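(* Let $0<\alpha<1$, $T>0$, $x_0\in(0,1)$ and $p\in L^\infty(0,1)$ be arbitrary. Let $a\in L^2(0,1)$ and let $u\in L^2(0,T;H^1(0,1))$ satisfy $u-a\in H_\alpha(0,T;H^{-1}(0,1))$ and $$\partial_t^\alpha(u(x,t)-a(x))-u_{xx}(x,t)+p(x)u(x,t)=0\quad\text{in }(0,1)\times(0,T).$$ If $J^\alpha u(x_0,\cdot)=J^\alpha u_x(x_0,\cdot)=0$ in $(0,T)$, then $u=0$ in $(0,1)\times(0,T)$ and $a=0$ in $(0,1)$.
   Context: For $\beta>0$, the Riemann-Liouville integral operator is $J^\beta w(t):=\frac1{\Gamma(\beta)}\int_0^t(t-\tau)^{\beta-1}w(\tau)\,d\tau$, acting in the time variable. For $0<\alpha<1$, $H^\alpha(0,T)$ is the Sobolev-Slobodecki space with norm $\left(\|w\|_{L^2(0,T)}^2+\int_0^T\int_0^T\frac{|w(t)-w(\tau)|^2}{|t-\tau|^{1+2\alpha}}\,dt\,d\tau\right)^{1/2}$, and $H_\alpha(0,T)$ is the closure of $\{w\in C^1[0,T];\,w(0)=0\}$ in $H^\alpha(0,T)$. It is known that $H_\alpha(0,T)=J^\alpha L^2(0,T)$. The operator $\partial_t^\alpha:=(J^\alpha)^{-1}$ with domain $H_\alpha(0,T)$ is the minimum closed extension in $L^2(0,T)$ of the Caputo derivative $w\mapsto\frac1{\Gamma(1-\alpha)}\int_0^t(t-\tau)^{-\alpha}w'(\tau)\,d\tau$ defined on $\{w\in C^1[0,T];\,w(0)=0\}$. For a Hilbert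 space $X$, $H_\alpha(0,T;X)$ and $\partial_t^\alpha$ on it are the $X$-valued analogues, i.e. $H_\alpha(0,T;X)=J^\alpha L^2(0,T;X)$ and $\partial_t^\alpha=(J^\alpha)^{-1}$. The equation is understood in $L^2(0,T;H^{-1}(0,1))$, where $H^{-1}(0,1)=(H^1_0(0,1))'$ and $u_{xx}$ is taken in the distribution sense; $a$ is regarded as a function constant in $t$. No boundary conditions are imposed at $x=0,1$. For such $u$ one has $J^\alpha u\in L^2(0,T;H^2(I))$ for every nonempty open interval $I$ with $\overline I\subset(0,1)$, so the traces $J^\alpha u(x_0,\cdot)$ and $J^\alpha u_x(x_0,\cdot)=(J^\alpha u)_x(x_0,\cdot)$ are well defined in $L^2(0,T)$. *)

(* Defs.v *)
From HB Require Import structures.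
From mathcomp Require Import all_boot all_order all_algebra.
From mathcomp Require Import all_classical all_reals all_analysis.
Set Implicit Arguments.
Unset Strict Implicit.
Unset Printing Implicit Defensive.
Import Order.TTheory GRing.Theory Num.Theory.
Import numFieldNormedType.Exports.
Local Open Scope classical_set_scope.
Local Open Scope ring_scope.

Definition Gamma (R : realType) (b : R) : R :=
  \int[lebesgue_measure]_(s in `]0, +oo[) (s `^ (b - 1) * expR (- s)).

(** A normed space of (classes of) functions or functionals is given by an
  ambient vector space [X] and an extended-valued seminorm
  [N : X -> \bar R]: the space is [{x | N x < +oo}], modulo [N x = 0].
  Functions with values in the space are functions [R -> X]; only their values
  at almost every time matter. *)
Section VectorValued.
Context (R : realType) (X : lmodType R) (N : X -> \bar R).
Local Notation mu := (@lebesgue_measure R).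

(** A simple function is a finite list of pairs [(A, c)], standing for the sum
  of the [1_A * c]. *)
Definition simple_fun := seq (set R * X).

Definition is_simple (D : set R) (s : simple_fun) : Prop :=
  forall e, e \in s ->
    [/\ measurable e.1, e.1 `<=` D, (mu e.1 < +oo)%E & (N e.2 < +oo)%E].

Definition simple_eval (s : simple_fun) (t : R) : X :=
  \sum_(e <- s) (\1_(e.1) t : R) *: e.2.

Definition simple_int (s : simple_fun) : X :=
  \sum_(e <- s) fine (mu e.1) *: e.2.

Definition strongly_measurable (D : set R) (F : R -> X) : Prop :=
  exists s : nat -> simple_fun, (forall n, is_simple D (s n)) /\
    {ae mu, forall t, D t ->
      (fun n => N (F t - simple_eval (s n) t)) @ \oo --> 0%E}.

Definition is_bochner_int (D : set R) (F : R -> X) (x : X) : Prop :=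
  (N x < +oo)%E /\
  exists s : nat -> simple_fun,
    [/\ forall n, is_simple D (s n),
        {ae mu, forall t, D t ->
          (fun n => N (F t - simple_eval (s n) t)) @ \oo --> 0%E},
        (fun n => \int[mu]_(t in D) N (F t - simple_eval (s n) t))%E
          @ \oo --> 0%E
      & (fun n => N (x - simple_int (s n))) @ \oo --> 0%E].

(** A representative of the Bochner integral ([0] if [F] is not integrable). *)
Definition bochner_int (D : set R) (F : R -> X) : X :=
  xget 0 [set x | is_bochner_int D F x].

Definition L2_valued (T : R) (F : R -> X) : Prop :=
  strongly_measurable `]0, T[ F /\
  (\int[mu]_(t in `]0%R, T[) (N (F t) * N (F t)) < +oo)%E.

Definition RL_integral (b : R) (F : R -> X) (t : R) : X :=
  (Gamma b)^-1 *:
    bochner_int `]0, t[ (fun tau => ((t - tau) `^ (b - 1)) *: F tau).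

Definition is_RL_preimage (alpha T : R) (w F : R -> X) : Prop :=
  L2_valued T F /\
  {ae mu, forall t, t \in `]0, T[ -> N (w t - RL_integral alpha F t) = 0%E}.

(** The space H_alpha(0,T;X) = J^alpha L^2(0,T;X). *)
Definition H_alpha (alpha T : R) (w : R -> X) : Prop :=
  exists F, is_RL_preimage alpha T w F.

(** The operator (J^alpha)^{-1} on [H_alpha]; the preimage is determined up to
  equality in the space at almost every time. *)
Definition dt_alpha (alpha T : R) (w : R -> X) : R -> X :=
  xget (fun=> 0) [set F | is_RL_preimage alpha T w F].

End VectorValued.

Section Sobolev.
Context (R : realType).
Local Notation mu := (@lebesgue_measure R).
Local Notation I01 := (`]0, 1[%classic : set R).

Definition in_L2 (f : R -> R) : Prop := f \_ I01 \in Lfun mu 2%:E.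

Definition in_Linfty (f : R -> R) : Prop := f \_ I01 \in Lfun mu +oo%E.

Definition test_fun (phi : R -> R) : Prop :=
  (forall n x, derivable (derive1n n phi) x 1) /\
  exists a b, [/\ 0 < a, b < 1 & forall x, x \notin `[a, b] -> phi x = 0].

Definition is_weak_deriv (f g : R -> R) : Prop :=
  forall phi, test_fun phi ->
    \int[mu]_(x in I01) (f x * derive1 phi x) = - \int[mu]_(x in I01) (g x * phi x).

Definition in_H1 (f : R -> R) : Prop :=
  in_L2 f /\ exists g, in_L2 g /\ is_weak_deriv f g.

(** A representative in L^2(0,1), unique almost everywhere ([0] if there is
  none). *)
Definition weak_deriv (f : R -> R) : R -> R :=
  xget (fun=> 0) [set g | in_L2 g /\ is_weak_deriv f g].

Definition H1norm (f : R -> R^o) : \bar R :=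
  if `[< in_H1 f >] then
    (Num.sqrt (\int[mu]_(x in I01) (f x ^+ 2)
               + \int[mu]_(x in I01) (weak_deriv f x ^+ 2)))%:E
  else +oo%E.

Definition in_H10 (v : R -> R^o) : Prop :=
  in_H1 v /\
  forall e : R, 0 < e -> exists2 phi, test_fun phi & (H1norm (v - phi)%R < e%:E)%E.

(** H^{-1}(0,1) is the dual of H^1_0(0,1). A functional is represented by a map
  on all functions, of which only the restriction to H^1_0 is relevant. *)
Definition functional := (R -> R^o) -> R^o.

Definition linear_on_H10 (l : functional) : Prop :=
  forall (c : R) v w, in_H10 v -> in_H10 w -> l (c *: v + w) = c * l v + l w.

Definition Hm1norm (l : functional) : \bar R :=
  if `[< linear_on_H10 l >] then
    ereal_sup [set `|l v|%:E | v in [set v | in_H10 v /\ (H1norm v <= 1)%E]]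
  else +oo%E.

Definition embed (f : R -> R) : functional :=
  fun v => \int[mu]_(x in I01) (f x * v x).

(** The second distributional derivative, as an element of H^{-1}(0,1); it
  exists for [f] in H^1 and is unique since test functions are dense in H^1_0. *)
Definition distr_dxx (f : R -> R) : functional :=
  xget 0 [set l : functional | (Hm1norm l < +oo)%E /\
    forall phi, test_fun phi ->
      l phi = \int[mu]_(x in I01) (f x * derive1n 2 phi x)].

(** [y] is the value at [x0] of a representative of [f] continuous near [x0];
  such a [y] is unique. *)
Definition is_trace (f : R -> R) (x0 y : R) : Prop :=
  exists e : R, 0 < e /\ exists g : R -> R,
    [/\ forall x, ball x0 e x -> {for x, continuous g},
        {ae mu, forall x, ball x0 e x -> f x = g x} & g x0 = y].

Definition trace (f : R -> R) (x0 : R) : R := xget 0 [set y | is_trace f x0 y].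

End Sobolev.

(* Main.v *)
(** For almost every [t] the function [v = J^alpha u(t)] is in H^1, satisfies
  [v'' = p v + u(t) - a], and has zero Cauchy data at [x0]; hence [v = I I (p v + u(t) - a)],
  where [I] integrates from [x0]. Testing with [g] and writing [B = I* I*], the moments
  [U_g(t) = <u(t), g>] satisfy [U_{B g} - <a, B g> = J^alpha U_{g - p B g}].
  Under the Laplace transform truncated at [T], [J^alpha] becomes [s^-alpha] up to an error
  of order [e^(- s T)], so that [g = h + (lam + p) B g] with [lam = s^alpha] expresses
  [<a, B g>] by the transform of [U_h]. This resolvent [g] is entire in [lam] of order 1/2:
  [f(lam) = <a, B g>] grows polynomially as [lam -> +oo], and tends to zero as
  [lam -> -oo], where the resolvent oscillates. A Phragmen-Lindelof argument, carried out
  on the polynomial partial sums of [f] by finite differences with binomial weights, gives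
  [f = 0]; hence [<a, B g> = 0] for all [g], and [a = 0]. Then the transform of [U_h] is
  [O(e^(- s (T - d)))] for every [d > 0], so [U_h = 0] on [0, T] for every [h], which
  means [u = 0]. *)

Require Import Defs.
From mathcomp Require Import all_boot all_order all_algebra.
From mathcomp Require Import all_classical all_reals all_analysis.
From mathcomp Require Import measurable_realfun ess_sup_inf.
From mathcomp Require Import ring lra zify.
Set Implicit Arguments.
Unset Strict Implicit.
Unset Printing Implicit Defensive.
Import Order.TTheory GRing.Theory Num.Theory.
Import numFieldNormedType.Exports.
Local Open Scope classical_set_scope.
Local Open Scope ring_scope.

(** With no boundary conditions at 0 and 1 there is no eigenfunction expansion. The Cauchy data at
    [x0] supply a Volterra operator instead: its resolvent exists for every real [lam], and [m]
    factors [B] mean [2 m] integrations and a divisor [(2 m)!], whence the order 1/2. Polynomial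
    growth as [lam -> +oo] holds because [s = lam^(1/alpha) >= lam] for [lam >= 1]: the error
    [e^(- s T)] absorbs a resolvent that grows slower than every exponential. The finite differences
    work as follows. A polynomial of degree below [2 N] has zero difference of order [2 N], so its
    value at the central node is a combination of its values at the other nodes, with coefficients
    at most 1 in modulus. Partial sums with [2 n^4] terms are accurate up to [|lam|] of order [n^7],
    far enough for [2 n^4] nodes at spacing [n^3]; growth [|lam|^k] is removed beforehand by divided
    differences. Functions of time are tested against functionals, so transforms and Fubini concern
    scalar functions only; the price is that null sets of times must be kept independent of the test
    function. *)

Lemma ae_imp d (T : measurableType d) (R : realType)
    (nu : {measure set T -> \bar R}) (P Q : T -> Prop) :
  {ae nu, forall x, P x} -> (forall x, P x -> Q x) -> {ae nu, forall x, Q x}.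
Proof. by move=> aeP PQ; apply: filterS aeP. Qed.

Lemma ae_imp2 d (T : measurableType d) (R : realType)
    (nu : {measure set T -> \bar R}) (P P' Q : T -> Prop) :
  {ae nu, forall x, P x} -> {ae nu, forall x, P' x} ->
  (forall x, P x -> P' x -> Q x) -> {ae nu, forall x, Q x}.
Proof. by move=> aeP aeP' PQ; apply: filterS2 aeP aeP'. Qed.

(** * Comparison of integrals almost everywhere *)

Section NonmeasurableIntegrands.
Context d (T : measurableType d) (R : realType).
Variable nu : {measure set T -> \bar R}.
Import HBNNSimple.
Local Open Scope ereal_scope.

(* The integral of a nonnegative function is the supremum of the integrals of
   the simple functions below it, so measurability is not needed here. *)
Lemma ae_le_integral_nomeas (D : set T) (f g : T -> \bar R) :
  (forall x, D x -> 0 <= f x) -> (forall x, D x -> 0 <= g x) ->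
  {ae nu, forall x, D x -> f x <= g x} ->
  \int[nu]_(x in D) f x <= \int[nu]_(x in D) g x.
Proof.
move=> f0 g0 [N [mN N0 fgN]].
rewrite !ge0_integralE//; apply: ge_ereal_sup => _ [h hf <-].
have mCN : measurable (~` N) by exact: measurableC.
(* A simple function below [f] becomes one below [g] once it is set to zero on the exceptional null
   set [N]; its integral does not change. *)
apply: (@le_trans _ _ (sintegral nu (proj_nnsfun h mCN))); last first.
  apply: ereal_sup_ubound; exists (proj_nnsfun h mCN); [move=> x|by []].
  rewrite (_ : proj_nnsfun h mCN x = (h \_ (~` N)) x); last by rewrite mrestrict.
  rewrite patchE; case: ifPn => [xN|_]; last first.
    by rewrite patchE; case: ifPn => // /set_mem /g0.
  have {}xN := set_mem xN.
  apply: (le_trans (hf x)); rewrite !patchE; case: ifPn => // xD.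
  apply: contrapT => fgx; apply: xN; apply: fgN => /=.
  by move=> H; apply: fgx; apply: H; exact: set_mem.
rewrite -!integralT_nnsfun.
have mh : measurable_fun [set: T] (EFin \o (h : T -> R)) by exact/measurable_EFinP.
rewrite (@ge0_negligible_integral _ _ _ nu setT N)//=; last first.
  by move=> x _; rewrite lee_fin.
rewrite setTD integral_mkcond.
rewrite (_ : \int[nu]_x ((fun x0 => (h x0)%:E) \_ (~` N)) x =
   \int[nu]_x (proj_nnsfun h mCN x)%:E)//.
apply: eq_integral => x _.
rewrite (_ : proj_nnsfun h mCN x = (h \_ (~` N)) x); last by rewrite mrestrict.
by rewrite !patchE; case: ifPn.
Qed.

(** Split into positive and negative parts. Moments of [u] and chosen weak derivatives are known
    only up to null sets, and this replaces them under the integral sign. *)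
Lemma ae_eq_integral_nomeas (D : set T) (f g : T -> \bar R) :
  {ae nu, forall x, D x -> f x = g x} ->
  \int[nu]_(x in D) f x = \int[nu]_(x in D) g x.
Proof.
have ge0 (f1 g1 : T -> \bar R) : (forall x, D x -> 0 <= f1 x) ->
    (forall x, D x -> 0 <= g1 x) -> {ae nu, forall x, D x -> f1 x = g1 x} ->
    \int[nu]_(x in D) f1 x = \int[nu]_(x in D) g1 x.
  move=> f0 g0 fg; apply/eqP; rewrite eq_le !ae_le_integral_nomeas//.
  - by apply: filterS fg => x fg Dx; rewrite fg.
  - by apply: filterS fg => x fg Dx; rewrite fg.
move=> fg; rewrite [LHS]integralE [RHS]integralE; congr (_ - _).
- apply: ge0 => //; apply: filterS fg => x fg Dx.
  by rewrite !funeposE fg.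
- apply: ge0 => //; apply: filterS fg => x fg Dx.
  by rewrite !funenegE fg.
Qed.

Lemma ae_eq_Rintegral (D : set T) (f g : T -> R) :
  {ae nu, forall x, D x -> f x = g x} ->
  (\int[nu]_(x in D) f x = \int[nu]_(x in D) g x)%R.
Proof.
move=> fg; congr fine; apply: ae_eq_integral_nomeas.
by apply: filterS fg => x fg Dx; rewrite fg.
Qed.

End NonmeasurableIntegrands.

(** * Real-valued integrals and Fubini's theorem *)

Section RealIntegrals.
Context (R : realType).
Local Notation mu := (@lebesgue_measure R).

Definition rintegrable (D : set R) (f : R -> R) := mu.-integrable D (EFin \o f).

Lemma rintegrableP (D : set R) (f : R -> R) : measurable_fun D f ->
  (\int[mu]_(x in D) `|f x|%:E < +oo)%E -> rintegrable D f.
Proof. by move=> mf f1; apply/integrableP; split; [exact/measurable_EFinP|]. Qed.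

Lemma rintegrable_measurable (D : set R) (f : R -> R) :
  rintegrable D f -> measurable_fun D f.
Proof. by move=> /measurable_int/measurable_EFinP. Qed.

Lemma rintegrable_lty (D : set R) (f : R -> R) : rintegrable D f ->
  (\int[mu]_(x in D) `|f x|%:E < +oo)%E.
Proof. by move=> /integrableP[]. Qed.

Lemma ae_neq (c : R) : {ae mu, forall x, x <> c}.
Proof.
apply: (@negligibleS _ _ _ mu [set c]) => [x /= /contrapT//|].
by apply/negligibleP => //; exact: lebesgue_measure_set1.
Qed.

Lemma rintegrable_le (D : set R) (f g : R -> R) : measurable D ->
  measurable_fun D f -> rintegrable D g ->
  (forall x, D x -> `|f x| <= g x) -> rintegrable D f.
Proof.
move=> mD mf ig fg; apply: (@le_integrable _ _ _ mu D mD _ (EFin \o g)) => //.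
  exact/measurable_EFinP.
by move=> x Dx /=; rewrite lee_fin (le_trans (fg _ Dx))// ler_norm.
Qed.

Lemma rintegrable_norm (D : set R) (f : R -> R) : measurable D ->
  rintegrable D f -> rintegrable D (fun x => `|f x|).
Proof. by move=> mD /(@integrable_norm _ _ _ mu). Qed.

Lemma rintegrableD (D : set R) (f g : R -> R) : measurable D ->
  rintegrable D f -> rintegrable D g -> rintegrable D (fun x => f x + g x).
Proof. by move=> mD i1 i2; exact: (@integrableD _ _ _ mu D mD _ _ i1 i2). Qed.

Lemma rintegrableB (D : set R) (f g : R -> R) : measurable D ->
  rintegrable D f -> rintegrable D g -> rintegrable D (fun x => f x - g x).
Proof. by move=> mD i1 i2; exact: (@integrableB _ _ _ mu D mD _ _ i1 i2). Qed.

Lemma rintegrableZl (D : set R) (c : R) (f : R -> R) : measurable D ->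
  rintegrable D f -> rintegrable D (fun x => c * f x).
Proof. by move=> mD i1; exact: (@integrableZl _ _ _ mu D mD c _ i1). Qed.

Lemma rintegrable_bddM (D : set R) (C : R) (f g : R -> R) : measurable D ->
  measurable_fun D g -> (forall x, D x -> `|g x| <= C) ->
  rintegrable D f -> rintegrable D (fun x => g x * f x).
Proof.
move=> mD mg gC ift.
apply: (@rintegrable_le _ _ (fun x => C * `|f x|)) => //.
- by apply: measurable_funM => //; exact: rintegrable_measurable.
- by apply: rintegrableZl => //; exact: rintegrable_norm.
- by move=> x Dx; rewrite normrM ler_wpM2r// gC.
Qed.

Lemma rintZl (D : set R) (c : R) (f : R -> R) : measurable D -> rintegrable D f ->
  \int[mu]_(x in D) (c * f x) = c * \int[mu]_(x in D) f x.
Proof. by move=> mD i1; exact: (@RintegralZl _ _ _ mu D f c mD i1). Qed.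

Lemma rintD (D : set R) (f g : R -> R) : measurable D ->
  rintegrable D f -> rintegrable D g ->
  \int[mu]_(x in D) (f x + g x) = \int[mu]_(x in D) f x + \int[mu]_(x in D) g x.
Proof. by move=> mD i1 i2; exact: (@RintegralD _ _ _ mu D f g mD i1 i2). Qed.

Lemma rintB (D : set R) (f g : R -> R) : measurable D ->
  rintegrable D f -> rintegrable D g ->
  \int[mu]_(x in D) (f x - g x) = \int[mu]_(x in D) f x - \int[mu]_(x in D) g x.
Proof. by move=> mD i1 i2; exact: (@RintegralB _ _ _ mu D f g mD i1 i2). Qed.

Lemma le_rint (D : set R) (f g : R -> R) : measurable D ->
  rintegrable D f -> rintegrable D g -> (forall x, D x -> f x <= g x) ->
  \int[mu]_(x in D) f x <= \int[mu]_(x in D) g x.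
Proof. by move=> mD i1 i2 fg; exact: (@le_Rintegral _ (measurableTypeR R) R mu D f g mD i1 i2 fg). Qed.

Lemma le_norm_rint (D : set R) (f : R -> R) : measurable D -> rintegrable D f ->
  `|\int[mu]_(x in D) f x| <= \int[mu]_(x in D) `|f x|.
Proof. by move=> mD i1; exact: (@le_normr_Rintegral _ _ _ mu D f mD i1). Qed.

Lemma le_norm_rint_le (D : set R) (f g : R -> R) : measurable D ->
  measurable_fun D f -> rintegrable D g -> (forall x, D x -> `|f x| <= g x) ->
  `|\int[mu]_(x in D) f x| <= \int[mu]_(x in D) g x.
Proof.
move=> mD mf ig fg; have ift := rintegrable_le mD mf ig fg.
apply: le_trans (le_norm_rint mD ift) _; apply: le_rint => //.
exact: rintegrable_norm.
Qed.

Lemma eq_rintegrable (D : set R) (f g : R -> R) : measurable D -> (forall x, D x -> f x = g x) ->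
  rintegrable D f -> rintegrable D g.
Proof.
by move=> mD fg; apply: eq_integrable => // x /set_mem Dx /=; rewrite fg.
Qed.

Lemma eq_rint (D : set R) (f g : R -> R) : (forall x, D x -> f x = g x) ->
  \int[mu]_(x in D) f x = \int[mu]_(x in D) g x.
Proof. by move=> fg; apply: eq_Rintegral => x /set_mem Dx; exact: fg. Qed.

(** If [f] is not integrable then neither is [c * f], as [c != 0]; both extended integrals are then
    infinite and [fine] sends them to 0. *)
Lemma RintegralZl_meas (D : set R) (c : R) (f : R -> R) : measurable D ->
  c != 0 -> measurable_fun D f ->
  \int[mu]_(x in D) (c * f x) = c * \int[mu]_(x in D) f x.
Proof.
move=> mD c0 mf; have [ift|nif] := pselect (rintegrable D f).
  by rewrite RintegralZl.
have fin0 (g : R -> R) : measurable_fun D g -> ~ rintegrable D g ->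
    \int[mu]_(x in D) g x = 0.
  move=> mg ng; have : (\int[mu]_(x in D) (g x)%:E)%E \isn't a fin_num.
    apply/negP; rewrite -integral_fin_num_abs// => H; apply: ng.
    by apply: rintegrableP => //; exact: H.
  by rewrite /Rintegral; case: (\int[mu]_(x in D) (g x)%:E)%E.
rewrite (fin0 f)// mulr0 fin0//; first exact: measurable_funM.
move=> /(rintegrableZl c^-1 mD) H; apply: nif; move: H.
by under eq_fun do rewrite mulKf//.
Qed.

Lemma integrable_patch (D : set R) (g : R -> \bar R) : measurable D ->
  mu.-integrable setT (g \_ D) -> mu.-integrable D g.
Proof. by move=> mD ig; apply/integrable_mkcond. Qed.

(** The indicators of [A] and [B] are absorbed into the integrand, which reduces the rectangle to
    the whole plane. *)
Lemma Rfubini (A B : set R) (F : R * R -> R) :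
  measurable A -> measurable B -> measurable_fun [set: R * R] F ->
  (\int[mu]_(x in A) \int[mu]_(y in B) `|F (x, y)|%:E < +oo)%E ->
  [/\ rintegrable A (fun x => \int[mu]_(y in B) F (x, y)),
      rintegrable B (fun y => \int[mu]_(x in A) F (x, y)),
      {ae mu, forall x, A x -> rintegrable B (fun y => F (x, y))},
      {ae mu, forall y, B y -> rintegrable A (fun x => F (x, y))} &
      \int[mu]_(x in A) \int[mu]_(y in B) F (x, y) =
      \int[mu]_(y in B) \int[mu]_(x in A) F (x, y)].
Proof.
move=> mA mB mF F1.
pose G (z : R * R) : \bar R := (F z * \1_A z.1 * \1_B z.2)%:E.
have mG : measurable_fun [set: R * R] G.
  apply/measurable_EFinP; apply: measurable_funM; first apply: measurable_funM => //.
  - by apply: measurableT_comp; [exact: measurable_indic|exact: measurable_fst].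
  - by apply: measurableT_comp; [exact: measurable_indic|exact: measurable_snd].
have EB x : (\int[mu]_y `|G (x, y)| =
     (\int[mu]_(y in B) `|F (x, y)|%:E) * (\1_A x)%:E)%E.
  rewrite indicE; case: (boolP (x \in A)) => xA; last first.
    rewrite mule0 integral0_eq// => y _.
    by rewrite /G/= indicE (negbTE xA) mulr0 mul0r normr0.
  rewrite mule1 [in RHS]integral_mkcond; apply: eq_integral => y _.
  rewrite /G/= !indicE xA mulr1 patchE; case: ifPn => yB; last by rewrite mulr0 normr0.
  by rewrite mulr1.
have iG : (mu \x mu)%E.-integrable setT G.
  apply/integrable12ltyP; [exact: mG|].
  apply: le_lt_trans F1; rewrite [leRHS]integral_mkcond.
  rewrite le_eqVlt; apply/orP; left; apply/eqP; apply: eq_integral => x _.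
  rewrite EB patchE indicE; case: ifPn => _; first by rewrite mule1.
  by rewrite mule0.
have GF x : fubini_F mu G x = ((fun x => \int[mu]_(y in B) (F (x, y))%:E)%E \_ A) x.
  rewrite /fubini_F patchE; case: ifPn => xA; last first.
    rewrite integral0_eq// => y _.
    by rewrite /G/= indicE (negbTE xA) mulr0 mul0r.
  rewrite [in RHS]integral_mkcond; apply: eq_integral => y _.
  rewrite /G/= !indicE xA mulr1 patchE; case: ifPn => yB; last by rewrite mulr0.
  by rewrite mulr1.
have GG y : fubini_G mu G y = ((fun y => \int[mu]_(x in A) (F (x, y))%:E)%E \_ B) y.
  rewrite /fubini_G patchE; case: ifPn => yB; last first.
    rewrite integral0_eq// => x _.
    by rewrite /G/= [X in _ * X]indicE (negbTE yB) mulr0.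
  rewrite [in RHS]integral_mkcond; apply: eq_integral => x _.
  rewrite /G/= !indicE yB mulr1 patchE; case: ifPn => xA; last by rewrite mulr0.
  by rewrite mulr1.
(* An integrable function is finite almost everywhere, so inserting [fine] does not change its
   integral; this turns the inner integrals into real numbers. *)
have aux (D : set R) (g : R -> \bar R) : measurable D -> mu.-integrable setT (g \_ D) ->
    rintegrable D (fun x => fine (g x)) /\
    \int[mu]_(x in D) fine (g x) = fine (\int[mu]_x (g \_ D) x)%E.
  move=> mD ig0; have ig := integrable_patch mD ig0; split.
    apply: rintegrableP.
      by apply: measurableT_comp => //; exact: measurable_int ig.
    have /integrableP[_] := ig; apply: le_lt_trans.
    apply: ae_le_integral_nomeas => //; apply: aeW => x _.
    by case: (g x) => [r| |] //=; rewrite leey.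
  rewrite -integral_mkcond; congr fine; apply: ae_eq_integral_nomeas.
  have := @integrable_ae _ _ _ mu D mD g ig; apply: filterS => x h Dx.
  by rewrite fineK// h.
have sub (D E : set R) (H : R -> R -> R) (k : R -> R -> \bar R) :
   measurable D -> measurable E -> {ae mu, forall x, mu.-integrable setT (k x)} ->
   (forall x y, x \in D -> k x y = ((EFin \o H x) \_ E) y) ->
   {ae mu, forall x, D x -> rintegrable E (H x)}.
  move=> mD mE ikx kH; apply: (ae_imp ikx) => x ik Dx.
  apply: integrable_patch => //; rewrite (_ : _ \_ _ = k x)//.
  by apply/funext => y; rewrite kH// inE.
have iF : mu.-integrable setT ((fun x => \int[mu]_(y in B) (F (x, y))%:E)%E \_ A).
  by rewrite (_ : _ \_ _ = fubini_F mu G); [exact: integrable_fubini_F|exact/funext].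
have iG' : mu.-integrable setT ((fun y => \int[mu]_(x in A) (F (x, y))%:E)%E \_ B).
  rewrite (_ : _ \_ _ = fubini_G mu G); last exact/funext.
  apply/integrableP; split; first exact: (measurable_fubini_G iG).
  have /integrable21ltyP G1 := iG; apply: le_lt_trans (G1 mG).
  apply: ae_le_integral_nomeas => //.
    by move=> y _; exact: integral_ge0.
  apply: aeW => y _; apply: le_abse_integral => //.
  by apply: measurableT_comp mG _; exact: measurable_pair2.
have [i1 e1] := aux _ _ mA iF.
have [i2 e2] := aux _ _ mB iG'.
split; [exact: i1|exact: i2| | |].
- apply: (sub A B (fun x y => F (x, y)) (fun x y => G (x, y))) => //.
    exact: ae_integrable1 iG.
  move=> x y xA; rewrite /G/= !indicE xA mulr1 patchE; case: ifPn => _.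
    by rewrite mulr1.
  by rewrite mulr0.
- apply: (sub B A (fun y x => F (x, y)) (fun y x => G (x, y))) => //.
    exact: ae_integrable2 iG.
  move=> y x yB; rewrite /G/= !indicE yB mulr1 patchE; case: ifPn => _.
    by rewrite mulr1.
  by rewrite mulr0.
- rewrite e1 e2; congr fine; apply: (etrans _ (etrans (Fubini iG) _)).
  + by apply: eq_integral => x _; rewrite -GF.
  + by apply: eq_integral => y _; rewrite -GG.
Qed.

End RealIntegrals.

(** * Affine change of variables *)

Section AffineSubstitution.
Context (R : realType).
Local Notation mu := (@lebesgue_measure R).

(** Multiplied by [c], the pushforward gives each interval []a, b]] its length, hence is Lebesgue
    measure by uniqueness. *)
Lemma lebesgue_measure_affine (c d : R) (A : set R) : 0 < c -> measurable A ->
  pushforward mu ((fun x => c * x + d) : _ -> measurableTypeR R) A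
  = (c^-1%:E * mu A)%E.
Proof.
move=> c0 mA.
have mphi : measurable_fun [set: measurableTypeR R]
  ((fun x => c * x + d) : measurableTypeR R -> measurableTypeR R).
  exact: measurable_funD.
pose nu := mscale (NngNum (ltW c0)) (pushforward mu
   ((fun x => c * x + d) : measurableTypeR R -> measurableTypeR R)).
have H : mu A = nu mphi A.
  apply: lebesgue_measure_unique => //= _ [[a b]] _ <-.
  rewrite /nu/= /mscale/= /pushforward.
  rewrite (_ : _ @^-1` _ = `](a - d) / c, (b - d) / c]%classic); last first.
    apply/seteqP; split => x /=; rewrite !in_itv/= ltr_pdivrMr// ler_pdivlMr//;
      by rewrite ltrBlDr lerBrDr (mulrC x).
  rewrite !lebesgue_measure_itv/= !lte_fin ltr_pM2r ?invr_gt0// ltrD2r.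
  case: ifPn => ab; last by rewrite mule0.
  rewrite -!EFinD -EFinM; congr EFin.
  by field; rewrite gt_eqF.
rewrite H /nu/= /mscale/= muleA -EFinM mulVf ?mul1e//.
by rewrite gt_eqF.
Qed.

Lemma ge0_integral_affine (c d : R) (f : R -> \bar R) : 0 < c ->
  measurable_fun [set: R] f -> (forall x, 0 <= f x)%E ->
  (\int[mu]_x f (c * x + d)%R = c^-1%:E * \int[mu]_x f x)%E.
Proof.
move=> c0 mf f0.
have mphi : measurable_fun [set: measurableTypeR R]
  ((fun x => c * x + d) : measurableTypeR R -> measurableTypeR R).
  exact: measurable_funD.
have := @ge0_integral_pushforward _ _ _ (measurableTypeR R) R _ mphi mu setT f
  measurableT mf (fun y _ => f0 y).
rewrite preimage_setT => <-.
have ci0 : 0 <= c^-1 by rewrite invr_ge0 ltW.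
rewrite -(ge0_integral_mscale mu measurableT (NngNum ci0))//.
by apply: eq_measure_integral => A mA _; exact: (lebesgue_measure_affine d c0 mA).
Qed.

End AffineSubstitution.

(** * The Riemann-Liouville kernel and its Laplace transform *)

Section PowerIntegrals.
Context (R : realType) (alpha : R).
Hypothesis alpha0 : 0 < alpha < 1.
Local Notation mu := (@lebesgue_measure R).

Lemma measurable_powR1 (D : set R) : measurable_fun D (fun r : R => r `^ (alpha - 1)).
Proof. by apply: measurable_funTS; exact: measurable_powR. Qed.

Lemma integral_powR_itv (a b : R) : 0 < a -> a < b ->
  (\int[mu]_(r in `[a, b]) (r `^ (alpha - 1))%:E =
   ((b `^ alpha - a `^ alpha) / alpha)%:E)%E.
Proof.
have [al0 al1] := andP alpha0 => a0 ab.
have aN0 : alpha != 0 by rewrite gt_eqF.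
have der (x : R) : 0 < x -> is_derive x 1 (fun r : R => r `^ alpha / alpha) (x `^ (alpha - 1)).
  move=> x0.
  have D1 : derivable (fun r : R => r `^ alpha) x 1.
    by apply: derivable_powR; rewrite in_itv/= x0.
  have -> : x `^ (alpha - 1) = alpha^-1 *: (alpha * x `^ (alpha - 1)).
    by rewrite /GRing.scale/= mulrA mulVf// mul1r.
  have -> : (fun r : R => r `^ alpha / alpha) = (fun r => alpha^-1 *: (r `^ alpha : R^o)).
    by apply/funext => r; rewrite /GRing.scale/= mulrC.
  apply: is_deriveZ.
  apply: DeriveDef => //; rewrite -derive1E powR_derive1// in_itv/= x0//.
have con (x : R) : 0 < x -> {for x, continuous (fun r : R => r `^ (alpha - 1))}.
  move=> x0; apply: differentiable_continuous; apply/derivable1_diffP.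
  by apply: derivable_powR; rewrite in_itv/= x0.
have conF (x : R) : 0 < x -> {for x, continuous (fun r : R => r `^ alpha / alpha)}.
  move=> x0; apply: differentiable_continuous; apply/derivable1_diffP.
  by apply: ex_derive; exact: der.
rewrite (@continuous_FTC2 _ _ (fun r => r `^ alpha / alpha))//.
- by rewrite -EFinB -mulrBl.
- apply: continuous_in_subspaceT => x /set_mem /=; rewrite in_itv/= => /andP[ax _].
  by apply: con; exact: lt_le_trans ax.
- split.
  + move=> x; rewrite in_itv/= => /andP[ax _]; apply: ex_derive.
    by apply: der; exact: lt_trans ax.
  + apply: cvg_at_right_filter; exact: conF.
  + apply: cvg_at_left_filter; apply: conF; exact: lt_trans ab.
- move=> x; rewrite in_itv/= => /andP[ax _]; rewrite derive1E.
  by apply: derive_val; apply: der; exact: lt_trans ax.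
Qed.

End PowerIntegrals.

Section RiemannLiouvilleKernel.
Context (R : realType) (alpha : R).
Hypothesis alpha0 : 0 < alpha < 1.
Local Notation mu := (@lebesgue_measure R).

(** The kernel of [J^alpha] up to the factor [1 / Gamma alpha]. The indicator makes it causal, so
    that integrals over []0, t[] become convolutions on the whole line. *)
Definition rlk (r : R) : R := (r `^ (alpha - 1)) * \1_(`]0, +oo[%classic) r.

Lemma rlk_ge0 r : 0 <= rlk r.
Proof. by rewrite /rlk mulr_ge0// powR_ge0. Qed.

Lemma rlkE r : 0 < r -> rlk r = r `^ (alpha - 1).
Proof. by move=> r0; rewrite /rlk indicE mem_set ?mulr1//= in_itv/= r0. Qed.

Lemma rlk0 r : r <= 0 -> rlk r = 0.
Proof.
move=> r0; rewrite /rlk indicE memNset ?mulr0//= in_itv/= andbT.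
by apply/negP; rewrite -leNgt.
Qed.

Lemma measurable_rlk : measurable_fun [set: R] rlk.
Proof.
apply: measurable_funM; first exact: measurable_powR.
exact: measurable_indic.
Qed.

(** The exponent [alpha - 1] is negative. This later compares the kernel started at [x] with the one
    started at [T]. *)
Lemma rlk_decr (r c : R) : 0 < r -> 0 <= c -> rlk (r + c) <= rlk r.
Proof.
have [a0 a1] := andP alpha0; move=> r0 c0; have rc0 : 0 < r + c by rewrite ltr_wpDr.
rewrite !rlkE// -(opprB 1 alpha) !powRN lef_pV2 ?posrE ?powR_gt0//.
by apply: ge0_ler_powR; rewrite ?nnegrE ?subr_ge0 ?lerDl//; exact: ltW.
Qed.

Lemma rlk_le1 (r : R) : 1 <= r -> rlk r <= 1.
Proof.
have [a0 a1] := andP alpha0; move=> r1; rewrite rlkE; last exact: lt_le_trans r1.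
by rewrite -[leRHS](powRr0 r) ler_powR// subr_le0 ltW.
Qed.

Lemma rlk_ge1 (r : R) : 0 < r <= 1 -> 1 <= rlk r.
Proof.
have [a0 a1] := andP alpha0; move=> /andP[r0 r1]; rewrite rlkE//.
by rewrite -{1}(powRr0 r) ger_powR ?r0// subr_le0 ltW.
Qed.

Lemma integral_powR_01 :
  (\int[mu]_(r in `]0%R, 1%R]) (r `^ (alpha - 1))%:E <= (alpha^-1)%:E)%E.
Proof.
have [a0 a1] := andP alpha0.
(* Monotone convergence over intervals that avoid the singularity; the index [n.+2] keeps the left
   end below 1. *)
pose F n : set R := `[n.+2%:R^-1, 1%R]%classic.
have FE : `]0%R, 1%R]%classic = \bigcup_n F n.
  apply/seteqP; split => [x|x [n _]] /=; rewrite /F/= !in_itv/=.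
    move=> /andP[x0 x1]; exists (Num.truncn x^-1) => //.
    rewrite /F/= in_itv/= x1 andbT invf_ple ?posrE//; apply: ltW.
    have := truncnS_gt x^-1; move=> /lt_trans; apply.
    by rewrite ltr_nat.
  move=> /andP[nx ->]; rewrite andbT; exact: lt_le_trans nx.
rewrite FE.
have := @ge0_nondecreasing_set_cvg_integral _ (measurableTypeR R) R F (fun r => (r `^ (alpha - 1))%:E) mu.
move=> /(_ _ _ _ _) H.
have cv : (\int[mu]_(x in F i) (x `^ (alpha - 1))%:E)%E @[i --> \oo] -->
    (\int[mu]_(x in \bigcup_i F i) (x `^ (alpha - 1))%:E)%E.
  apply: H.
  - move=> m n mn; apply/subsetPset => x; rewrite /F/= !in_itv/= => /andP[mx ->].
    rewrite andbT; apply: le_trans mx; rewrite lef_pV2 ?posrE//.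
    by rewrite ler_nat.
  - by move=> i; exact: measurable_itv.
  - by move=> i; apply/measurable_EFinP; exact: measurable_powR1.
  - by move=> i x _; rewrite lee_fin powR_ge0.
rewrite -(cvg_lim _ cv)//; apply: lime_le; first by apply/cvg_ex; eexists; exact: cv.
near=> n; rewrite /F integral_powR_itv//; last first.
  by rewrite invf_lt1// ltr1n.
by rewrite powR1 lee_fin ler_pdivrMr// mulVf ?gt_eqF// gerBl powR_ge0.
Unshelve. all: by end_near. Qed.

Definition laplace_rlk (s : R) := (\int[mu]_r (expR (- (s * r)) * rlk r)%:E)%E.

Lemma measurable_expR_mul d (S : measurableType d) (s : R) (D : set S) (g : S -> R) :
  measurable_fun D g -> measurable_fun D (fun x => expR (- (s * g x))).
Proof.
move=> mg; apply: measurableT_comp; first exact: measurable_expR.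
apply: measurableT_comp; first exact: oppr_measurable.
by apply: measurable_funM => //; exact: measurable_cst.
Qed.

Lemma measurable_expR_lin (s : R) (D : set R) :
  measurable_fun D (fun r => expR (- (s * r))).
Proof.
by apply: measurable_expR_mul; exact: measurable_id.
Qed.

Lemma measurable_laplace_rlk (s : R) :
  measurable_fun [set: R] (fun r => expR (- (s * r)) * rlk r).
Proof. by apply: measurable_funM; [exact: measurable_expR_lin|exact: measurable_rlk]. Qed.

(** The kernel is homogeneous of degree [alpha - 1], and replacing [r] by [s * r] brings out one
    more factor [s]. The identity lives in the extended reals, so finiteness is left to the case
    [s = 1]. *)
Lemma laplace_rlk_scale (s : R) : 0 < s ->
  laplace_rlk s = ((s `^ (- alpha))%:E * laplace_rlk 1)%E.
Proof.
move=> s0.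
have := @ge0_integral_affine R s 0 (fun x => (expR (- (1 * x)) * rlk x)%:E) s0.
move=> /(_ _ _) -H.
have {H} : (\int[mu]_x (expR (- (1 * (s * x + 0))) * rlk (s * x + 0))%:E =
   (s^-1)%:E * laplace_rlk 1)%E.
  apply: H; first by apply/measurable_EFinP; exact: measurable_laplace_rlk.
  by move=> x; rewrite lee_fin mulr_ge0// ?expR_ge0// rlk_ge0.
have -> : (\int[mu]_x (expR (- (1 * (s * x + 0))) * rlk (s * x + 0))%:E =
   (s `^ (alpha - 1))%:E * laplace_rlk s)%E.
  rewrite -ge0_integralZl_EFin//; last 3 first.
  - by move=> x _; rewrite lee_fin mulr_ge0// ?expR_ge0// rlk_ge0.
  - by apply/measurable_EFinP; exact: measurable_laplace_rlk.
  - exact: powR_ge0.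
  apply: eq_integral => x _; rewrite -EFinM; congr EFin; rewrite mul1r addr0.
  have [x0|x0] := ltP 0 x.
    by rewrite !rlkE ?mulr_gt0// powRM ?ltW// mulrCA.
  by rewrite !rlk0 ?mulr0// pmulr_rle0.
move=> H; have : ((s `^ (1 - alpha))%:E * ((s `^ (alpha - 1))%:E * laplace_rlk s) =
   (s `^ (1 - alpha))%:E * ((s^-1)%:E * laplace_rlk 1))%E by rewrite H.
rewrite !muleA -!EFinM -powRD; last by rewrite (gt_eqF s0) implybT.
rewrite -powR_inv1 ?ltW// -powRD; last by rewrite (gt_eqF s0) implybT.
rewrite (_ : 1 - alpha + (alpha - 1) = 0); last by ring.
by rewrite powRr0 mul1e => ->; congr (((_ `^ _)%:E * _)%E); ring.
Qed.

Lemma laplace_rlk1_lty : (laplace_rlk 1 < +oo)%E.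
Proof.
rewrite /laplace_rlk.
(* Up to 1 the exponential is at most 1 and the power is integrable; beyond 1 the power is at most 1
   and the exponential density has mass 1. *)
pose h (r : R) : R := (r `^ (alpha - 1)) * \1_(`]0, 1]%classic) r + exponential_pdf 1 r.
apply: (@le_lt_trans _ _ (\int[mu]_r (h r)%:E)%E).
  apply: ae_le_integral_nomeas.
  - by move=> x _; rewrite lee_fin mulr_ge0 ?expR_ge0 ?rlk_ge0.
  - move=> x _; rewrite lee_fin addr_ge0// ?mulr_ge0 ?powR_ge0//.
    exact: exponential_pdf_ge0.
  - apply: aeW => x _; rewrite lee_fin /h.
    have [x0|x0] := leP x 0.
      rewrite rlk0// mulr0 addr_ge0// ?mulr_ge0 ?powR_ge0//.
      exact: exponential_pdf_ge0.
    have [x1|x1] := leP x 1.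
      rewrite rlkE// indicE mem_set/= ?in_itv/= ?x0// mulr1.
      apply: ler_wpDr; first exact: exponential_pdf_ge0.
      by rewrite ler_piMl ?powR_ge0// mul1r -[leRHS]expR0 ler_expR oppr_le0 ltW.
    rewrite indicE memNset/=; last by rewrite in_itv/= x0/=; apply/negP; rewrite -ltNge.
    rewrite mulr0 add0r exponential_pdfE; last exact: ltW.
    rewrite mul1r mulN1r mul1r.
    by rewrite ler_piMr ?expR_ge0// rlk_le1// ltW.
rewrite /h; under eq_integral do rewrite EFinD.
rewrite ge0_integralD//=; last 4 first.
- by move=> x _; rewrite lee_fin mulr_ge0 ?powR_ge0.
- by apply/measurable_EFinP; apply: measurable_funM; [exact: measurable_powR1|exact: measurable_indic].
- by move=> x _; rewrite lee_fin exponential_pdf_ge0.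
- by apply/measurable_EFinP; exact: measurable_exponential_pdf.
rewrite integral_exponential_pdf// lte_add_pinfty ?ltry//.
apply: le_lt_trans (ltry alpha^-1); apply: le_trans integral_powR_01.
rewrite [leRHS]integral_mkcond; apply: ae_le_integral_nomeas.
- by move=> x _; rewrite lee_fin mulr_ge0 ?powR_ge0.
- by move=> x _; rewrite patchE; case: ifPn => // _; rewrite lee_fin powR_ge0.
- apply: aeW => x _; rewrite patchE indicE; case: ifPn => _; first by rewrite mulr1.
  by rewrite mulr0.
Qed.

Lemma laplace_rlk1_gt0 : (0 < laplace_rlk 1)%E.
Proof.
apply: (@lt_le_trans _ _ (\int[mu]_(r in `]0%R, 1%R]) (expR (-1))%:E)%E).
  by rewrite integral_cst//= lebesgue_measure_itv/= lte_fin ltr01 -EFinD subr0 -EFinM mulr1 lte_fin expR_gt0.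
rewrite integral_mkcond; apply: ae_le_integral_nomeas.
- by move=> x _; rewrite patchE; case: ifPn => // _; rewrite lee_fin expR_ge0.
- by move=> x _; rewrite lee_fin mulr_ge0 ?expR_ge0 ?rlk_ge0.
- apply: aeW => x _; rewrite patchE; case: ifPn; last first.
    by move=> _; rewrite lee_fin mulr_ge0 ?expR_ge0 ?rlk_ge0.
  move=> /set_mem/=; rewrite in_itv/= => /[dup] x01 /andP[x0 x1].
  rewrite lee_fin -[leLHS]mulr1 ler_pM ?expR_ge0// ?rlk_ge1//.
  by rewrite ler_expR mul1r lerN2.
Qed.

Lemma Gamma_laplace : (Gamma alpha)%:E = laplace_rlk 1.
Proof.
rewrite /Gamma /Rintegral -(@fineK _ (laplace_rlk 1)); last first.
  by rewrite ge0_fin_numE ?laplace_rlk1_lty// ltW// laplace_rlk1_gt0.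
congr (fine _)%:E; rewrite integral_mkcond; apply: eq_integral => x _.
rewrite patchE; case: ifPn => [/set_mem|/negP x0] /=.
  by rewrite in_itv/= andbT => x0; rewrite rlkE// mulrC mul1r.
rewrite rlk0 ?mulr0// leNgt; apply/negP => x0'; apply: x0.
by rewrite inE/= in_itv/= x0'.
Qed.

Lemma Gamma_gt0 : 0 < Gamma alpha.
Proof. by rewrite -lte_fin Gamma_laplace laplace_rlk1_gt0. Qed.

Lemma laplace_rlkE (s : R) : 0 < s ->
  laplace_rlk s = (s `^ (- alpha) * Gamma alpha)%:E.
Proof. by move=> s0; rewrite laplace_rlk_scale// EFinM Gamma_laplace. Qed.

Lemma laplace_rlk_shift (s tau : R) :
  (\int[mu]_t (expR (- (s * t)) * rlk (t - tau))%:E =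
   (expR (- (s * tau)))%:E * laplace_rlk s)%E.
Proof.
have -> : (\int[mu]_t (expR (- (s * t)) * rlk (t - tau))%:E =
  \int[mu]_t (expR (- (s * ((1 * t - tau) + tau))) * rlk (1 * t - tau))%:E)%E.
  by apply: eq_integral => t _; rewrite mul1r subrK.
rewrite (@ge0_integral_affine R 1 (- tau)
   (fun x => (expR (- (s * (x + tau))) * rlk x)%:E)); [|exact: ltr01| |]; last 2 first.
- apply/measurable_EFinP; apply: measurable_funM; last exact: measurable_rlk.
  by apply: measurable_expR_mul; exact: measurable_funD.
- by move=> x; rewrite lee_fin mulr_ge0 ?expR_ge0 ?rlk_ge0.
rewrite invr1 mul1e /laplace_rlk -ge0_integralZl_EFin ?expR_ge0//; last 2 first.
- by move=> x _; rewrite lee_fin mulr_ge0 ?expR_ge0 ?rlk_ge0.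
- by apply/measurable_EFinP; exact: measurable_laplace_rlk.
apply: eq_integral => x _; rewrite -EFinM; congr EFin.
by rewrite [RHS]mulrA -expRD mulrDr opprD [in LHS]addrC.
Qed.

Lemma measurable_rlk_shift (s : R) :
  measurable_fun [set: R * R] (fun z : R * R => expR (- (s * z.2)) * rlk (z.2 - z.1)).
Proof.
apply: measurable_funM.
  by apply: measurable_expR_mul; exact: measurable_snd.
apply: (measurableT_comp measurable_rlk); apply: measurable_funB => /=.
- exact: measurable_snd.
- exact: measurable_fst.
Qed.

(** The weight [expR (- t)] makes the shifted kernels integrable in [t] with a common bound, so
    Tonelli controls the double integral, and an integrable function of [t] is finite almost
    everywhere. This is what makes the Bochner integral behind [J^alpha u] exist. *)
Lemma ae_RL_lty (T : R) (phi : R -> \bar R) : measurable_fun `]0, T[ phi ->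
  (forall t, 0 <= phi t)%E -> (\int[mu]_(t in `]0%R, T[) phi t < +oo)%E ->
  {ae mu, forall t, t \in `]0, T[ ->
    (\int[mu]_(tau in `]0%R, t[) (((t - tau) `^ (alpha - 1))%:E * phi tau) < +oo)%E}.
Proof.
move=> mphi phi0 iphi.
pose phi' := phi \_ `]0, T[.
have phi'0 t : (0 <= phi' t)%E by rewrite /phi' patchE; case: ifPn.
have mphi' : measurable_fun [set: R] phi' by apply/(measurable_restrictT phi).
pose f (z : R * R) := ((expR (- (1 * z.2)) * rlk (z.2 - z.1))%:E * phi' z.1)%E.
have f0 z : (0 <= f z)%E.
  by rewrite /f mule_ge0// lee_fin mulr_ge0 ?expR_ge0 ?rlk_ge0.
have mf : measurable_fun [set: R * R] f.
  apply: emeasurable_funM.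
    by apply/measurable_EFinP; exact: (measurable_rlk_shift 1).
  by apply: (measurableT_comp mphi'); exact: measurable_fst.
have FT : (\int[mu]_y \int[mu]_x f (x, y) < +oo)%E.
  have -> : (\int[mu]_y \int[mu]_x f (x, y) = \int[mu]_x \int[mu]_y f (x, y))%E.
    exact: (esym (@fubini_tonelli _ _ (measurableTypeR R) (measurableTypeR R) R mu mu f mf f0)).
  apply: (@le_lt_trans _ _ (\int[mu]_x (laplace_rlk 1 * phi' x))%E).
    apply: ae_le_integral_nomeas.
    - by move=> x _; apply: integral_ge0.
    - by move=> x _; rewrite mule_ge0// ltW// laplace_rlk1_gt0.
    - apply: aeW => x _; rewrite /f/= /phi' patchE.
      case: ifPn => [/set_mem/=|_]; last first.
        by rewrite mule0; under eq_integral do rewrite mule0; rewrite integral0.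
      rewrite in_itv/= => /andP[x0 _].
      rewrite ge0_integralZr//; last 2 first.
      + apply/measurable_EFinP.
        apply: (measurableT_comp (measurable_rlk_shift 1) (measurable_pair1 x)).
      + by move=> y _; rewrite lee_fin mulr_ge0 ?expR_ge0 ?rlk_ge0.
      apply: lee_pmul => //.
        by apply: integral_ge0 => y _; rewrite lee_fin mulr_ge0 ?expR_ge0 ?rlk_ge0.
      rewrite laplace_rlk_shift -[leRHS]mul1e; apply: lee_wpmul2r.
        by rewrite ltW// laplace_rlk1_gt0.
      by rewrite lee_fin -[leRHS]expR0 ler_expR oppr_le0 mul1r ltW.
  rewrite ge0_integralZl//; last by rewrite ltW// laplace_rlk1_gt0.
  rewrite lte_mul_pinfty//.
  - by rewrite ltW// laplace_rlk1_gt0.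
  - by rewrite ge0_fin_numE ?laplace_rlk1_lty// ltW// laplace_rlk1_gt0.
  - by rewrite /phi' -integral_mkcond.
have mG : measurable_fun [set: R] (fun y => \int[mu]_x f (x, y))%E.
  exact: (@measurable_fun_fubini_tonelli_G _ _ (measurableTypeR R) (measurableTypeR R) R mu f mf f0).
have iG : mu.-integrable setT (fun y => \int[mu]_x f (x, y))%E.
  apply/integrableP; split => //; apply: le_lt_trans FT.
  apply: ae_le_integral_nomeas => //; first by move=> y _; apply: integral_ge0.
  by apply: aeW => y _; rewrite gee0_abs//; apply: integral_ge0.
have := @integrable_ae _ _ _ mu setT measurableT _ iG.
move=> H; apply: (ae_imp H) => t /(_ I); rewrite ge0_fin_numE; last exact: integral_ge0.
move=> tlt; rewrite in_itv/= => /andP[t0 tT].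
(* For [t < T] the factor [expR T] outweighs the weight [expR (- t)]. *)
apply: (@le_lt_trans _ _ ((expR T)%:E * \int[mu]_x f (x, t))%E); last first.
  by rewrite lte_mul_pinfty// lee_fin expR_ge0.
rewrite -ge0_integralZl_EFin ?expR_ge0//; last first.
  exact: (measurableT_comp mf (measurable_pair2 t)).
rewrite [leLHS]integral_mkcond; apply: ae_le_integral_nomeas.
- by move=> x _; rewrite patchE; case: ifPn => // _; rewrite mule_ge0// lee_fin powR_ge0.
- by move=> x _; rewrite mule_ge0// lee_fin expR_ge0.
apply: aeW => x _; rewrite patchE; case: ifPn; last first.
  by move=> _; rewrite mule_ge0// lee_fin expR_ge0.
move=> /set_mem/=; rewrite in_itv/= => /andP[x0 xt].
rewrite /f/= muleA -EFinM.
have -> : phi' x = phi x.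
  by rewrite /phi' patchE mem_set//= in_itv/= x0 (lt_trans xt).
apply: lee_wpmul2r => //; rewrite lee_fin rlkE ?subr_gt0// mulrA -expRD.
rewrite ler_peMl ?powR_ge0// -[leLHS]expR0 ler_expR mul1r subr_ge0 ltW//.
Qed.

Definition RLreal (U : R -> R) (t : R) : R :=
  (Gamma alpha)^-1 * \int[mu]_(tau in `]0, t[) ((t - tau) `^ (alpha - 1) * U tau).

(* Extending [U] by zero beyond [T], the Laplace transform of the convolution is
   a product; cutting the convolution at [T] costs at most [expR (- (s * T))]. *)
Lemma laplace_RLreal (T s : R) (U : R -> R) : 0 < T -> 0 < s ->
  rintegrable `]0, T[ U ->
  rintegrable `]0, T[ (RLreal U) /\
  `|\int[mu]_(t in `]0, T[) (expR (- (s * t)) * RLreal U t)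
    - s `^ (- alpha) * \int[mu]_(t in `]0, T[) (expR (- (s * t)) * U t)|
  <= s `^ (- alpha) * expR (- (s * T)) * \int[mu]_(t in `]0, T[) `|U t|.
Proof.
move=> T0 s0 iU.
have G0 := Gamma_gt0.
pose U' := U \_ `]0, T[.
have mU' : measurable_fun [set: R] U'.
  by apply/(measurable_restrictT U) => //; exact: rintegrable_measurable.
pose F (z : R * R) : R := expR (- (s * z.2)) * rlk (z.2 - z.1) * U' z.1.
have mF : measurable_fun [set: R * R] F.
  apply: measurable_funM; first exact: measurable_rlk_shift.
  by apply: (measurableT_comp mU'); exact: measurable_fst.
pose D : set R := `]0%R, T[%classic.
have mD : measurable D by exact: measurable_itv.
have mFr x : measurable_fun [set: R] (fun t => expR (- (s * t)) * rlk (t - x)).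
  by apply: (measurableT_comp (measurable_rlk_shift s) (measurable_pair1 x)).
have mFx x : measurable_fun [set: R] (fun t => (expR (- (s * t)) * rlk (t - x))%:E).
  by apply/measurable_EFinP; exact: mFr.
have Fx0 x t : (0 <= (expR (- (s * t)) * rlk (t - x))%:E)%E.
  by rewrite lee_fin mulr_ge0 ?expR_ge0 ?rlk_ge0.
have Fin x (E : set R) : (\int[mu]_(t in E) (expR (- (s * t)) * rlk (t - x))%:E < +oo)%E.
  apply: (@le_lt_trans _ _ (\int[mu]_t (expR (- (s * t)) * rlk (t - x))%:E)%E).
    rewrite integral_mkcond; apply: ae_le_integral_nomeas => //.
      by move=> t _; rewrite patchE; case: ifPn.
    by apply: aeW => t _; rewrite patchE; case: ifPn.
  by rewrite laplace_rlk_shift laplace_rlkE// -EFinM ltry.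
have FT : (\int[mu]_(x in D) \int[mu]_(y in D) `|F (x, y)|%:E < +oo)%E.
  apply: (@le_lt_trans _ _
      (\int[mu]_(x in D) ((s `^ (- alpha) * Gamma alpha)%:E * `|U x|%:E))%E); last first.
    rewrite ge0_integralZl_EFin//; last 2 first.
    - by apply/measurable_EFinP; apply: measurableT_comp => //; exact: rintegrable_measurable.
    - by rewrite mulr_ge0 ?powR_ge0// ltW.
    rewrite lte_mul_pinfty//; first by rewrite lee_fin mulr_ge0 ?powR_ge0// ltW.
    exact: rintegrable_lty.
  apply: ae_le_integral_nomeas.
  - by move=> x _; apply: integral_ge0 => y _; rewrite lee_fin.
  - by move=> x _; rewrite mule_ge0// lee_fin ?mulr_ge0 ?powR_ge0// ltW.
  apply: aeW => x /= Dx; rewrite /F/=.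
  under eq_integral do rewrite normrM EFinM (ger0_norm (mulr_ge0 (expR_ge0 _) (rlk_ge0 _))).
  rewrite ge0_integralZr; [|exact: mD|exact: (measurable_funTS (mFx x))|by move=> *; exact: Fx0|by rewrite lee_fin].
  have -> : U' x = U x by rewrite /U' patchE mem_set.
  apply: lee_wpmul2r => //.
  apply: (@le_trans _ _ (\int[mu]_t (expR (- (s * t)) * rlk (t - x))%:E)%E).
    rewrite [leLHS]integral_mkcond; apply: ae_le_integral_nomeas => //.
      by move=> t _; rewrite patchE; case: ifPn.
    by apply: aeW => t _; rewrite patchE; case: ifPn.
  rewrite laplace_rlk_shift laplace_rlkE// -EFinM lee_fin ler_piMl//.
    by rewrite mulr_ge0 ?powR_ge0// ltW.
  rewrite -[leRHS]expR0 ler_expR oppr_le0 mulr_ge0 ?ltW//.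
  by move: Dx; rewrite /D/= in_itv/= => /andP[].
have [i1 i2 _ _ _] := Rfubini mD mD mF FT.
(* The transform of the kernel started at [x], cut at [T]; without the cut it is [s^(- alpha) *
   Gamma alpha * expR (- (s * x))]. *)
pose Phi x := \int[mu]_(t in D) (expR (- (s * t)) * rlk (t - x)).
have PhiE x : (Phi x)%:E = (\int[mu]_(t in D) (expR (- (s * t)) * rlk (t - x))%:E)%E.
  rewrite fineK// ge0_fin_numE; [exact: Fin|apply: integral_ge0 => t _; exact: Fx0].
have iFx x : rintegrable D (fun t => expR (- (s * t)) * rlk (t - x)).
  apply: rintegrableP; first exact: (measurable_funTS (mFr x)).
  under eq_integral do rewrite ger0_norm ?(mulr_ge0 (expR_ge0 _) (rlk_ge0 _))//.
  exact: Fin.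
have inner1 x : D x -> \int[mu]_(y in D) F (x, y) = U x * Phi x.
  move=> Dx; rewrite /F/= /U' patchE mem_set// -(rintZl _ mD (iFx x)).
  by apply: eq_Rintegral => y _; rewrite mulrC.
have inner2 t : D t -> \int[mu]_(x in D) F (x, t) = expR (- (s * t)) * Gamma alpha * RLreal U t.
  rewrite /D/= in_itv/= => /andP[t0 tT].
  rewrite /RLreal -mulrA (mulrA (Gamma alpha)) mulfV ?gt_eqF// mul1r.
  rewrite -RintegralZl_meas ?gt_eqF ?expR_gt0//; last first.
    apply: measurable_funM.
      apply: (measurableT_comp (measurable_powR _)) => //.
      by apply: measurable_funB.
    apply: (measurable_funS _ _ (rintegrable_measurable iU)) => //.
    by apply: subset_itvl; rewrite bnd_simp ltW.
  rewrite [LHS]Rintegral_mkcond [RHS]Rintegral_mkcond.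
  apply: eq_Rintegral => x _; rewrite !patchE.
  case: ifPn => [/set_mem|/negP xD].
    rewrite /D/= in_itv/= => /andP[x0 xT].
    have U'x : U' x = U x by rewrite /U' patchE mem_set//= in_itv/= x0.
    case: ifPn => [/set_mem/=|/negP xt].
      rewrite in_itv/= => /andP[_ xt].
      by rewrite /F/= U'x rlkE ?subr_gt0// mulrA.
    rewrite /F/= rlk0 ?mulr0 ?mul0r// subr_le0 leNgt; apply/negP => xt'.
    by apply: xt; rewrite inE/= in_itv/= x0.
  case: ifPn => // /set_mem/=; rewrite in_itv/= => /andP[x0 xt].
  by exfalso; apply: xD; rewrite inE /D/= in_itv/= x0 (lt_trans xt).
pose K := s `^ (- alpha) * Gamma alpha.
have K0 : 0 <= K by rewrite mulr_ge0 ?powR_ge0// ltW.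
have est x : D x -> `|K * expR (- (s * x)) - Phi x| <= K * expR (- (s * T)).
  rewrite /D/= in_itv/= => /andP[x0 xT].
  have mult : (Phi x)%:E = (\int[mu]_t ((fun t => (expR (- (s * t)) * rlk (t - x))%:E) \_ D) t)%E.
    by rewrite PhiE integral_mkcond.
  have Kx y : (K * expR (- (s * y)))%:E = (\int[mu]_t (expR (- (s * t)) * rlk (t - y))%:E)%E.
    by rewrite laplace_rlk_shift laplace_rlkE// -EFinM mulrC.
  have le1 : Phi x <= K * expR (- (s * x)).
    rewrite -lee_fin mult Kx; apply: ae_le_integral_nomeas => //.
      by move=> t _; rewrite patchE; case: ifPn.
    by apply: aeW => t _; rewrite patchE; case: ifPn.
  (* By [rlk_decr], the part beyond [T] is at most the full transform of the kernel started at [T];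
     this is the origin of [expR (- (s * T))]. *)
  have le2 : K * expR (- (s * x)) <= Phi x + K * expR (- (s * T)).
    rewrite -lee_fin EFinD mult !Kx -ge0_integralD; [|exact: measurableT|by move=> t _; rewrite patchE; case: ifPn
      | |by move=> t _; exact: Fx0|exact: mFx]; last first.
      apply/(measurable_restrictT (fun t => (expR (- (s * t)) * rlk (t - x))%:E)) => //.
      exact: (measurable_funTS (mFx x)).
    apply: ae_le_integral_nomeas => //.
      by move=> t _; rewrite adde_ge0// patchE; case: ifPn.
    apply: (ae_imp (ae_neq T)) => t /eqP tT _; rewrite patchE.
    case: ifPn => [_|/negP tD]; first by rewrite leeDl.
    rewrite add0e lee_fin ler_wpM2l ?expR_ge0//.
    have [t0|t0] := leP t 0; first by rewrite rlk0 ?rlk_ge0// subr_le0 (le_trans t0) ?ltW.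
    have {}tT : T < t.
      rewrite lt_neqAle eq_sym tT leNgt; apply/negP => tT'; apply: tD.
      by rewrite inE /D/= in_itv/= t0.
    have -> : t - x = (t - T) + (T - x) :> R by rewrite addrA subrK.
    apply: rlk_decr; first by rewrite subr_gt0.
    by rewrite subr_ge0 ltW.
  by rewrite ger0_norm ?subr_ge0// lerBlDl.
have mPhi : measurable_fun D (fun x => U x * Phi x).
  apply: (eq_measurable_fun (fun x => \int[mu]_(y in D) F (x, y))).
    by move=> x /set_mem Dx; rewrite inner1.
  exact: rintegrable_measurable i1.
have iUPhi : rintegrable D (fun x => U x * Phi x).
  move: i1; apply: eq_integrable => //.
  by move=> x /set_mem Dx /=; rewrite inner1.
have iRL : rintegrable D (fun t => expR (- (s * t)) * Gamma alpha * RLreal U t).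
  move: i2; apply: eq_integrable => //.
  by move=> x /set_mem Dx /=; rewrite inner2.
split.
  (* Fubini gives integrability with the exponential weight; on []0, T[] the inverse weight is
     bounded and removes it. *)
  have := @rintegrable_bddM R D (expR (s * T) / Gamma alpha) _ (fun t => expR (s * t) / Gamma alpha) mD _ _ iRL.
  have mg : measurable_fun D (fun t => expR (s * t) / Gamma alpha).
    apply: measurable_funM => //.
    under eq_fun do rewrite -[s * _]opprK -mulNr.
    exact: measurable_expR_lin.
  move=> /(_ mg) H.
  have : rintegrable D (fun x => expR (s * x) / Gamma alpha * (expR (- (s * x)) * Gamma alpha * RLreal U x)).
    apply: H => x; rewrite /D/= in_itv/= => /andP[x0 xT].
    rewrite ger0_norm ?divr_ge0 ?expR_ge0 ?(ltW G0)//.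
    rewrite ler_pM2r ?invr_gt0// ler_expR ler_pM2l//; exact: ltW.
  apply: eq_integrable => // x _ /=; congr EFin.
  by rewrite expRN; field; rewrite (gt_eqF G0) (gt_eqF (expR_gt0 _)).
have iEU : rintegrable D (fun t => expR (- (s * t)) * U t).
  apply: (@rintegrable_bddM R D 1) => //; first exact: measurable_expR_lin.
  move=> x; rewrite /D/= in_itv/= => /andP[x0 xT].
  by rewrite ger0_norm ?expR_ge0// -[leRHS]expR0 ler_expR oppr_le0 mulr_ge0// ltW.
have E1 : Gamma alpha * \int[mu]_(t in D) (expR (- (s * t)) * RLreal U t) =
    \int[mu]_(x in D) (U x * Phi x).
  transitivity (\int[mu]_(t in D) (expR (- (s * t)) * Gamma alpha * RLreal U t)).
    rewrite -RintegralZl_meas ?gt_eqF//; last first.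
      apply: (eq_measurable_fun (fun t => (Gamma alpha)^-1 * (expR (- (s * t)) * Gamma alpha * RLreal U t))).
        by move=> t _; field; rewrite gt_eqF.
      by apply: measurable_funM => //; exact: rintegrable_measurable iRL.
    by apply: eq_Rintegral => t _; rewrite mulrCA mulrA.
  transitivity (\int[mu]_(t in D) \int[mu]_(x in D) F (x, t)).
    by apply: eq_Rintegral => t /set_mem Dt; rewrite inner2.
  have [_ _ _ _ <-] := Rfubini mD mD mF FT.
  by apply: eq_Rintegral => x /set_mem Dx; rewrite inner1.
rewrite -(ler_pM2l G0) -[X in X * `|_|](ger0_norm (ltW G0)) -normrM mulrBr {}E1.
rewrite [X in `|_ - X|]mulrA (mulrC (Gamma alpha)) -/K -[X in `|_ - X|]rintZl//.
rewrite -rintB//; last exact: rintegrableZl.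
rewrite mulrA mulrA (mulrC (Gamma alpha)) -/K -rintZl//; last exact: rintegrable_norm.
apply: le_norm_rint_le => //.
- by apply: rintegrable_measurable; apply: rintegrableB => //; exact: rintegrableZl.
- by apply: rintegrableZl => //; exact: rintegrable_norm.
- move=> x Dx; rewrite distrC mulrA (mulrC _ (U x)) -mulrBr normrM mulrC.
  by apply: ler_wpM2r => //; exact: est.
Qed.

End RiemannLiouvilleKernel.

(** * A Phragmen-Lindelof principle for polynomials on the real line *)

Section PolynomialsOnTheLine.
Context (R : realType).

(** Translation preserves the degree and the leading coefficient, so the top terms cancel. *)
Lemma size_difference (h : R) (P : {poly R}) (n : nat) :
  (size P <= n.+1)%N -> (size (P - (P \Po ('X + h%:P)))%R <= n)%N.
Proof.
move=> sP; have [->|P0] := eqVneq P 0; first by rewrite comp_poly0 subrr size_poly0.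
have sX : size ('X + h%:P : {poly R}) = 2%N by rewrite size_XaddC.
have sC : size (P \Po ('X + h%:P)) = size P by rewrite size_comp_poly2.
have lC : lead_coef (P \Po ('X + h%:P)) = lead_coef P.
  by rewrite lead_coef_comp ?sX// lead_coefXaddC expr1n mulr1.
have s1 : (0 < size P)%N by rewrite size_poly_gt0.
apply/leq_sizeP => j nj; rewrite coefB.
have [jP|jP] := ltnP j (size P); last by rewrite !nth_default ?subrr// sC.
have jE : j = (size P).-1.
  by apply/eqP; rewrite eqn_leq -ltnS prednK// jP -ltnS prednK// (leq_trans sP).
by rewrite jE -lead_coefE -sC -lead_coefE lC subrr.
Qed.

(** This is the [n]-th finite difference. Pascal's rule rewrites it as a difference of order one
    less, taken of [P - (P \Po ('X + h%:P))]. *)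
Lemma alternating_bin_sum (n : nat) (P : {poly R}) (y h : R) :
  (size P <= n)%N ->
  \sum_(i < n.+1) (-1) ^+ i * 'C(n, i)%:R * P.[y + h * i%:R] = 0.
Proof.
elim: n P => [P|n IH P sP].
  by rewrite leqn0 size_poly_eq0 => /eqP->; rewrite big_ord1 horner0 mulr0.
rewrite big_ord_recl/= bin0 expr0 !mul1r mulr0 addr0.
under eq_bigr => i _ do rewrite /bump/= add1n binS natrD mulrDr mulrDl.
rewrite big_split/= addrA.
have -> : P.[y] + \sum_(i < n.+1) (-1) ^+ i.+1 * 'C(n, i.+1)%:R * P.[y + h * i.+1%:R]
   = \sum_(i < n.+1) (-1) ^+ i * 'C(n, i)%:R * P.[y + h * i%:R].
  rewrite [RHS]big_ord_recl/= bin0 expr0 !mul1r mulr0 addr0; congr (_ + _).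
  by rewrite big_ord_recr/= bin_small// mulr0 mul0r addr0.
rewrite -[RHS](IH _ (size_difference h sP)).
rewrite -big_split/=; apply: eq_bigr => i _.
rewrite hornerD hornerN horner_comp hornerD hornerX hornerC.
rewrite exprS mulN1r !mulNr -mulrBr; congr (_ * (_ - _.[_])).
by rewrite -addrA -{3}(mulr1 h) -mulrDr natr1.
Qed.

(** Towards the centre, consecutive coefficients have ratio at least 1. Divided by the central one,
    the weights of the finite difference are thus at most 1. *)
Lemma bin_le_central (N i : nat) : (i <= N.*2)%N -> ('C(N.*2, i) <= 'C(N.*2, N))%N.
Proof.
wlog: i / (i <= N)%N => [H iN|].
  have [iN'|/ltnW Ni] := leqP i N; first exact: H.
  rewrite -bin_sub//; apply: H; last exact: leq_subr.
  by rewrite leq_subLR -addnn leq_add2r.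
move=> iN _; rewrite -(subKn iN); move: (N - i)%N (leq_subr i N) => j.
elim: j => [_|j IH jN]; first by rewrite subn0.
apply: leq_trans (IH (ltnW jN)).
have : ('C(N.*2, N - j.+1) * (N.*2 - (N - j.+1)) = (N - j) * 'C(N.*2, N - j))%N.
  by have := mul_bin_left N.*2 (N - j.+1); rewrite -subSn// subSS => ->; rewrite mulnC.
move=> E; have jN0 : (0 < N - j)%N by rewrite subn_gt0.
rewrite -(leq_pmul2l jN0) -E mulnC leq_mul2l; apply/orP; right.
by rewrite -addnn leq_subRL; lia.
Qed.

(* [n^4] nodes on each side of the centre, [n^3] apart: the harmonic sum over the
   nodes is [O(n^2)], hence small compared with the spacing. *)
Definition line_bound (m : nat) (F : nat -> {poly R}) :=
  exists A C n0 (e : nat -> R), [/\ 1 <= A, 0 <= C, (forall n, 0 <= e n),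
    (n%:R ^+ 4 * e n) @[n --> \oo] --> (0 : R) &
    forall n x, (n0 <= n)%N -> A <= `|x| -> `|x| <= 2 * n%:R ^+ 7 ->
      `|(F n).[x]| <= C * `|x| ^+ m / `|x| + e n].

(** Telescopes [1 / K.+1 <= 2 * (Num.sqrt K.+1 - Num.sqrt K)]. At [K = n ^ 4] the bound is
    [2 * n ^ 2], one order below the spacing [n ^ 3]. *)
Lemma harmonic_sqrt (K : nat) : \sum_(1 <= d < K.+1) (d%:R^-1 : R) <= 2 * Num.sqrt K%:R.
Proof.
elim: K => [|K IH]; first by rewrite big_geq// mulr_ge0// sqrtr_ge0.
rewrite big_nat_recr//=; apply: le_trans (lerD IH (lexx _)) _.
set a := Num.sqrt K%:R; set b := Num.sqrt K.+1%:R.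
have b0 : 0 < b by rewrite sqrtr_gt0.
have a0 : 0 <= a by rewrite sqrtr_ge0.
have b2 : b ^+ 2 = K.+1%:R by rewrite sqr_sqrtr.
have a2 : a ^+ 2 = K%:R by rewrite sqr_sqrtr.
have ab : b ^+ 2 - a ^+ 2 = 1 by rewrite a2 b2 -natr1; ring.
have leab : a <= b by rewrite ler_sqrt// ler_nat.
have b1 : 1 <= b by rewrite -sqrtr1 ler_sqrt// ler1n.
have H : 1 <= 2 * (b - a) * b by nra.
rewrite -lerBrDl -mulrBr -b2; apply: (@le_trans _ _ b^-1).
  by rewrite lef_pV2 ?posrE ?exprn_gt0// expr2 ler_peMr// ltW.
by rewrite -[b^-1]mul1r ler_pdivrMr.
Qed.

(** In the vanishing difference of order [2 N] the central term is minus the sum of the others, and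
    the central binomial coefficient is the largest. *)
Lemma central_value_bound (N : nat) (P : {poly R}) (y h : R) (g : nat -> R) :
  (size P <= N.*2)%N ->
  (forall d, (1 <= d <= N)%N ->
     `|P.[y + h * d%:R]| <= g d /\ `|P.[y - h * d%:R]| <= g d) ->
  `|P.[y]| <= 2 * \sum_(1 <= d < N.+1) g d.
Proof.
move=> sP Pg.
pose c i : R := 'C(N.*2, i)%:R.
pose E i : R := (-1) ^+ i * c i * P.[(y - h * N%:R) + h * i%:R].
have S0 : \sum_(0 <= i < N.*2.+1) E i = 0.
  by rewrite big_mkord; exact: alternating_bin_sum.
have NN : (N.+1 <= N.*2.+1)%N by rewrite ltnS -addnn leq_addr.
rewrite (@big_cat_nat _ _ _ N.+1)//= big_nat_recr//= in S0.
have EN : E N = (-1) ^+ N * c N * P.[y] by rewrite /E subrK.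
have cN0 : 0 < c N by rewrite ltr0n bin_gt0 -addnn leq_addr.
have cle i : (i <= N.*2)%N -> `|(-1) ^+ i * c i| <= c N.
  move=> iN; rewrite normrM normrX normrN1 expr1n mul1r ger0_norm ?ler0n//.
  by rewrite ler_nat bin_le_central.
have S1 : `|\sum_(0 <= i < N) E i| <= c N * \sum_(1 <= d < N.+1) g d.
  rewrite big_nat_rev/= add0n mulr_sumr big_add1/=.
  apply: le_trans (ler_norm_sum _ _ _) _.
  apply: ler_sum_nat => i /andP[_ iN]; rewrite ?add0n /E normrM.
  apply: ler_pM => //.
    by apply: cle; rewrite -addnn (leq_trans (leq_subr _ _))// leq_addr.
  have -> : y - h * N%:R + h * (N - i.+1)%:R = y - h * i.+1%:R.
    by rewrite natrB//; ring.
  by have [] := Pg i.+1 iN.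
have S2 : `|\sum_(N.+1 <= i < N.*2.+1) E i| <= c N * \sum_(1 <= d < N.+1) g d.
  rewrite -{1}(add0n N.+1) big_addn mulr_sumr big_add1/=.
  have -> : (N.*2.+1 - N.+1 = N)%N by rewrite subSS -addnn addnK.
  apply: le_trans (ler_norm_sum _ _ _) _.
  apply: ler_sum_nat => i /andP[_ iN]; rewrite ?add0n /E normrM.
  apply: ler_pM => //.
    by apply: cle; rewrite -addnn addnS -addSn leq_add2r.
  have -> : y - h * N%:R + h * (i + N.+1)%:R = y + h * i.+1%:R.
    by rewrite natrD -!natr1; ring.
  by have [] := Pg i.+1 iN.
have : c N * `|P.[y]| <= c N * (2 * \sum_(1 <= d < N.+1) g d).
  have -> : c N * `|P.[y]| = `|E N|.
    by rewrite EN !normrM normrX normrN1 expr1n mul1r (gtr0_norm cN0).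
  have -> : E N = - (\sum_(0 <= i < N) E i + \sum_(N.+1 <= i < N.*2.+1) E i).
    by apply/eqP; rewrite -subr_eq0 opprK -[X in _ == X]S0; apply/eqP; ring.
  rewrite normrN; apply: le_trans (ler_normD _ _) _.
  by have := lerD S1 S2; lra.
by rewrite ler_pM2l.
Qed.

Lemma cvg_inv_nat : (n%:R^-1 : R) @[n --> \oo] --> (0 : R).
Proof.
apply/gtr0_cvgV0; last exact: cvgr_idn.
by near=> n; rewrite ltr0n; near: n; exact: nbhs_infty_gt.
Unshelve. all: by end_near. Qed.

Lemma line_bound0_cvg (F : nat -> {poly R}) :
  (forall n, (size (F n) <= 2 * n ^ 4)%N) -> line_bound 0 F ->
  forall y, (F n).[y] @[n --> \oo] --> (0 : R).
Proof.
move=> sF [A [C [n0 [e [A1 C0 e0 ecv FB]]]]] y.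
(* The first term is [2 * (2 * C / h) * (2 * n ^ 2)] with [h = n ^ 3]; the second counts the error
   [e n] at each of the [2 * n ^ 4] nodes. *)
pose bnd n : R := 8 * C / n%:R + 2 * (n%:R ^+ 4 * e n).
have bcv : bnd n @[n --> \oo] --> (0 : R).
  rewrite [X in _ --> X](_ : 0 = 8 * C * 0 + 2 * 0); last by rewrite !mulr0 addr0.
  apply: cvgD; apply: cvgM => //; try exact: cvg_cst.
  exact: cvg_inv_nat.
apply/norm_cvg0P.
apply: (@squeeze_cvgr _ _ _ _ (cst 0) bnd).
- near=> n; rewrite /cst normr_ge0/=.
  have n1 : 1 <= n%:R :> R by rewrite ler1n; near: n; exact: nbhs_infty_gt.
  (* These thresholds put every node [y + h * d] and [y - h * d] in the range of [line_bound], at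
     modulus at least [h * d / 2]. *)
  have nA : 2 * A <= n%:R :> R by near: n; exact: nbhs_infty_ger.
  have ny : 2 * `|y| <= n%:R :> R by near: n; exact: nbhs_infty_ger.
  have n0n : (n0 <= n)%N by near: n; exact: nbhs_infty_ge.
  set h : R := n%:R ^+ 3.
  have nh : n%:R <= h by rewrite /h ler_eXnr.
  have h0 : 0 < h by lra.
  pose g d : R := 2 * C / h * d%:R^-1 + e n.
  have := @central_value_bound (n ^ 4)%N (F n) y h g _ _.
  rewrite -mul2n => /(_ (sF n)) H.
  apply: (le_trans (H _)).
    move=> d /andP[d1 dN].
    have d1' : 1 <= d%:R :> R by rewrite ler1n.
    have dN' : d%:R <= n%:R ^+ 4 :> R by rewrite -natrX ler_nat.
    have hd : h <= h * d%:R by rewrite ler_peMr// ltW.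
    have hd7 : h * d%:R <= n%:R ^+ 7 by rewrite (exprD _ 3 4) ler_wpM2l// ltW.
    have aux x : h * d%:R - `|y| <= `|x| -> `|x| <= h * d%:R + `|y| -> `|(F n).[x]| <= g d.
      move=> x1 x2; have x0 : 0 < `|x| by lra.
      have := FB n x n0n; rewrite expr0 mulr1 => FBx.
      apply: (le_trans (FBx _ _)); [lra|lra|].
      rewrite /g lerD2r; rewrite ler_pdivrMr//.
      rewrite -mulrA -invfM mulrAC ler_pdivlMr; last by lra.
      have hx : h * d%:R <= 2 * `|x| by lra.
      by rewrite (_ : 2 * C * `|x| = C * (2 * `|x|)); [exact: ler_wpM2l|ring].
    have yy : 0 <= `|y| by [].
    have hdn : `|h * d%:R| = h * d%:R by rewrite ger0_norm//; lra.
    split; apply: aux.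
    - by have := lerB_normD (h * d%:R) y; rewrite hdn (addrC _ y).
    - by have := ler_normD y (h * d%:R); rewrite hdn (addrC `|y|).
    - by have := lerB_dist (h * d%:R) y; rewrite hdn distrC.
    - by have := ler_normB y (h * d%:R); rewrite hdn (addrC `|y|).
  rewrite /g big_split/= -mulr_sumr sumr_const_nat subSS subn0.
  rewrite mulrDr /bnd -[e n *+ _]mulr_natl natrX; apply: lerD => //.
  have := harmonic_sqrt (n ^ 4)%N.
  have -> : Num.sqrt (n ^ 4)%:R = n%:R ^+ 2 :> R.
    by rewrite natrX (exprM _ 2 2) sqrtr_sqr ger0_norm// exprn_ge0.
  move=> Hs; have c0 : 0 <= 2 * (2 * C / h) by rewrite mulr_ge0// divr_ge0// ?mulr_ge0// ltW.
  rewrite mulrA; apply: (le_trans (ler_wpM2l c0 Hs)).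
  rewrite le_eqVlt; apply/orP; left; apply/eqP; rewrite /h.
  by field; lra.
- exact: cvg_cst.
- exact: bcv.
Unshelve. all: by end_near. Qed.

(** A Liouville argument by induction on the growth exponent: the divided differences of [F n] at a
    point [z] lose one power and so tend to 0. Hence [F n] tends everywhere to the constant [f z],
    and the decay of [f] as [x -> -oo] forces this constant to be 0. *)
Lemma line_bound_cvg (m : nat) (F : nat -> {poly R}) (f : R -> R) (A : R) :
  (forall n, (size (F n) <= 2 * n ^ 4)%N) -> line_bound m F ->
  (forall x, x <= - A -> (F n).[x] @[n --> \oo] --> f x) ->
  (forall d, 0 < d -> exists B, forall x, x <= - B -> `|f x| <= d) ->
  forall y, (F n).[y] @[n --> \oo] --> (0 : R).
Proof.
elim: m F f A => [F f A sF Fb _ _|m IH F f A sF Fb Fcv f0 y].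
  exact: line_bound0_cvg.
have [A0 [C [n0 [e [A1 C0 e0 ecv FB]]]]] := Fb.
pose z := - (Num.max A A0); have zA : z <= - A by rewrite lerN2 le_max lexx.
have Fz := Fcv z zA.
have z1 : 1 <= `|z|.
  by rewrite normrN (le_trans A1)// (le_trans _ (ler_norm _))// le_max lexx orbT.
have /cvg_seq_bounded [K [_ /(_ (K + 1))]] := cvgP _ Fz.
rewrite ltrDl ltr01 => /(_ isT) FK.
have {}FK n : `|(F n).[z]| <= K + 1 by exact: FK.
have K1 : 0 <= K + 1 by exact: le_trans (FK 0%N).
have /boolp.choice[Q FQ] n : exists Q : {poly R}, F n - (F n).[z]%:P = Q * ('X - z%:P).
  by apply/factor_theorem; rewrite /root !hornerE subrr.
have sQ n : (size (Q n) <= 2 * n ^ 4)%N.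
  have [->|Q0] := eqVneq (Q n) 0; first by rewrite size_poly0.
  have := sF n; apply: leq_trans; apply: (@leq_trans (size (F n - (F n).[z]%:P)).-1).
    by rewrite FQ size_Mmonic ?monicXsubC// size_XsubC addn2.
  have := size_polyD (F n) (- (F n).[z]%:P); rewrite size_polyN => sFz.
  rewrite -subn1 leq_subLR; apply: (leq_trans sFz); rewrite geq_max leq_addl/=.
  by rewrite (leq_trans (size_polyC_leq1 _))// leq_addr.
have Qx n x : x != z -> (Q n).[x] = ((F n).[x] - (F n).[z]) / (x - z).
  move=> xz; have := congr1 (fun P => P.[x]) (FQ n); rewrite !hornerE => ->.
  by rewrite mulfK// subr_eq0.
have Qcv : forall y, (Q n).[y] @[n --> \oo] --> (0 : R).
  apply: (IH Q (fun x => (f x - f z) / (x - z)) (Num.max A (`|z| + 1))) => //.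
  (* Beyond [2 * |z| + 1] one has [|x - z| >= |x| / 2], which doubles the constants; [K + 1]
     accounts for the subtracted values [(F n).[z]]. *)
  - exists (Num.max A0 (2 * `|z| + 1)), (2 * (C + (K + 1))), n0, (fun n => 2 * e n).
    split => //.
    + by rewrite le_max A1.
    + by rewrite mulr_ge0// addr_ge0.
    + by move=> n; rewrite mulr_ge0.
    + rewrite (_ : (fun n => _) = (fun n => 2 * (n%:R ^+ 4 * e n))).
        by rewrite -[X in _ --> X](mulr0 2); apply: cvgM => //; exact: cvg_cst.
      by apply/funext => n; ring.
    + move=> n x n0n; rewrite ge_max => /andP[A0x zx] x7.
      have x1 : 1 <= `|x| by exact: le_trans A0x.
      have x0 : 0 < `|x| by lra.
      have xz : `|x| / 2 <= `|x - z| by have := lerB_dist x z; lra.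
      have xz0 : 0 < `|x - z| by lra.
      have xnz : x != z by rewrite -subr_eq0 -normr_gt0.
      rewrite Qx// normrM normfV ler_pdivrMr//.
      have Fx : `|(F n).[x] - (F n).[z]| <= C * `|x| ^+ m + e n + (K + 1).
        apply: le_trans (ler_normB _ _) _; apply: lerD; last exact: FK.
        apply: le_trans (FB n x n0n A0x x7) _.
        by rewrite exprS mulrCA mulrAC mulfV ?mul1r// gt_eqF.
      apply: (le_trans Fx).
      apply: (@le_trans _ _ ((2 * (C + (K + 1)) * `|x| ^+ m / `|x| + 2 * e n) * (`|x| / 2))); last first.
        apply: ler_wpM2l => //; rewrite addr_ge0 ?mulr_ge0 ?invr_ge0 ?exprn_ge0//.
        exact: addr_ge0.
      have -> : (2 * (C + (K + 1)) * `|x| ^+ m / `|x| + 2 * e n) * (`|x| / 2) =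
         (C + (K + 1)) * `|x| ^+ m + e n * `|x| by field; lra.
      have xm1 : 1 <= `|x| ^+ m by rewrite exprn_ege1.
      have ex : e n <= e n * `|x| by rewrite ler_peMr.
      have Kx : (K + 1) <= (K + 1) * `|x| ^+ m by rewrite ler_peMr.
      lra.
  - move=> x xA.
    have xA' : x <= - A by apply: (le_trans xA); rewrite lerN2 le_max lexx.
    have xz : x < z.
      have : x <= - (`|z| + 1) by apply: (le_trans xA); rewrite lerN2 le_max lexx orbT.
      have := ler_norm (- z); rewrite normrN; lra.
    under eq_fun do rewrite Qx ?lt_eqF//.
    apply: cvgM; last exact: cvg_cst.
    by apply: cvgB => //; exact: Fcv.
  - move=> d d0; have [B HB] := f0 1 ltr01.
    exists (Num.max B (`|z| + (1 + `|f z|) / d)) => x.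
    rewrite lerNr ge_max -2!lerNr => /andP[xB xz].
    have fz0 : 0 <= (1 + `|f z|) / d by rewrite divr_ge0// ?addr_ge0// ltW.
    have zx : (1 + `|f z|) / d <= `|x - z|.
      by have := ler_norm (z - x); rewrite distrC; have := ler_norm (- z); rewrite normrN; lra.
    have xz0 : 0 < `|x - z|.
      by apply: lt_le_trans zx; rewrite divr_gt0// ltr_wpDr.
    rewrite normrM normfV ler_pdivrMr//.
    apply: le_trans (ler_normB _ _) _.
    apply: (@le_trans _ _ (1 + `|f z|)); first by rewrite lerD2r; apply: HB; rewrite lerNr.
    by rewrite mulrC -ler_pdivrMr.
have Flim x : (F n).[x] @[n --> \oo] --> f z.
  rewrite (_ : (fun n => _) = (fun n => (Q n).[x] * (x - z) + (F n).[z])).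
    rewrite -[X in _ --> X]add0r -(mul0r (x - z)).
    by apply: cvgD => //; apply: cvgM => //; exact: cvg_cst.
  apply/funext => n; have := congr1 (fun P => P.[x]) (FQ n); rewrite !hornerE.
  by move=> <-; rewrite subrK.
have fz : f z = 0.
  apply/eqP; apply: contraT => fz0.
  have fz2 : 0 < `|f z| / 2 by rewrite divr_gt0// normr_gt0.
  have [B HB] := f0 _ fz2.
  pose x := Num.min (- A) (- B).
  have xA : x <= - A by rewrite ge_min lexx.
  have xB : x <= - B by rewrite ge_min lexx orbT.
  have fx : f x = f z.
    apply: (etrans (esym (cvg_lim _ (Fcv x xA)))) => //; exact: cvg_lim.
  have := HB x xB; rewrite fx; have : 0 < `|f z| by rewrite normr_gt0.
  lra.
by rewrite -fz; exact: Flim.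
Qed.

End PolynomialsOnTheLine.

(** * Integration from [x0] as a Volterra operator *)

Section VolterraOperator.
Context (R : realType) (x0 : R).
Hypothesis x001 : 0 < x0 < 1.
Local Notation mu := (@lebesgue_measure R).
Local Notation I01 := (`]0, 1[%classic : set R).

Let mI : measurable I01. Proof. exact: measurable_itv. Qed.

(* [Iop q x] is the signed integral of [q] from [x0] to [x]; [Istar] is its
   adjoint. *)
Definition sgk (x y : R) : R :=
  \1_(`]x0, +oo[%classic) y * \1_(`]0, +oo[%classic) (x - y)
  - \1_(`]-oo, x0[%classic) y * \1_(`]0, +oo[%classic) (y - x).

Definition Iop (q : R -> R) (x : R) : R := \int[mu]_(y in I01) (sgk x y * q y).

Definition Istar (h : R -> R) (y : R) : R := \int[mu]_(x in I01) (sgk x y * h x).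

(** The class of weights of the whole argument: it is stable under [Istar], linear combinations and
    products, and pairs with every integrable function. *)
Definition bm01 (h : R -> R) :=
  measurable_fun I01 h /\ exists H, forall x, I01 x -> `|h x| <= H.

Lemma sgk_right (x y : R) : x0 < y -> sgk x y = (y < x)%R%:R.
Proof.
move=> y0; rewrite /sgk !indicE/= !mem_setE/= !in_itv/= !andbT y0 mul1r.
by rewrite (lt_gtF y0)/= mul0r subr0 subr_gt0.
Qed.

Lemma sgk_left (x y : R) : y < x0 -> sgk x y = - (x < y)%R%:R.
Proof.
move=> y0; rewrite /sgk !indicE/= !mem_setE/= !in_itv/= !andbT y0 mul1r.
by rewrite (lt_gtF y0)/= mul0r sub0r subr_gt0.
Qed.

Lemma sgk_diag (x : R) : sgk x x0 = 0.
Proof.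
by rewrite /sgk !indicE/= !mem_setE/= !in_itv/= !ltxx/= !mul0r subr0.
Qed.

Lemma sgk_le1 (x y : R) : `|sgk x y| <= 1.
Proof.
have [yx|yx|->] := ltgtP y x0.
- by rewrite sgk_left// normrN ger0_norm// lern1 leq_b1.
- by rewrite sgk_right// ger0_norm// lern1 leq_b1.
- by rewrite sgk_diag normr0.
Qed.

Lemma measurable_sgk : measurable_fun [set: R * R] (fun z : R * R => sgk z.1 z.2).
Proof.
have mind (a b : itv_bound R) : measurable_fun [set: R] (\1_[set` Interval a b] : R -> R).
  exact: measurable_indic.
apply: measurable_funB; apply: measurable_funM.
- by apply: (measurableT_comp (mind _ _)); exact: measurable_snd.
- apply: (measurableT_comp (mind _ _)); apply: measurable_funB => /=.
    exact: measurable_fst.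
  exact: measurable_snd.
- by apply: (measurableT_comp (mind _ _)); exact: measurable_snd.
- apply: (measurableT_comp (mind _ _)); apply: measurable_funB => /=.
    exact: measurable_snd.
  exact: measurable_fst.
Qed.

Lemma measurable_sgk1 (x : R) (D : set R) : measurable_fun D (sgk x).
Proof.
apply: measurable_funTS.
exact: (measurableT_comp measurable_sgk (measurable_pair1 x)).
Qed.

Lemma measurable_sgk2 (y : R) (D : set R) : measurable_fun D (sgk ^~ y).
Proof.
apply: measurable_funTS.
exact: (measurableT_comp measurable_sgk (measurable_pair2 y)).
Qed.

Lemma rintegrable_cst01 (c : R) : rintegrable I01 (fun=> c).
Proof.
apply: rintegrableP => //; rewrite integral_cst//= lebesgue_measure_itv/= lte_fin ltr01.
by rewrite -EFinD -EFinM ltry.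
Qed.

Lemma rint_cst01 (c : R) : \int[mu]_(x in I01) c = c.
Proof.
rewrite Rintegral_cst//= lebesgue_measure_itv/= lte_fin ltr01 -EFinD/=.
by rewrite subr0 mulr1.
Qed.

Lemma bm01_rintegrable (h : R -> R) : bm01 h -> rintegrable I01 h.
Proof.
move=> [mh [H hH]]; apply: (rintegrable_le mI mh (rintegrable_cst01 H)) => //.
Qed.

Lemma bm01_lin (c : R) (h k : R -> R) : bm01 h -> bm01 k ->
  bm01 (fun x => c * h x + k x).
Proof.
move=> [mh [H hH]] [mk [K kK]]; split.
  by apply: measurable_funD => //; apply: measurable_funM.
exists (`|c| * H + K) => x x01; apply: le_trans (ler_normD _ _) _.
by rewrite normrM lerD ?kK// ler_wpM2l// hH.
Qed.

Lemma bm01M (h k : R -> R) : bm01 h -> bm01 k -> bm01 (fun x => h x * k x).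
Proof.
move=> [mh [H hH]] [mk [K kK]]; split; first exact: measurable_funM.
exists (H * K) => x Ix; rewrite normrM ler_pM// ?hH// kK//.
Qed.

Lemma bm01_cst (c : R) : bm01 (fun=> c).
Proof. by split => //; exists `|c|. Qed.

(** The kernel is bounded by 1, so the absolute double integral is at most the product of two [L^1]
    norms. *)
Lemma sgk_Rfubini (q h : R -> R) : rintegrable I01 q -> rintegrable I01 h ->
  [/\ rintegrable I01 (fun x => h x * Iop q x),
      rintegrable I01 (fun y => q y * Istar h y) &
      \int[mu]_(x in I01) (h x * Iop q x) = \int[mu]_(y in I01) (q y * Istar h y)].
Proof.
move=> iq ih.
have mpatch (f : R -> R) : rintegrable I01 f -> measurable_fun [set: R] (f \_ I01).
  by move=> ift; apply/(measurable_restrictT f) => //; exact: rintegrable_measurable.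
pose F (z : R * R) := (h \_ I01) z.1 * sgk z.1 z.2 * (q \_ I01) z.2.
have mF : measurable_fun [set: R * R] F.
  apply: measurable_funM; first apply: measurable_funM.
  - by apply: (measurableT_comp (mpatch _ ih)); exact: measurable_fst.
  - exact: measurable_sgk.
  - by apply: (measurableT_comp (mpatch _ iq)); exact: measurable_snd.
have mn (f : R -> R) : rintegrable I01 f -> measurable_fun I01 (fun x => `|f x|%:E).
  move=> ift; apply/measurable_EFinP; apply: measurableT_comp => //.
  exact: rintegrable_measurable.
have FT : (\int[mu]_(x in I01) \int[mu]_(y in I01) `|F (x, y)|%:E < +oo)%E.
  pose Kq := (\int[mu]_(y in I01) `|q y|%:E)%E.
  have Kq0 : (0 <= Kq)%E by apply: integral_ge0 => y _; rewrite lee_fin.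
  apply: (@le_lt_trans _ _ (\int[mu]_(x in I01) (`|h x|%:E * Kq))%E).
    apply: ae_le_integral_nomeas.
    - by move=> x _; apply: integral_ge0 => y _; rewrite lee_fin.
    - by move=> x _; rewrite mule_ge0// lee_fin.
    apply: aeW => x Ix; rewrite -ge0_integralZl_EFin//; last exact: mn.
    apply: ae_le_integral_nomeas.
    - by move=> y _; rewrite lee_fin.
    - by move=> y _; rewrite -EFinM lee_fin mulr_ge0.
    apply: aeW => y Iy; rewrite -EFinM lee_fin /F/= !patchE !mem_set// !normrM.
    by rewrite -mulrA ler_wpM2l// ler_piMl// sgk_le1.
  rewrite ge0_integralZr//; last exact: mn.
  rewrite lte_mul_pinfty//.
  - by apply: integral_ge0 => y _; rewrite lee_fin.
  - rewrite ge0_fin_numE; first exact: rintegrable_lty.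
    by apply: integral_ge0 => y _; rewrite lee_fin.
  - exact: rintegrable_lty.
have [i1 i2 _ _ _] := Rfubini mI mI mF FT.
have e1 x : I01 x -> \int[mu]_(y in I01) F (x, y) = h x * Iop q x.
  move=> Ix; have mq : measurable_fun I01 (fun y => sgk x y * q y).
    by apply: measurable_funM; [exact: measurable_sgk1|exact: rintegrable_measurable].
  have [hx0|hx0] := eqVneq (h x) 0.
    rewrite hx0 mul0r; transitivity (\int[mu]_(y in I01) (0 : R)).
      by apply: eq_rint => y _; rewrite /F/= patchE mem_set// hx0 !mul0r.
    by rewrite rint_cst01.
  rewrite /Iop -RintegralZl_meas//; apply: eq_rint => y Iy.
  by rewrite /F/= !patchE !mem_set// mulrA.
have e2 y : I01 y -> \int[mu]_(x in I01) F (x, y) = q y * Istar h y.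
  move=> Iy; have mh : measurable_fun I01 (fun x => sgk x y * h x).
    by apply: measurable_funM; [exact: measurable_sgk2|exact: rintegrable_measurable].
  have [hx0|hx0] := eqVneq (q y) 0.
    rewrite hx0 mul0r; transitivity (\int[mu]_(y in I01) (0 : R)).
      by apply: eq_rint => x _; rewrite /F/= (patchE q) mem_set// hx0 !mulr0.
    by rewrite rint_cst01.
  rewrite /Istar -RintegralZl_meas//; apply: eq_rint => x Ix.
  by rewrite /F/= !patchE !mem_set// mulrC (mulrC (h x)).
split.
- exact: eq_rintegrable i1.
- exact: eq_rintegrable i2.
- by rewrite -(eq_rint e1); have [_ _ _ _ ->] := Rfubini mI mI mF FT; exact: eq_rint.
Qed.

Lemma IopE (q h : R -> R) : rintegrable I01 q -> rintegrable I01 h ->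
  \int[mu]_(x in I01) (h x * Iop q x) = \int[mu]_(y in I01) (q y * Istar h y).
Proof. by move=> iq ih; have [] := sgk_Rfubini iq ih. Qed.

Lemma rintegrable_sgk1 (x : R) (q : R -> R) : rintegrable I01 q ->
  rintegrable I01 (fun y => sgk x y * q y).
Proof.
move=> iq; apply: (@rintegrable_bddM R I01 1) => //; first exact: measurable_sgk1.
by move=> y _; exact: sgk_le1.
Qed.

Lemma rintegrable_sgk2 (y : R) (h : R -> R) : rintegrable I01 h ->
  rintegrable I01 (fun x => sgk x y * h x).
Proof.
move=> iq; apply: (@rintegrable_bddM R I01 1) => //; first exact: measurable_sgk2.
by move=> x _; exact: sgk_le1.
Qed.

Lemma Iop_bound (q : R -> R) (x : R) : rintegrable I01 q ->
  `|Iop q x| <= \int[mu]_(y in I01) `|q y|.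
Proof.
move=> iq; apply: le_norm_rint_le => //.
- by apply: rintegrable_measurable; exact: rintegrable_sgk1.
- exact: rintegrable_norm.
- by move=> y _; rewrite normrM ler_piMl// sgk_le1.
Qed.

Lemma Istar_bound (q : R -> R) (x : R) : rintegrable I01 q ->
  `|Istar q x| <= \int[mu]_(y in I01) `|q y|.
Proof.
move=> iq; apply: le_norm_rint_le => //.
- by apply: rintegrable_measurable; exact: rintegrable_sgk2.
- exact: rintegrable_norm.
- by move=> y _; rewrite normrM ler_piMl// sgk_le1.
Qed.

Lemma Iop_bm01 (q : R -> R) : rintegrable I01 q -> bm01 (Iop q).
Proof.
(* Fubini against the constant 1 provides the measurability of [Iop x0 q]. *)
move=> iq; have [i1 _ _] := sgk_Rfubini iq (rintegrable_cst01 1).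
split; last by eexists => x _; exact: Iop_bound.
apply: (eq_measurable_fun (fun x => 1 * Iop q x)) => [x _|].
  by rewrite mul1r.
exact: rintegrable_measurable.
Qed.

Lemma Istar_bm01 (q : R -> R) : rintegrable I01 q -> bm01 (Istar q).
Proof.
move=> iq; have [_ i1 _] := sgk_Rfubini (rintegrable_cst01 1) iq.
split; last by eexists => x _; exact: Istar_bound.
apply: (eq_measurable_fun (fun x => 1 * Istar q x)) => [x _|].
  by rewrite mul1r.
exact: rintegrable_measurable.
Qed.

Lemma eq_Istar (h k : R -> R) : (forall x, I01 x -> h x = k x) -> Istar h = Istar k.
Proof. by move=> hk; apply/funext => y; apply: eq_rint => x Ix; rewrite hk. Qed.

Lemma Istar_lin (c : R) (h k : R -> R) (y : R) :
  rintegrable I01 h -> rintegrable I01 k ->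
  Istar (fun x => c * h x + k x) y = c * Istar h y + Istar k y.
Proof.
move=> ih ik; rewrite /Istar -rintZl//; last exact: rintegrable_sgk2.
rewrite -rintD//; last 2 first.
- by apply: rintegrableZl => //; exact: rintegrable_sgk2.
- exact: rintegrable_sgk2.
by apply: eq_rint => x _; ring.
Qed.

(** [Istar h y] integrates [h] from [y] to the endpoint of []0, 1[] on the same side of [x0]. This
    is the distance to that endpoint, the natural variable for iterates. *)
Definition dist_end (y : R) : R := if x0 < y then 1 - y else y.

Lemma dist_end01 (y : R) : I01 y -> 0 <= dist_end y <= 1.
Proof.
rewrite /= in_itv/= => /andP[y0 y1]; rewrite /dist_end; case: ifPn => _; lra.
Qed.

Lemma is_derive_pow (c a b : R) (m : nat) (x : R) :
  is_derive x (1 : R) (fun x : R => c * (a + b * x) ^+ m.+1)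
    (c * (m.+1%:R * (a + b * x) ^+ m * b)).
Proof.
have d1 : is_derive x (1 : R) (fun x : R => a + b * x) b.
  rewrite (_ : (fun x : R => a + b * x) = cst a + b \*: id)//.
  by apply: is_derive_eq; rewrite /GRing.scale/= mulr1 add0r.
have := is_deriveZ c (is_deriveX m.+1 d1).
rewrite (_ : c \*: _ = (fun x : R => c * (a + b * x) ^+ m.+1)) //=.
by apply/funext => z; rewrite /= exprfctE.
Qed.

Lemma continuous_FTC2_Rintegral (F f : R -> R) (a b : R) : a <= b ->
  (forall x : R, is_derive x (1 : R) F (f x)) -> continuous f ->
  \int[mu]_(x in `]a, b[) f x = F b - F a.
Proof.
rewrite le_eqVlt => /predU1P[->|ab] dF cf.
  by rewrite set_itvoo0 Rintegral_set0 subrr.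
rewrite /Rintegral -(@integral_itv_bndoo _ a b _ true false); last first.
  apply/measurable_EFinP; apply: measurable_funTS.
  exact: continuous_measurable_fun.
have cF x : {for x, continuous F}.
  apply: differentiable_continuous; apply/derivable1_diffP.
  exact: ex_derive.
rewrite (@continuous_FTC2 _ f F)//.
- exact: continuous_subspaceT.
- split => [x _| |].
  + exact: ex_derive.
  + by apply: cvg_at_right_filter; exact: cF.
  + by apply: cvg_at_left_filter; exact: cF.
- by move=> x _; rewrite derive1E; exact: derive_val.
Qed.

Lemma rint01_indic (a b : R) (f g : R -> R) : 0 <= a -> b <= 1 ->
  (forall x, I01 x -> a < x < b -> g x = f x) ->
  (forall x, I01 x -> ~~ (a < x < b) -> g x = 0) ->
  \int[mu]_(x in I01) g x = \int[mu]_(x in `]a, b[) f x.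
Proof.
move=> a0 b1 gf g0; rewrite Rintegral_mkcond [RHS]Rintegral_mkcond.
apply: eq_Rintegral => x _; rewrite !patchE mem_setE [in RHS]mem_setE /= !in_itv/=.
have [xab|xab] := boolP (a < x < b).
  have Ix : 0 < x < 1.
    move: xab => /andP[ax xb]; rewrite (le_lt_trans a0 ax)/=.
    exact: lt_le_trans b1.
  by rewrite Ix gf//= in_itv/=.
by case: ifPn => // Ix; rewrite g0//= in_itv.
Qed.

(** The Volterra gain: integrating [d ^ m / m!] from [y] to the endpoint, where the distance [d]
    vanishes, gives [d ^ m.+1 / m.+1!]. The two sides of [x0] are mirror images. *)
Lemma Istar_dist_end (m : nat) (H : R) (h : R -> R) : 0 <= H -> rintegrable I01 h ->
  (forall x, I01 x -> `|h x| <= H * (dist_end x ^+ m / m`!%:R)) ->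
  forall y, I01 y -> `|Istar h y| <= H * (dist_end y ^+ m.+1 / m.+1`!%:R).
Proof.
move=> H0 ih hH y; rewrite /= in_itv/= => /andP[y0 y1].
have [x00 x01] := andP x001.
have fact0 k : (k`!%:R : R) != 0 by rewrite pnatr_eq0 -lt0n fact_gt0.
have m10 k : (k.+1%:R : R) != 0 by rewrite pnatr_eq0.
have mle (g : R -> R) : measurable_fun I01 g -> (forall x, I01 x -> `|g x| <= H) ->
    rintegrable I01 g.
  by move=> mg gH; exact: (rintegrable_le mI mg (rintegrable_cst01 H)).
have mpow (c : R) : measurable_fun [set: R] (fun x : R => H * ((c - x) ^+ m / m`!%:R)).
  apply: measurable_funM => //; apply: measurable_funM => //.
  by apply: measurable_funX; apply: measurable_funB.
have frac01 (c : R) : 0 <= c <= 1 -> 0 <= c ^+ m / m`!%:R <= 1.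
  move=> /andP[c0 c1]; rewrite divr_ge0 ?exprn_ge0//= ler_pdivrMr ?ltr0n ?fact_gt0// mul1r.
  by apply: (le_trans (exprn_ile1 _ c0 c1)); rewrite ler1n fact_gt0.
have mlt : measurable_fun I01 (fun x : R => (y < x)%R%:R : R).
  apply: (eq_measurable_fun (\1_(`]y, +oo[%classic) : R -> R)).
    by move=> x _; rewrite indicE mem_setE/= in_itv/= andbT.
  by apply: measurable_funTS; exact: measurable_indic.
have mgt : measurable_fun I01 (fun x : R => (x < y)%R%:R : R).
  apply: (eq_measurable_fun (\1_(`]-oo, y[%classic) : R -> R)).
    by move=> x _; rewrite indicE mem_setE/= in_itv/=.
  by apply: measurable_funTS; exact: measurable_indic.
have mIs : measurable_fun I01 (fun x => sgk x y * h x).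
  by apply: rintegrable_measurable; exact: rintegrable_sgk2.
have [yx|yx|yE] := ltgtP y x0.
- rewrite [in leRHS]/dist_end ltNge (ltW yx)/=.
  have -> : H * (y ^+ m.+1 / m.+1`!%:R) =
      \int[mu]_(x in I01) ((x < y)%R%:R * (H * (x ^+ m / m`!%:R))).
    rewrite (@rint01_indic 0 y (fun x => H * (x ^+ m / m`!%:R)))//; last 3 first.
    + exact: ltW.
    + by move=> x _ /andP[_ ->]; rewrite mul1r.
    + move=> x; rewrite /= in_itv/= => /andP[-> _]/= /negbTE ->.
      by rewrite mul0r.
    have D (x : R) : is_derive x (1 : R) (fun x : R => H * (x ^+ m.+1 / m.+1`!%:R))
        (H * (x ^+ m / m`!%:R)).
      have := @is_derive_pow (H / m.+1`!%:R) 0 1 m x.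
      rewrite (_ : (fun x : R => _) = (fun x => H * (x ^+ m.+1 / m.+1`!%:R))); last first.
        by apply/funext => z; rewrite add0r mul1r mulrAC mulrA.
      move=> D; apply: is_derive_eq D _.
      by rewrite add0r mul1r mulr1 factS natrM; move: (fact0 m) (m10 m);
        move: (m.+1%:R) (m`!%:R) => u v v0 u0; field; rewrite u0 v0.
    have C : continuous (fun x : R => H * (x ^+ m / m`!%:R)).
      move=> x; apply: cvgM; first exact: cvg_cst.
      apply: cvgM; last exact: cvg_cst.
      exact: exprn_continuous.
    rewrite (continuous_FTC2_Rintegral (ltW y0) D C).
    by rewrite expr0n/= mul0r mulr0 subr0.
  apply: le_norm_rint_le => //.
  + apply: mle.
      apply: measurable_funM => //; apply: measurable_funM => //.
      by apply: measurable_funM => //; exact: measurable_funX.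
    move=> x; rewrite /= in_itv/= => /andP[x0' x1'].
    rewrite normrM [X in X * _]ger0_norm// normrM (ger0_norm H0).
    have /andP[f0 f1] := @frac01 x (introT andP (conj (ltW x0') (ltW x1'))).
    rewrite (ger0_norm f0) -[leRHS]mul1r; apply: ler_pM => //.
    + by rewrite mulr_ge0.
    + by rewrite lern1 leq_b1.
    + by rewrite ler_piMr.
  + move=> x Ix; rewrite sgk_left// normrM normrN [X in X * _]ger0_norm//.
    have [xy|xy] := ltP x y; last by rewrite !mul0r.
    rewrite !mul1r (le_trans (hH _ Ix))// /dist_end.
    by rewrite ltNge (ltW (lt_trans xy yx)).
- rewrite [in leRHS]/dist_end yx.
  have -> : H * ((1 - y) ^+ m.+1 / m.+1`!%:R) =
      \int[mu]_(x in I01) ((y < x)%R%:R * (H * ((1 - x) ^+ m / m`!%:R))).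
    rewrite (@rint01_indic y 1 (fun x => H * ((1 - x) ^+ m / m`!%:R)))//; last 3 first.
    + exact: ltW.
    + by move=> x _ /andP[-> _]; rewrite mul1r.
    + move=> x; rewrite /= in_itv/= => /andP[_ ->]/=; rewrite andbT => /negbTE ->.
      by rewrite mul0r.
    have D (x : R) : is_derive x (1 : R) (fun x : R => - (H * ((1 - x) ^+ m.+1 / m.+1`!%:R)))
        (H * ((1 - x) ^+ m / m`!%:R)).
      have := @is_derive_pow (- (H / m.+1`!%:R)) 1 (-1) m x.
      rewrite (_ : (fun x : R => _) = (fun x => - (H * ((1 - x) ^+ m.+1 / m.+1`!%:R)))); last first.
        by apply/funext => z; rewrite mulN1r mulNr mulrAC mulrA.
      move=> D; apply: is_derive_eq D _.
      by rewrite mulN1r factS natrM; move: (fact0 m) (m10 m);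
        move: (m.+1%:R) (m`!%:R) => u v v0 u0; field; rewrite u0 v0.
    have C : continuous (fun x : R => H * ((1 - x) ^+ m / m`!%:R)).
      move=> x; apply: cvgM; first exact: cvg_cst.
      apply: cvgM; last exact: cvg_cst.
      apply: (@continuous_comp _ _ _ (fun x : R => 1 - x) (fun x => x ^+ m)).
        by apply: cvgB; [exact: cvg_cst|exact: cvg_id].
      exact: exprn_continuous.
    rewrite (continuous_FTC2_Rintegral (ltW y1) D C).
    by rewrite subrr expr0n/= mul0r mulr0 oppr0 sub0r opprK.
  apply: le_norm_rint_le => //.
  + apply: mle.
      apply: measurable_funM => //; apply: measurable_funTS; exact: mpow.
    move=> x; rewrite /= in_itv/= => /andP[x0' x1'].
    rewrite normrM [X in X * _]ger0_norm// normrM (ger0_norm H0).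
    have x01' : 0 <= 1 - x <= 1 by lra.
    have /andP[f0 f1] := @frac01 (1 - x) x01'.
    rewrite (ger0_norm f0) -[leRHS]mul1r; apply: ler_pM => //.
    + by rewrite mulr_ge0.
    + by rewrite lern1 leq_b1.
    + by rewrite ler_piMr.
  + move=> x Ix; rewrite sgk_right// normrM [X in X * _]ger0_norm//.
    have [xy|xy] := ltP y x; last by rewrite !mul0r.
    rewrite !mul1r (le_trans (hH _ Ix))// /dist_end.
    by rewrite (lt_trans yx xy).
- have -> : Istar h y = 0.
    rewrite /Istar yE; transitivity (\int[mu]_(x in I01) (0 : R)).
      by apply: eq_rint => x _; rewrite sgk_diag mul0r.
    by rewrite rint_cst01.
  rewrite normr0 mulr_ge0// divr_ge0// exprn_ge0//.
  have Iy : I01 y by rewrite /= in_itv/= y0.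
  by have /andP[] := dist_end01 Iy.
Qed.

(** The absolute value of [sgk x y]. Separating it from the sign, which depends on [y] alone, treats
    both sides of [x0] at once. *)
Definition beyond (y x : R) : R :=
  if x0 < y then (y < x)%R%:R else if y < x0 then (x < y)%R%:R else 0.

Lemma sgk_beyond (x y : R) :
  sgk x y = (if x0 < y then 1 else -1) * beyond y x.
Proof.
rewrite /beyond; have [yx|yx|->] := ltgtP y x0.
- by rewrite sgk_left// mulN1r.
- by rewrite sgk_right// mul1r.
- by rewrite sgk_diag mulr0.
Qed.

Lemma beyond01 (y x : R) : 0 <= beyond y x <= 1.
Proof.
rewrite /beyond; case: ifPn => _; first by rewrite ler0n lern1 leq_b1.
by case: ifPn => _; rewrite ?ler0n ?lern1 ?leq_b1// lexx ler01.
Qed.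

Lemma measurable_beyond (y : R) (D : set R) : measurable_fun D (beyond y).
Proof.
apply: measurable_funTS.
apply: (eq_measurable_fun (fun x => (if x0 < y then 1 else -1) * sgk x y)).
  by move=> x _; rewrite sgk_beyond mulrA; case: ifPn => _; rewrite ?mulrNN !mul1r.
by apply: measurable_funM => //; exact: measurable_sgk2.
Qed.

(** On its way from [x0] to [z] the integral meets the region beyond [y] only after passing [y],
    which leaves [F z - F y]. *)
Lemma Iop_beyond (F f : R -> R) (y z : R) : I01 y -> I01 z ->
  (forall x : R, is_derive x (1 : R) F (f x)) -> continuous f -> F y = 0 ->
  Iop (fun x => beyond y x * f x) z = beyond y z * F z.
Proof.
have [x00 x01] := andP x001.
rewrite /= !in_itv/= => /andP[y0 y1] /andP[z0 z1] dF cf Fy.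
have zero (k : R -> R) : (forall x, I01 x -> k x = 0) -> \int[mu]_(x in I01) k x = 0.
  by move=> k0; rewrite (eq_rint k0) rint_cst01.
rewrite /Iop /beyond; case: ifPn => xy.
  case: ltP => [yz|zy].
    rewrite mul1r (@rint01_indic y z f); last 4 first.
    - exact: ltW.
    - exact: ltW.
    - move=> x _ /andP[yx xz].
      by rewrite yx mul1r sgk_right ?(lt_trans xy)// xz mul1r.
    - move=> x _; rewrite negb_and; case: ltP => //= yx; last by rewrite mul0r mulr0.
      by move=> /negbTE xz; rewrite sgk_right ?(lt_trans xy)// xz mul0r.
    by rewrite (continuous_FTC2_Rintegral (ltW yz) dF cf) Fy subr0.
  rewrite mul0r; apply: zero => x _; case: ltP => yx; last by rewrite mul0r mulr0.
  by rewrite sgk_right ?(lt_trans xy)// ltNge (le_trans zy (ltW yx)) mul0r.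
case: ifPn => yx; last first.
  by rewrite mul0r; apply: zero => x _; rewrite mul0r mulr0.
case: ltP => [zy|yz].
  rewrite mul1r (@rint01_indic z y (fun x => - f x)); last 4 first.
  - exact: ltW.
  - exact: ltW.
  - move=> x _ /andP[zx xy'].
    by rewrite xy' mul1r sgk_left ?(lt_trans xy')// zx mulN1r.
  - move=> x _; rewrite negb_and; case: (ltP x y) => //= xy'; last by rewrite mul0r mulr0.
    rewrite orbF => /negbTE zx; rewrite sgk_left ?(lt_trans xy')// zx.
    by rewrite oppr0 mul0r.
  have dF' x : is_derive x (1 : R) (- F) (- f x) by exact: is_deriveN.
  have cf' : continuous (fun x => - f x) by move=> x; apply: cvgN; exact: cf.
  by rewrite (continuous_FTC2_Rintegral (ltW zy) dF' cf')/= -[(- F) y]/(- F y) -[(- F) z]/(- F z) Fy; lra.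
rewrite mul0r; apply: zero => x _; case: (ltP x y) => xy'; last by rewrite mul0r mulr0.
by rewrite sgk_left ?(lt_trans xy')// ltNge (le_trans (ltW xy') yz) oppr0 mul0r.
Qed.

(** Integration by parts, obtained from the duality of [Iop] and [Istar], so that [h] may be merely
    integrable. Boundary terms vanish: [F] is 0 at [y], and [Istar h] is 0 at the endpoint. *)
Lemma Istar_by_parts (F f h : R -> R) (C : R) (y : R) : I01 y ->
  (forall x : R, is_derive x (1 : R) F (f x)) -> continuous f -> F y = 0 ->
  (forall x, `|f x| <= C) -> rintegrable I01 h ->
  \int[mu]_(x in I01) (beyond y x * f x * Istar h x) =
  \int[mu]_(x in I01) (beyond y x * F x * h x).
Proof.
move=> Iy dF cf Fy fC ih.
have ift : rintegrable I01 (fun x => beyond y x * f x).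
  apply: (rintegrable_le mI _ (rintegrable_cst01 C)).
    apply: measurable_funM; first exact: measurable_beyond.
    by apply: measurable_funTS; exact: continuous_measurable_fun.
  move=> x _; have /andP[b0 b1] := beyond01 y x.
  by rewrite normrM (ger0_norm b0) (le_trans _ (fC x))// ler_piMl.
rewrite -(IopE ift ih); apply: eq_rint => z Iz.
by rewrite (Iop_beyond Iy Iz dF cf Fy) mulrC.
Qed.

Lemma Istar_beyond (h : R -> R) (y : R) : rintegrable I01 h ->
  Istar h y = (if x0 < y then 1 else -1) * \int[mu]_(x in I01) (beyond y x * h x).
Proof.
move=> ih; rewrite -rintZl//; last first.
  apply: (@rintegrable_bddM R I01 1) => //; first exact: measurable_beyond.
  by move=> x _; have /andP[b0 b1] := beyond01 y x; rewrite ger0_norm.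
by apply: eq_rint => x _; rewrite sgk_beyond mulrA.
Qed.

(* Variation of constants for [psi'' = q - k^2 psi] with zero data at the far end. *)
Lemma Istar2_sin (k : R) (q psi : R -> R) (y : R) : 0 < k -> I01 y ->
  bm01 q -> bm01 psi ->
  (forall x, I01 x -> psi x = Istar (Istar (fun x => q x - k ^+ 2 * psi x)) x) ->
  psi y = (if x0 < y then 1 else -1) *
    \int[mu]_(x in I01) (beyond y x * (sin (k * (x - y)) / k) * q x).
Proof.
move=> k0 Iy bq bpsi psiE.
have knz : k != 0 by rewrite gt_eqF.
pose g x := q x - k ^+ 2 * psi x.
have bg : bm01 g.
  have := bm01_lin (- k ^+ 2) bpsi bq.
  by rewrite (_ : (fun x => _) = g)//; apply/funext => x; rewrite /g addrC mulNr.
have ig := bm01_rintegrable bg.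
have bpsi1 := Istar_bm01 ig; have ipsi1 := bm01_rintegrable bpsi1.
set psi1 := Istar g in bpsi1 ipsi1.
have dlin (x : R) : is_derive x (1 : R) (fun x : R => k * (x - y)) k.
  have := @is_derive_pow k (- y) 1 0 x; rewrite expr0 !mulr1.
  by rewrite (_ : (fun x : R => _) = (fun x => k * (x - y)))//; apply/funext => z; rewrite expr1 mul1r addrC.
have clin : continuous (fun x : R => k * (x - y)).
  move=> x; apply: cvgM; first exact: cvg_cst.
  by apply: cvgB; [exact: cvg_id|exact: cvg_cst].
have dsin (x : R) : is_derive x (1 : R) (fun x : R => sin (k * (x - y)) / k) (cos (k * (x - y))).
  have := is_deriveZ k^-1 (@is_derive1_comp R sin (fun x => k * (x - y)) x _ _ (is_derive_sin _) (dlin x)).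
  rewrite (_ : k^-1 \*: _ = (fun x : R => sin (k * (x - y)) / k)); last first.
    by apply/funext => z; rewrite /= /GRing.scale/= mulrC.
  by move=> D; apply: is_derive_eq D _; rewrite /GRing.scale/= mulrC mulfK.
have dcos (x : R) : is_derive x (1 : R) (fun x : R => 1 - cos (k * (x - y))) (k * sin (k * (x - y))).
  have := is_deriveB (is_derive_cst (1 : R^o) x (1 : R)) (@is_derive1_comp R cos (fun x => k * (x - y)) x _ _ (is_derive_cos _) (dlin x)).
  by move=> D; apply: is_derive_eq D _; rewrite sub0r mulNr opprK mulrC.
have ccos : continuous (fun x : R => cos (k * (x - y))).
  by move=> x; apply: (continuous_comp (clin x)); exact: continuous_cos.
have csin : continuous (fun x : R => k * sin (k * (x - y))).
  move=> x; apply: cvgM; first exact: cvg_cst.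
  by apply: (continuous_comp (clin x)); exact: continuous_sin.
have intb (c f : R -> R) (C : R) : continuous c -> (forall x, `|c x| <= C) ->
    rintegrable I01 f -> rintegrable I01 (fun x => beyond y x * c x * f x).
  move=> cc cC ift; apply: (@rintegrable_bddM R I01 C) => //.
    apply: measurable_funM; first exact: measurable_beyond.
    by apply: measurable_funTS; exact: continuous_measurable_fun.
  move=> x _; have /andP[b0 b1] := beyond01 y x.
  by rewrite normrM (ger0_norm b0) (le_trans _ (cC x))// ler_piMl.
have csk : continuous (fun x : R => sin (k * (x - y)) / k).
  move=> x; apply: cvgM; last exact: cvg_cst.
  by apply: (continuous_comp (clin x)); exact: continuous_sin.
have c1c : continuous (fun x : R => 1 - cos (k * (x - y))).
  by move=> x; apply: cvgB; [exact: cvg_cst|exact: ccos].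
have bsk x : `|sin (k * (x - y)) / k| <= k^-1.
  by rewrite normrM normfV (gtr0_norm k0) ler_piMl ?invr_ge0 ?(ltW k0) ?sin_max.
have b1c x : `|1 - cos (k * (x - y))| <= 2.
  by apply: le_trans (ler_normB _ _) _; rewrite normr1 lerD2l cos_max.
have bks x : `|k * sin (k * (x - y))| <= k.
  by rewrite normrM (gtr0_norm k0) -[leRHS]mulr1 ler_wpM2l ?(ltW k0)// sin_max.
rewrite psiE// -/g -/psi1 Istar_beyond//; congr (_ * _).
(* Write 1 as [cos + (1 - cos)]. By parts, the first half gives [sin / k] against
   [g = q - k ^ 2 * psi] and the second gives [k * sin] against [psi]; the terms with [psi]
   cancel. *)
transitivity (\int[mu]_(x in I01) (beyond y x * cos (k * (x - y)) * psi1 x +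
   beyond y x * (1 - cos (k * (x - y))) * psi1 x)).
  by apply: eq_rint => x _; ring.
rewrite rintD//; last 2 first.
- by apply: (intb _ _ 1) => // x; exact: cos_max.
- exact: (intb _ _ 2).
have := @Istar_by_parts _ _ g 1 y Iy dsin ccos _ _ ig.
rewrite subrr mulr0 sin0 mul0r => /(_ erefl) H1.
have {}H1 := H1 (fun x => cos_max _).
have := @Istar_by_parts _ _ psi1 k y Iy dcos csin _ _ ipsi1.
rewrite subrr mulr0 cos0 subrr => /(_ erefl) H2.
have {}H2 : \int[mu]_(x in I01) (beyond y x * (k * sin (k * (x - y))) * Istar psi1 x) =
    \int[mu]_(x in I01) (beyond y x * (1 - cos (k * (x - y))) * psi1 x).
  apply: H2 => x; rewrite normrM (gtr0_norm k0) -[leRHS]mulr1 ler_wpM2l ?(ltW k0)//.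
  exact: sin_max.
rewrite {}H1 -{}H2 -rintD//; last 2 first.
- exact: (intb _ _ k^-1).
- by apply: (intb _ _ k) => //; apply: bm01_rintegrable; exact: Istar_bm01.
apply: eq_rint => x Ix; rewrite -psiE// /g.
by field.
Qed.

End VolterraOperator.

(** * Factorial estimates behind the order 1/2 *)

Section FactorialSeries.
Context (R : realType).

Lemma exp_partial_le (x : R) (M : nat) : 0 <= x ->
  \sum_(m < M) x ^+ m / m`!%:R <= expR x.
Proof.
move=> x0; have -> : \sum_(m < M) x ^+ m / m`!%:R = series (exp_coeff x) M.
  rewrite /series/= big_mkord; apply: eq_bigr => m _.
  by rewrite exp_coeffE mulrC.
rewrite /expR; apply: nondecreasing_cvgn_le.
  apply/nondecreasing_seqP => n; rewrite /series/= big_nat_recr//= lerDl.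
  exact: exp_coeff_ge0.
exact: is_cvg_series_exp_coeff.
Qed.

Lemma exp_term_le (x : R) (m : nat) : 0 <= x -> x ^+ m / m`!%:R <= expR x.
Proof.
move=> x0; apply: le_trans (exp_partial_le m.+1 x0).
rewrite big_ord_recr/= lerDr; apply: sumr_ge0 => i _.
by rewrite divr_ge0// exprn_ge0.
Qed.

Lemma fact_double (m : nat) : (m`! * m ^ m <= (2 * m)`!)%N.
Proof.
have H k : (m`! * m ^ k <= (m + k)`!)%N.
  elim: k => [|k IH]; first by rewrite addn0 expn0 muln1.
  rewrite addnS factS expnS mulnCA; apply: leq_mul => //.
  by rewrite -addnS leq_addr.
by rewrite mul2n -addnn.
Qed.

(** From [m ^ m <= e ^ m * m!] follows [(2 m)! >= (m ^ 2 / e) ^ m], so the term is at most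
    [(e * X / m ^ 2) ^ m]. About [Num.sqrt X] terms therefore suffice before the decay becomes
    geometric. *)
Lemma tail_term_le (X : R) (M m : nat) : 0 <= X -> (1 <= M)%N -> (M <= m)%N ->
  2 * expR 1 * X <= M%:R ^+ 2 -> X ^+ m / (2 * m)`!%:R <= 2^-1 ^+ m.
Proof.
move=> X0 M1 Mm XM.
have e0 : 0 < expR 1 :> R := expR_gt0 _.
have m0 : 0 < m%:R :> R by rewrite ltr0n (leq_trans M1).
have Xm : 2 * expR 1 * X <= m%:R ^+ 2.
  by apply: (le_trans XM); rewrite lerXn2r ?nnegrE ?ler_nat.
have H1 : m%:R ^+ m <= expR 1 ^+ m * m`!%:R :> R.
  rewrite -ler_pdivrMr ?ltr0n ?fact_gt0//.
  by apply: le_trans (exp_term_le m (ltW m0)) _; rewrite -expRM_natl mulr1.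
have H2 : m%:R ^+ (2 * m) <= expR 1 ^+ m * (2 * m)`!%:R :> R.
  rewrite mul2n -addnn exprD.
  apply: (@le_trans _ _ (expR 1 ^+ m * m`!%:R * m%:R ^+ m)).
    by apply: ler_wpM2r => //; rewrite exprn_ge0// ltW.
  rewrite -mulrA; apply: ler_wpM2l; first by rewrite exprn_ge0// ltW.
  by rewrite -natrX -natrM ler_nat addnn -mul2n fact_double.
have H3 : (2 * expR 1 * X) ^+ m <= expR 1 ^+ m * (2 * m)`!%:R.
  apply: le_trans H2; rewrite exprM; apply: lerXn2r => //.
    by rewrite nnegrE !mulr_ge0// ltW.
  by rewrite nnegrE exprn_ge0// ltW.
have em0 : 0 < expR 1 ^+ m :> R by rewrite exprn_gt0.
have H4 : 2 ^+ m * X ^+ m <= (2 * m)`!%:R.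
  rewrite -(ler_pM2l em0); apply: le_trans H3.
  by rewrite !exprMn mulrCA mulrA.
rewrite ler_pdivrMr ?ltr0n ?fact_gt0// exprVn.
by rewrite -ler_pdivrMl ?invr_gt0 ?exprn_gt0// invrK.
Qed.

Lemma fact_le_exp (m : nat) : (m`! <= m ^ m)%N.
Proof.
have H k : (k <= m)%N -> (k`! <= m ^ k)%N.
  elim: k => [//|k IH] km; rewrite factS expnS leq_mul// IH//; exact: ltnW.
exact: H.
Qed.

(** As [(2 m)! >= m! * m!], each term is at most [(d * X) ^ m / m!] times [d^-1 ^ m / m!], and the
    second factor is at most [expR d^-1]. The free [d] expresses growth below every exponential. *)
Lemma double_fact_sum_le (X d : R) (M : nat) : 0 <= X -> 0 < d ->
  \sum_(m < M) X ^+ m / (2 * m)`!%:R <= expR (d * X) * expR d^-1.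
Proof.
move=> X0 d0; have dX : 0 <= d * X by rewrite mulr_ge0// ltW.
apply: (@le_trans _ _ (\sum_(m < M) (d * X) ^+ m / m`!%:R * expR d^-1)); last first.
  by rewrite -mulr_suml ler_wpM2r ?expR_ge0// exp_partial_le.
apply: ler_sum => m _.
have di0 : 0 <= d^-1 by rewrite invr_ge0 ltW.
apply: (@le_trans _ _ ((d * X) ^+ m / m`!%:R * (d^-1 ^+ m / m`!%:R))); last first.
  by rewrite ler_wpM2l ?exp_term_le// divr_ge0// exprn_ge0.
have -> : (d * X) ^+ m / m`!%:R * (d^-1 ^+ m / m`!%:R) = X ^+ m / (m`! * m`!)%:R.
  rewrite natrM exprMn exprVn.
  have f0 : m`!%:R != 0 :> R by rewrite pnatr_eq0 -lt0n fact_gt0.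
  have dm0 : d ^+ m != 0 by rewrite expf_neq0// gt_eqF.
  by field; rewrite f0 dm0.
apply: ler_wpM2l; first exact: exprn_ge0.
rewrite lef_pV2 ?posrE ?ltr0n ?muln_gt0 ?fact_gt0// ler_nat.
apply: leq_trans (fact_double m); rewrite leq_mul2l; apply/orP; right.
exact: fact_le_exp.
Qed.

(** Comparison with a geometric series from [M0] on. The explicit rate later measures how well the
    partial sums approximate the resolvent. *)
Lemma geometric_tail_cvg (a : nat -> R) (K : R) (M0 : nat) : 0 <= K ->
  (forall m, (M0 <= m)%N -> `|a m| <= K * 2^-1 ^+ m) ->
  exists l, (\sum_(m < M) a m) @[M --> \oo] --> l /\
    forall M, (M0 <= M)%N -> `|l - \sum_(m < M) a m| <= 2 * K * 2^-1 ^+ M.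
Proof.
move=> K0 aK.
have geo M k : \sum_(M <= m < M + k) K * 2^-1 ^+ m = 2 * K * (2^-1 ^+ M - 2^-1 ^+ (M + k)).
  elim: k => [|k IH]; first by rewrite addn0 big_geq// subrr mulr0.
  rewrite addnS big_nat_recr ?leq_addr//= IH exprS; move: (2^-1 ^+ (M + k)) => z.
  by field.
have dist M M' : (M0 <= M)%N -> (M <= M')%N ->
    \sum_(M <= m < M') `|a m| <= 2 * K * 2^-1 ^+ M.
  move=> M0M MM'; apply: (@le_trans _ _ (\sum_(M <= m < M') K * 2^-1 ^+ m)).
    by apply: ler_sum_nat => m /andP[Mm _]; apply: aK; exact: leq_trans Mm.
  by rewrite -(subnKC MM') geo ler_wpM2l ?mulr_ge0// gerBl exprn_ge0// invr_ge0.
have cv : cvgn (series a).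
  apply: normed_cvg; apply: nondecreasing_is_cvgn.
    apply/nondecreasing_seqP => n; rewrite [X in X <= _]/series [X in _ <= X]/series/= big_nat_recr//= lerDl.
    exact: normr_ge0.
  exists (\sum_(0 <= m < M0) `|a m| + 2 * K * 2^-1 ^+ M0) => _ [n _ <-].
  rewrite /series/=; have [nM|Mn] := leqP n M0.
    rewrite /series/=  (@big_cat_nat _ _ _ n 0 M0)//= -addrA lerDl addr_ge0//.
      by apply: sumr_ge0.
    by rewrite mulr_ge0 ?mulr_ge0// exprn_ge0// invr_ge0.
  by rewrite /series/= (@big_cat_nat _ _ _ M0 0 n) ?(ltnW Mn)//= lerD2l dist// ltnW.
have E M : \sum_(m < M) a m = series a M by rewrite /series/= big_mkord.
exists (limn (series a)); split.
  by under eq_fun do rewrite E.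
move=> M M0M; rewrite E.
have c2 : `|series a n - series a M| @[n --> \oo] --> `|limn (series a) - series a M|.
  by apply: cvg_norm; apply: cvgB => //; exact: cvg_cst.
rewrite -(cvg_lim _ c2)//; apply: limr_le; first by apply/cvg_ex; eexists; exact: c2.
near=> n; have Mn : (M <= n)%N by near: n; exact: nbhs_infty_ge.
rewrite /series/= (@big_cat_nat _ _ _ M 0 n)//= addrAC subrr add0r.
by apply: le_trans (ler_norm_sum _ _ _) _; exact: dist.
Unshelve. all: by end_near. Qed.

End FactorialSeries.

(** * The resolvent of the twice iterated Volterra operator *)

Section Resolvent.
Context (R : realType) (x0 P : R) (p a : R -> R).
Local Notation mu := (@lebesgue_measure R).
Local Notation I01 := (`]0, 1[%classic : set R).
Hypothesis x001 : 0 < x0 < 1.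
Hypothesis bp : bm01 p.
Hypothesis pP : forall x, I01 x -> `|p x| <= P.
Hypothesis ia : rintegrable I01 a.

Let mI : measurable I01. Proof. exact: measurable_itv. Qed.

Let P0 : 0 <= P.
Proof.
apply: le_trans (pP (x := 2^-1) _); first exact: normr_ge0.
by rewrite /= in_itv/=; apply/andP; split; lra.
Qed.

Definition Istar2 (g : R -> R) : R -> R := Istar x0 (Istar x0 g).

(** The factor [lam + p] multiplies after [B]: a solution of [g = h + resQ lam g] then satisfies
    [g - p * B g = lam * B g + h], whose left side is the weight in the moment equation. *)
Definition resQ (lam : R) (g : R -> R) (x : R) : R := (lam + p x) * Istar2 g x.

Definition Afun (g : R -> R) : R := \int[mu]_(x in I01) (a x * Istar2 g x).

Lemma Istar2_bm01 (g : R -> R) : bm01 g -> bm01 (Istar2 g).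
Proof.
by move=> bg; do 2 (apply: Istar_bm01; apply: bm01_rintegrable).
Qed.

Lemma Istar2_lin (c : R) (g k : R -> R) : bm01 g -> bm01 k ->
  Istar2 (fun x => c * g x + k x) = (fun x => c * Istar2 g x + Istar2 k x).
Proof.
move=> bg bk; rewrite /Istar2.
have ig := bm01_rintegrable bg; have ik := bm01_rintegrable bk.
have -> : Istar x0 (fun x => c * g x + k x) = (fun x => c * Istar x0 g x + Istar x0 k x).
  by apply/funext => y; exact: Istar_lin.
apply/funext => y; apply: Istar_lin => //; apply: bm01_rintegrable; exact: Istar_bm01.
Qed.

Lemma eq_Istar2 (g k : R -> R) : (forall x, I01 x -> g x = k x) -> Istar2 g = Istar2 k.
Proof. by move=> gk; rewrite /Istar2 (eq_Istar x0 gk). Qed.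

Lemma Istar2_dist_end (m : nat) (H : R) (g : R -> R) : 0 <= H -> bm01 g ->
  (forall x, I01 x -> `|g x| <= H * (dist_end x0 x ^+ m / m`!%:R)) ->
  forall y, I01 y -> `|Istar2 g y| <= H * (dist_end x0 y ^+ m.+2 / m.+2`!%:R).
Proof.
move=> H0 bg gH; have ig := bm01_rintegrable bg.
apply: Istar_dist_end => //; last exact: Istar_dist_end.
by apply: bm01_rintegrable; exact: Istar_bm01.
Qed.

Lemma dist_end_pow (m : nat) (x : R) : I01 x ->
  0 <= dist_end x0 x ^+ m / m`!%:R <= (m`!%:R)^-1.
Proof.
move=> /(dist_end01 x0)/andP[d0 d1]; rewrite divr_ge0 ?exprn_ge0//=.
by rewrite ler_piMl// exprn_ile1.
Qed.

Lemma Istar2_le (H : R) (g : R -> R) : bm01 g -> (forall x, I01 x -> `|g x| <= H) ->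
  forall y, I01 y -> `|Istar2 g y| <= H.
Proof.
move=> bg gH y Iy; have H0 : 0 <= H by apply: le_trans (gH _ Iy).
apply: le_trans (@Istar2_dist_end 0 H g H0 bg _ y Iy) _.
  by move=> x Ix; rewrite expr0 fact0 divr1 mulr1 gH.
have /andP[d0 d1] := dist_end_pow 2 Iy.
rewrite ler_piMr//; apply: le_trans d1 _; rewrite invf_le1 ?ler1n ?ltr0n//.
Qed.

Lemma resQ_bm01 (lam : R) (g : R -> R) : bm01 g -> bm01 (resQ lam g).
Proof.
move=> bg; have := bm01_lin lam (Istar2_bm01 bg) (bm01M bp (Istar2_bm01 bg)).
by congr (@bm01 R _); apply/funext => x; rewrite /resQ mulrDl.
Qed.

Lemma resQ_lin (lam c : R) (g k : R -> R) : bm01 g -> bm01 k ->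
  resQ lam (fun x => c * g x + k x) = (fun x => c * resQ lam g x + resQ lam k x).
Proof.
move=> bg bk; rewrite /resQ Istar2_lin//; by apply/funext => x; rewrite mulrDr mulrCA.
Qed.

Lemma iter_resQ_bm01 (lam : R) (g : R -> R) (m : nat) : bm01 g -> bm01 (iter m (resQ lam) g).
Proof. by move=> bg; elim: m => //= m IH; exact: resQ_bm01. Qed.

Lemma iter_resQ_lin (lam c : R) (g k : R -> R) (m : nat) : bm01 g -> bm01 k ->
  iter m (resQ lam) (fun x => c * g x + k x) =
  (fun x => c * iter m (resQ lam) g x + iter m (resQ lam) k x).
Proof.
move=> bg bk; elim: m => //= m ->; rewrite resQ_lin//; exact: iter_resQ_bm01.
Qed.

Lemma lamp_le (lam x : R) : I01 x -> `|lam + p x| <= `|lam| + P.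
Proof. by move=> Ix; rewrite (le_trans (ler_normD _ _))// lerD2l pP. Qed.

(** Each [B] is two integrations, so [m] iterations produce [(2 m)!]; this is where the order 1/2 in
    [lam] arises. *)
Lemma iter_resQ_dist_end (lam H : R) (g : R -> R) (m : nat) : bm01 g ->
  (forall x, I01 x -> `|g x| <= H) -> forall x, I01 x ->
  `|iter m (resQ lam) g x| <=
    H * (`|lam| + P) ^+ m * (dist_end x0 x ^+ (2 * m) / (2 * m)`!%:R).
Proof.
move=> bg gH; elim: m => [|m IH] x Ix /=.
  by rewrite muln0 !expr0 fact0 divr1 !mulr1 gH.
have H0 : 0 <= H by apply: le_trans (gH _ Ix).
have lP : 0 <= `|lam| + P by rewrite addr_ge0.
have -> : (2 * m.+1 = (2 * m).+2)%N by rewrite mulnS.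
rewrite {1}/resQ normrM; set D := _ / _.
have -> : H * (`|lam| + P) ^+ m.+1 * D = (`|lam| + P) * (H * (`|lam| + P) ^+ m * D).
  by rewrite exprS; move: (_ ^+ m) => z; ring.
apply: ler_pM => //; first exact: lamp_le.
apply: Istar2_dist_end => //; first by rewrite mulr_ge0// exprn_ge0.
exact: iter_resQ_bm01.
Qed.

Lemma iter_resQ_le (lam H : R) (g : R -> R) (m : nat) : bm01 g ->
  (forall x, I01 x -> `|g x| <= H) -> forall x, I01 x ->
  `|iter m (resQ lam) g x| <= H * ((`|lam| + P) ^+ m / (2 * m)`!%:R).
Proof.
move=> bg gH x Ix; apply: le_trans (iter_resQ_dist_end lam m bg gH Ix) _.
have H0 : 0 <= H by apply: le_trans (gH _ Ix).
rewrite [leRHS]mulrA ler_wpM2l ?mulr_ge0 ?exprn_ge0 ?addr_ge0//.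
by have /andP[] := dist_end_pow (2 * m) Ix.
Qed.

Lemma Afun_lin (c : R) (g k : R -> R) : bm01 g -> bm01 k ->
  Afun (fun x => c * g x + k x) = c * Afun g + Afun k.
Proof.
move=> bg bk.
have iag h : bm01 h -> rintegrable I01 (fun x => a x * Istar2 h x).
  move=> bh; have [mB [K BK]] := Istar2_bm01 bh.
  apply: (@eq_rintegrable _ _ (fun x => Istar2 h x * a x)) => // [x _|]; first exact: mulrC.
  exact: (@rintegrable_bddM _ _ K).
have Zl := rintZl c mI (iag _ bg).
have D := rintD mI (rintegrableZl c mI (iag _ bg)) (iag _ bk).
rewrite /Afun -[X in _ = X + _]Zl -D; apply: eq_rint => x _.
by rewrite (Istar2_lin _ bg bk) mulrDr mulrCA.
Qed.

Lemma eq_Afun (g k : R -> R) : (forall x, I01 x -> g x = k x) -> Afun g = Afun k.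
Proof. by move=> gk; rewrite /Afun (eq_Istar2 gk). Qed.

Lemma Afun_le_Istar2 (H : R) (g : R -> R) : bm01 g ->
  (forall x, I01 x -> `|Istar2 g x| <= H) ->
  `|Afun g| <= H * \int[mu]_(x in I01) `|a x|.
Proof.
move=> bg gH; rewrite -rintZl//; last exact: rintegrable_norm.
apply: le_norm_rint_le => //.
- apply: measurable_funM; first exact: rintegrable_measurable.
  by have [] := Istar2_bm01 bg.
- by apply: rintegrableZl => //; exact: rintegrable_norm.
- by move=> x Ix; rewrite normrM mulrC ler_wpM2r// gH.
Qed.

Lemma Afun_le (H : R) (g : R -> R) : bm01 g ->
  (forall x, I01 x -> `|g x| <= H) -> `|Afun g| <= H * \int[mu]_(x in I01) `|a x|.
Proof. by move=> bg gH; apply: Afun_le_Istar2 => //; exact: Istar2_le. Qed.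

(** The induction generalises over [h] because peeling off the innermost factor gives
    [lam * B h + p * B h], hence two new starting functions. *)
Lemma Afun_iter_poly (h : R -> R) (m : nat) : bm01 h ->
  exists q : {poly R}, (size q <= m.+1)%N /\
    forall lam, Afun (iter m (resQ lam) h) = q.[lam].
Proof.
elim: m h => [|m IH] h bh.
  by exists (Afun h)%:P; split => [|lam]; rewrite ?size_polyC_leq1 ?hornerC.
have bB := Istar2_bm01 bh.
have [q1 [s1 E1]] := IH _ bB; have [q2 [s2 E2]] := IH _ (bm01M bp bB).
exists ('X * q1 + q2); split => [|lam].
  apply: leq_trans (size_polyD _ _) _; rewrite geq_max (leqW s2) andbT.
  by apply: leq_trans (size_polyMleq _ _) _; rewrite size_polyX.
rewrite iterSr.
have -> : resQ lam h = (fun x => lam * Istar2 h x + p x * Istar2 h x).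
  by apply/funext => x; rewrite /resQ mulrDl.
have bpB := bm01M bp bB.
rewrite iter_resQ_lin// Afun_lin; [|exact: iter_resQ_bm01|exact: iter_resQ_bm01].
by rewrite E1 E2 !hornerE.
Qed.

Definition resS (lam : R) (h : R -> R) (M : nat) (x : R) : R :=
  \sum_(m < M) iter m (resQ lam) h x.

Lemma resSS (lam : R) (h : R -> R) (M : nat) :
  resS lam h M.+1 = (fun x => 1 * resS lam h M x + iter M (resQ lam) h x).
Proof. by apply/funext => x; rewrite /resS big_ord_recr mul1r. Qed.

Lemma resS0 (lam : R) (h : R -> R) : resS lam h 0 = fun=> 0.
Proof. by apply/funext => x; rewrite /resS big_ord0. Qed.

Lemma resS_bm01 (lam : R) (h : R -> R) (M : nat) : bm01 h -> bm01 (resS lam h M).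
Proof.
move=> bh; elim: M => [|M IH]; first by rewrite resS0; exact: bm01_cst.
by rewrite resSS; apply: bm01_lin => //; exact: iter_resQ_bm01.
Qed.

Lemma Istar2_0 : Istar2 (fun=> 0) = fun=> 0.
Proof.
have := @Istar2_lin 1 (fun=> 0) (fun=> 0) (bm01_cst 0) (bm01_cst 0).
rewrite (_ : (fun x : R => _) = (fun=> 0)); last by apply/funext => x; rewrite mul1r addr0.
move=> E; apply/funext => x; have := congr1 (fun f : R -> R => f x) E.
by rewrite /= mul1r; lra.
Qed.

Lemma resS_rec (lam : R) (h : R -> R) (M : nat) (x : R) : bm01 h ->
  resS lam h M.+1 x = h x + resQ lam (resS lam h M) x.
Proof.
move=> bh; elim: M => [|M IH].
  by rewrite resSS resS0 /resQ Istar2_0 !mulr0 add0r addr0.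
rewrite resSS mul1r {}IH (resSS lam h M).
rewrite resQ_lin; [|exact: resS_bm01|exact: iter_resQ_bm01].
by rewrite mul1r addrA.
Qed.

Lemma Afun_resS_poly (h : R -> R) (M : nat) : bm01 h ->
  exists q : {poly R}, (size q <= M)%N /\ forall lam, Afun (resS lam h M) = q.[lam].
Proof.
move=> bh; elim: M => [|M [q [sq IH]]].
  exists 0; rewrite size_poly0; split => // lam; rewrite resS0 horner0 /Afun Istar2_0.
  rewrite -[RHS](rint_cst01 (0 : R)); apply: eq_rint => x _; exact: mulr0.
have [q1 [s1 E1]] := Afun_iter_poly M bh.
exists (q + q1); split => [|lam].
  by apply: leq_trans (size_polyD _ _) _; rewrite geq_max s1 (leqW sq).
rewrite resSS Afun_lin; [|exact: resS_bm01|exact: iter_resQ_bm01].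
by rewrite mul1r IH E1 hornerD.
Qed.

(** The sum of the Neumann series. Its growth in [lam] stays below every exponential, which is used
    as [lam -> +oo]; the last clause controls the partial sums, which are polynomial in [lam] under
    [Afun]. *)
Lemma resolvent (lam H : R) (h : R -> R) : bm01 h ->
  (forall x, I01 x -> `|h x| <= H) ->
  exists g, [/\ bm01 g,
    forall x, I01 x -> g x = h x + resQ lam g x,
    forall d, 0 < d -> forall x, I01 x ->
      `|g x| <= H * (expR (d * (`|lam| + P)) * expR d^-1) &
    forall M, (1 <= M)%N -> 2 * expR 1 * (`|lam| + P) <= M%:R ^+ 2 ->
      forall x, I01 x -> `|g x - resS lam h M x| <= 2 * H * 2^-1 ^+ M].
Proof.
move=> bh hH.
have I12 : I01 (2^-1 : R) by rewrite /= in_itv/=; apply/andP; split; lra.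
have H0 : 0 <= H by apply: le_trans (hH _ I12).
have X0 : 0 <= `|lam| + P by rewrite addr_ge0.
have term M : (1 <= M)%N -> 2 * expR 1 * (`|lam| + P) <= M%:R ^+ 2 ->
    forall x, I01 x -> forall m, (M <= m)%N ->
      `|iter m (resQ lam) h x| <= H * 2^-1 ^+ m.
  move=> M1 XM x Ix m Mm; apply: le_trans (iter_resQ_le lam m bh hH Ix) _.
  by rewrite ler_wpM2l//; exact: tail_term_le XM.
have [M0 M01 XM0] : exists2 M0 : nat, (1 <= M0)%N & 2 * expR 1 * (`|lam| + P) <= M0%:R ^+ 2.
  exists (Num.truncn (2 * expR 1 * (`|lam| + P))).+1 => //.
  have := truncnS_gt (2 * expR 1 * (`|lam| + P)); set n := _.+1 => /ltW le.
  by apply: (le_trans le); rewrite -natrX ler_nat expnS expn1 leq_pmulr.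
pose g x := limn (fun M => resS lam h M x).
have gcv x : I01 x -> (fun M => resS lam h M x) @ \oo --> g x.
  move=> Ix; have [l [lcv _]] := geometric_tail_cvg H0 (term M0 M01 XM0 x Ix).
  by apply/cvg_ex; exists l.
have gle d : 0 < d -> forall x, I01 x -> `|g x| <= H * (expR (d * (`|lam| + P)) * expR d^-1).
  move=> d0 x Ix; have c1 : `|resS lam h M x| @[M --> \oo] --> `|g x| by apply: cvg_norm; exact: gcv.
  rewrite -(cvg_lim _ c1)//; apply: limr_le; first by apply/cvg_ex; eexists; exact: c1.
  apply: nearW => M; rewrite /resS; apply: le_trans (ler_norm_sum _ _ _) _.
  apply: (@le_trans _ _ (H * \sum_(m < M) (`|lam| + P) ^+ m / (2 * m)`!%:R)).
    by rewrite mulr_sumr; apply: ler_sum => m _; exact: iter_resQ_le.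
  by rewrite ler_wpM2l// double_fact_sum_le.
have bg : bm01 g.
  split; last by exists (H * (expR (1 * (`|lam| + P)) * expR 1^-1)); exact: gle.
  apply: (@measurable_fun_cvg _ _ _ _ (resS lam h)) => //.
  by move=> M; have [] := resS_bm01 lam M bh.
have gtail M : (1 <= M)%N -> 2 * expR 1 * (`|lam| + P) <= M%:R ^+ 2 ->
      forall x, I01 x -> `|g x - resS lam h M x| <= 2 * H * 2^-1 ^+ M.
  move=> M1 XM x Ix; have [l [lcv lM]] := geometric_tail_cvg H0 (term M M1 XM x Ix).
  have -> : g x = l by apply: cvg_unique lcv => //; exact: gcv.
  exact: lM.
exists g; split => // x Ix.
(* The partial sums approximate [g] uniformly in [x], so the limit passes through [Istar2] and the
   recursion [resS_rec] becomes the resolvent equation. *)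
have c1 : resQ lam (resS lam h n) x @[n --> \oo] --> resQ lam g x.
  apply: cvgM; first exact: cvg_cst.
  apply/cvgrPdist_le => e e0.
  have c0 : 2 * H * 2^-1 ^+ n @[n --> \oo] --> (0 : R).
    rewrite [X in _ --> X](_ : 0 = 2 * H * 0); last by rewrite mulr0.
    apply: cvgM; first exact: cvg_cst.
    by apply: cvg_expr; rewrite ger0_norm; lra.
  have /cvgrPdist_le/(_ e e0) := c0; apply: filterS2; last exact: (nbhs_infty_ge M0).
  move=> n nM0; rewrite sub0r normrN ger0_norm; last first.
    by rewrite !mulr_ge0// exprn_ge0.
  apply: le_trans.
  have -> : Istar2 g x - Istar2 (resS lam h n) x =
      Istar2 (fun x => -1 * resS lam h n x + g x) x.
    by rewrite Istar2_lin ?mulN1r 1?addrC//; exact: resS_bm01.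
  apply: (@Istar2_le _ _ _ _ _ Ix) => [|y Iy].
    by apply: bm01_lin => //; exact: resS_bm01.
  rewrite mulN1r addrC; apply: gtail => //; first exact: leq_trans nM0.
  apply: (le_trans XM0); by rewrite lerXn2r ?nnegrE// ler_nat.
have c2 : h x + resQ lam (resS lam h n) x @[n --> \oo] --> h x + resQ lam g x.
  by apply: cvgD => //; exact: cvg_cst.
apply: cvg_unique c2 => //.
have := gcv x Ix; rewrite -(cvg_shiftS (fun M => resS lam h M x)).
by under eq_fun do rewrite resS_rec//.
Qed.

(** The difference of two solutions is fixed by [resQ 0], hence by all its iterates, whose size is
    of order [P ^ m / (2 m)!]. *)
Lemma resolvent0_unique (g k : R -> R) : bm01 g -> bm01 k ->
  (forall x, I01 x -> g x - resQ 0 g x = k x - resQ 0 k x) ->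
  forall x, I01 x -> g x = k x.
Proof.
move=> bg bk E.
pose d x := -1 * k x + g x.
have bd : bm01 d by exact: bm01_lin.
have dE x : I01 x -> d x = resQ 0 d x.
  by move=> Ix; move: (E _ Ix); rewrite /d (resQ_lin _ _ bk bg); move: (resQ 0 g x) (resQ 0 k x) => u v; lra.
have itE m x : I01 x -> d x = iter m (resQ 0) d x.
  elim: m x => [//|m IH] x Ix; rewrite iterS (dE _ Ix).
  by rewrite {1}/resQ (eq_Istar2 IH).
have [_ [H dH]] := bd.
move=> x Ix; have H0 : 0 <= H by apply: le_trans (dH _ Ix).
suff /eqP : d x = 0 by rewrite /d mulN1r addrC subr_eq0 => /eqP.
apply/eqP; rewrite -normr_le0; apply/ler_addgt0Pr => e e0; rewrite add0r.
have [M1 M11 XM1] : exists2 M0 : nat, (1 <= M0)%N & 2 * expR 1 * P <= M0%:R ^+ 2.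
  exists (Num.truncn (2 * expR 1 * P)).+1 => //.
  have := truncnS_gt (2 * expR 1 * P); set n := _.+1 => /ltW le.
  by apply: (le_trans le); rewrite -natrX ler_nat expnS expn1 leq_pmulr.
have c0 : H * 2^-1 ^+ n @[n --> \oo] --> (0 : R).
  rewrite [X in _ --> X](_ : 0 = H * 0); last by rewrite mulr0.
  apply: cvgM; first exact: cvg_cst.
  by apply: cvg_expr; rewrite ger0_norm; lra.
have /cvgrPdist_le/(_ e e0) := c0 => -[n _ nP].
have := nP (maxn n M1) (leq_maxl _ _).
rewrite /= sub0r normrN ger0_norm; last by rewrite !mulr_ge0// exprn_ge0.
apply: le_trans; rewrite (itE (maxn n M1))//.
apply: le_trans (iter_resQ_le 0 _ bd dH Ix) _.
by rewrite normr0 add0r ler_wpM2l//; apply: tail_term_le XM1 => //; exact: leq_maxr.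
Qed.

(* Where [lam = - k^2] is very negative the potential is a perturbation of the
   oscillating kernel [sin (k (x - y)) / k]. *)
Lemma resolvent_neg (k H : R) (h g : R -> R) : 0 < k -> 2 * P <= k -> bm01 h -> bm01 g ->
  (forall x, I01 x -> `|h x| <= H) ->
  (forall x, I01 x -> g x = h x + resQ (- k ^+ 2) g x) ->
  forall x, I01 x -> `|Istar2 g x| <= 2 * H / k.
Proof.
move=> k0 Pk bh bg hH gE.
pose psi := Istar2 g.
have bpsi : bm01 psi := Istar2_bm01 bg.
pose q x := 1 * h x + p x * psi x.
have bq : bm01 q by apply: bm01_lin => //; exact: bm01M.
have psiE : forall x, I01 x -> psi x = Istar x0 (Istar x0 (fun x => q x - k ^+ 2 * psi x)) x.
  move=> x Ix; rewrite -[RHS]/(Istar2 _ x) /psi; congr (_ x); apply: eq_Istar2 => y Iy.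
  by rewrite gE// /resQ /q /psi; ring.
have sine x : I01 x -> forall K, (forall x, I01 x -> `|q x| <= K) -> `|psi x| <= K / k.
  move=> Ix K qK.
  rewrite (Istar2_sin x001 k0 Ix bq bpsi psiE) normrM.
  rewrite (_ : `|if _ then _ else _| = 1); last by case: ifPn => _; rewrite ?normrN normr1.
  rewrite mul1r -(rint_cst01 (K / k)); apply: le_norm_rint_le => //.
  - apply: measurable_funM; last by case: bq.
    apply: measurable_funM; first exact: measurable_beyond.
    apply: measurable_funTS; apply: continuous_measurable_fun => z.
    apply: cvgM; last exact: cvg_cst.
    apply: (@continuous_comp _ _ _ (fun y : R => k * (y - x)) sin); last exact: continuous_sin.
    by apply: cvgM; [exact: cvg_cst|apply: cvgB; [exact: cvg_id|exact: cvg_cst]].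
  - exact: rintegrable_cst01.
  - move=> y Iy; rewrite normrM mulrC; apply: ler_pM => //; first exact: qK.
    rewrite normrM; have /andP[b0 b1] := beyond01 x0 x y.
    rewrite (ger0_norm b0) -[leRHS]mul1r; apply: ler_pM => //.
    by rewrite normrM normfV (gtr0_norm k0) ler_piMl ?invr_ge0 ?(ltW k0)// sin_max.
have [_ [Psi0 hPsi0]] := bpsi.
(* Bootstrap: a bound [2 * H / k + E] on [psi], inserted into [q = h + p * psi], comes back with
   [E / 2] in place of [E], because the kernel is at most [1 / k] and [2 * P <= k]. *)
have bnd n x : I01 x -> `|psi x| <= 2 * H / k + Psi0 * 2^-1 ^+ n.
  elim: n x => [|n IH] x Ix.
    have H0 : 0 <= H by apply: le_trans (hH _ Ix).
    rewrite expr0 mulr1 (le_trans (hPsi0 _ Ix))// lerDr divr_ge0 ?mulr_ge0 ?(ltW k0)//.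
  have H0 : 0 <= H by apply: le_trans (hH _ Ix).
  have S0 : 0 <= Psi0 by apply: le_trans (hPsi0 _ Ix).
  set E := Psi0 * 2^-1 ^+ n.
  have E0 : 0 <= E by rewrite mulr_ge0 ?exprn_ge0.
  have := @sine x Ix (H + P * (2 * H / k + E)) => /(_ _)/le_trans; apply.
    move=> y Iy; rewrite /q mul1r (le_trans (ler_normD _ _))//.
    by rewrite normrM lerD ?hH// ler_pM ?pP// IH.
  rewrite ler_pdivrMr// [_ * k]mulrDl divfK ?gt_eqF// exprSr mulrA -/E.
  have e1 : P * (2 * H / k) <= H.
    rewrite mulrA ler_pdivrMr//; move: (ler_wpM2l H0 Pk); lra.
  have e2 : P * E <= E / 2 * k by move: (ler_wpM2l E0 Pk); lra.
  by rewrite mulrDr; lra.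
move=> x Ix; apply/ler_addgt0Pr => e e0.
have S0 : 0 <= Psi0 by apply: le_trans (hPsi0 _ Ix).
have c0 : Psi0 * 2^-1 ^+ n @[n --> \oo] --> (0 : R).
  rewrite [X in _ --> X](_ : 0 = Psi0 * 0); last by rewrite mulr0.
  apply: cvgM; first exact: cvg_cst.
  by apply: cvg_expr; rewrite ger0_norm; lra.
have /cvgrPdist_le/(_ e e0) := c0 => -[n _ nP].
apply: le_trans (bnd n x Ix) _; rewrite lerD2l.
have := nP n (leqnn _); rewrite /= sub0r normrN; exact: le_trans (ler_norm _).
Qed.

(** * Laplace-transformed moments and the vanishing of [Afun] *)

Section LaplaceFunctional.
Variables (alpha T mb : R) (X : R -> (R -> R) -> R).
Hypothesis alpha01 : 0 < alpha < 1.
Hypothesis T0 : 0 < T.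
Hypothesis mb0 : 0 <= mb.
Hypothesis X_lin : forall s c h k, 0 < s -> bm01 h -> bm01 k ->
  X s (fun x => c * h x + k x) = c * X s h + X s k.
Hypothesis X_le : forall s h H, 0 < s -> bm01 h -> (forall x, I01 x -> `|h x| <= H) ->
  `|X s h| <= mb * H.
(* The equation tested against [Istar2 g], after a Laplace transform truncated
   at [T]. *)
Hypothesis X_eq : forall s g H, 0 < s -> bm01 g ->
  (forall x, I01 x -> `|g x - p x * Istar2 g x| <= H) ->
  `|X s (Istar2 g) - Afun g * ((1 - expR (- (s * T))) / s)
    - s `^ (- alpha) * X s (fun x => g x - p x * Istar2 g x)|
  <= s `^ (- alpha) * expR (- (s * T)) * (mb * H).

(** Apply [X_le] with [H = 0] to the difference. *)
Lemma X_eq_on (s : R) (h k : R -> R) : 0 < s -> bm01 h -> bm01 k ->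
  (forall x, I01 x -> h x = k x) -> X s h = X s k.
Proof.
move=> s0 bh bk hk.
have := @X_le s (fun x => -1 * h x + k x) 0 s0 (bm01_lin _ bh bk).
rewrite mulr0 X_lin// normr_le0 => H; apply/eqP; rewrite eq_sym -subr_eq0 addrC -mulN1r.
by apply: H => x Ix; rewrite hk// mulN1r addNr normr0.
Qed.

(** The choice [lam = s^alpha] gives [g - p * B g = lam * B g + h]. In [X_eq] the two occurrences of
    the transform of [B g] then cancel, and only [Afun g] and [X s h] remain. *)
Lemma resolvent_laplace (s H G : R) (h g : R -> R) : 1 <= s -> bm01 h -> bm01 g ->
  (forall x, I01 x -> `|h x| <= H) -> (forall x, I01 x -> `|g x| <= G) ->
  (forall x, I01 x -> g x = h x + resQ (s `^ alpha) g x) ->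
  `|s `^ alpha * Afun g * ((1 - expR (- (s * T))) / s) + X s h|
    <= mb * expR (- (s * T)) * (H + s `^ alpha * G).
Proof.
move=> s1 bh bg hH gG gE; have s0 : 0 < s by lra.
set lam := s `^ alpha in gE *.
have lam0 : 0 < lam by exact: powR_gt0.
have E : forall x, I01 x -> g x - p x * Istar2 g x = lam * Istar2 g x + h x.
  by move=> x Ix; rewrite {1}gE// /resQ; ring.
have bB := Istar2_bm01 bg.
have bk : bm01 (fun x => lam * Istar2 g x + h x) by exact: bm01_lin.
have bgk : bm01 (fun x => g x - p x * Istar2 g x).
  have := bm01_lin (-1) (bm01M bp bB) bg.
  by congr (@bm01 R _); apply/funext => x; rewrite mulN1r addrC.
have gkH : forall x, I01 x -> `|g x - p x * Istar2 g x| <= H + lam * G.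
  move=> x Ix; rewrite E// addrC (le_trans (ler_normD _ _))//.
  by rewrite normrM (gtr0_norm lam0) lerD ?hH// (ler_wpM2l (ltW lam0))// Istar2_le.
have := X_eq s0 bg gkH.
rewrite (X_eq_on s0 bgk bk E) X_lin// powRN -/lam => Y.
have -> : lam * Afun g * ((1 - expR (- (s * T))) / s) + X s h =
  - lam * (X s (Istar2 g) - Afun g * ((1 - expR (- (s * T))) / s)
     - lam^-1 * (lam * X s (Istar2 g) + X s h)).
  move: (_ / s) (X s _) (X s h) (Afun g) => th X1 X2 A1.
  by field; rewrite gt_eqF.
rewrite normrM normrN (gtr0_norm lam0).
apply: le_trans (ler_wpM2l (ltW lam0) Y) _.
rewrite !mulrA mulfV ?gt_eqF// mul1r; lra.
Qed.

Lemma powR_le_self (s : R) : 1 <= s -> 1 <= s `^ alpha <= s.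
Proof.
have [a0 a1] := andP alpha01; move=> s1; apply/andP; split.
  by rewrite -[leLHS](powRr0 s) ler_powR// ltW.
by rewrite -[leRHS]powRr1 ?(le_trans ler01)// ler_powR// ltW.
Qed.

(** Solve [resolvent_laplace] for [Afun g] at [s = lam^(1/alpha)]; the growth of [g] is absorbed by
    the truncation error since [s >= lam]. *)
Lemma Afun_resolvent_pos (H : R) (h : R -> R) : bm01 h ->
  (forall x, I01 x -> `|h x| <= H) ->
  exists (k : nat) (C : R), 0 <= C /\ forall lam g, 1 <= lam -> bm01 g ->
    (forall x, I01 x -> g x = h x + resQ lam g x) ->
    (forall d, 0 < d -> forall x, I01 x ->
      `|g x| <= H * (expR (d * (`|lam| + P)) * expR d^-1)) ->
    `|Afun g| <= C * lam ^+ k.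
Proof.
move=> bh hH; have [a0 a1] := andP alpha01.
have I12 : I01 (2^-1 : R) by rewrite /= in_itv/=; apply/andP; split; lra.
have H0 : 0 <= H by apply: le_trans (hH _ I12).
(* Dividing by [(1 - expR (- (s * T))) / s] costs a factor [s = lam^(1/alpha)], at most [lam ^ k]
   because [k > 1/alpha] and [lam >= 1]. *)
pose k := (Num.truncn alpha^-1).+1.
pose D := mb * (H + H + H * (expR (T * P) * expR T^-1)).
have D0 : 0 <= D by rewrite mulr_ge0// !addr_ge0// !mulr_ge0// expR_ge0.
have eT : 0 < 1 - expR (- T) by rewrite subr_gt0 -[ltRHS]expR0 ltr_expR oppr_lt0.
exists k, (D / (1 - expR (- T))); split => [|lam g lam1 bg gE gG].
  by rewrite divr_ge0// ltW.
have lam0 : 0 < lam by lra.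
pose s := lam `^ alpha^-1.
have sal : s `^ alpha = lam by rewrite -powRrM mulVf ?gt_eqF// powRr1// ltW.
have s1 : 1 <= s by rewrite -[leLHS](powRr0 lam) ler_powR// invr_ge0 ltW.
have s0 : 0 < s by lra.
have sk : s <= lam ^+ k.
  by rewrite -powR_mulrn ?(ltW lam0)// ler_powR// ltW// truncnS_gt.
have lams : lam <= s by rewrite -[leLHS]sal; have /andP[] := powR_le_self s1.
(* The growth bound is taken with [d = T], exactly what [expR (- (s * T))] can cancel. *)
have := @resolvent_laplace s H _ h g s1 bh bg hH (gG T T0); rewrite sal => /(_ gE).
set e := expR (- (s * T)); set th := _ / s; rewrite (gtr0_norm lam0) => Y.
have e1 : e <= expR (- T) by rewrite ler_expR lerN2 ler_peMl// ltW.
have e0 : 0 < e := expR_gt0 _.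
have eT1 : expR (- T) <= 1 by lra.
have XH := X_le s0 bh hH.
have eG : e * expR (T * (lam + P)) <= expR (T * P).
  rewrite -expRD ler_expR; have := ler_wpM2l (ltW T0) lams; lra.
have B : lam * (`|Afun g| * th) <= lam * D.
  have th0 : 0 <= th by rewrite divr_ge0 ?(ltW s0)//; lra.
  have -> : lam * (`|Afun g| * th) = `|lam * Afun g * th|.
    by rewrite 2!normrM (gtr0_norm lam0) [X in _ = _ * X]ger0_norm// mulrA.
  rewrite -[X in `|X|](addrK (X s h)) (le_trans (ler_normB _ _))//.
  apply: le_trans (lerD Y XH) _.
  set G1 := expR (T * (lam + P)) in eG *; set G2 := expR (T * P) in eG *; set G3 := expR T^-1.
  have -> : mb * e * (H + lam * (H * (G1 * G3))) + mb * H =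
    mb * H * (e + lam * (e * G1) * G3 + 1) by ring.
  have -> : lam * D = mb * H * (lam + lam * G2 * G3 + lam) by rewrite /D -/G2 -/G3; ring.
  rewrite ler_wpM2l ?mulr_ge0// lerD//; rewrite lerD//; first by lra.
  by rewrite ler_wpM2r ?expR_ge0// ler_wpM2l// ltW.
have {}B : `|Afun g| * th <= D by move: B; rewrite ler_pM2l.
have th1 : (1 - expR (- T)) / s <= th.
  by rewrite /th ler_pM2r ?invr_gt0// lerD2l lerN2.
have {}B : `|Afun g| * ((1 - expR (- T)) / s) <= D.
  by apply: le_trans B; rewrite ler_wpM2l.
rewrite mulrAC ler_pdivlMr//.
have : `|Afun g| * (1 - expR (- T)) <= D * s by rewrite -ler_pdivrMr// -mulrA.
by move=> /le_trans; apply; rewrite ler_wpM2l.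
Qed.

Lemma cvg_pow4_geometric :
  n%:R ^+ 4 * 2^-1 ^+ (2 * n ^ 4) @[n --> \oo] --> (0 : R).
Proof.
apply: (@squeeze_cvgr _ _ _ _ (cst 0) (fun n => (n%:R)^-1)).
- near=> n; have n0 : (0 < n)%N by near: n; exact: nbhs_infty_gt.
  rewrite mulr_ge0 ?exprn_ge0//= -natrX; set k := (n ^ 4)%N.
  have k0 : (0 < k)%N by rewrite expn_gt0 n0.
  have kn : (n <= k)%N by rewrite /k expnS leq_pmulr// expn_gt0 n0.
  have k2 : k%:R <= 2 ^+ k :> R by rewrite -natrX ler_nat ltnW// ltn_expl.
  apply: (@le_trans _ _ k%:R^-1); last by rewrite lef_pV2 ?posrE ?ltr0n// ler_nat.
  rewrite mul2n -addnn exprD exprVn -[leRHS]mul1r mulrA.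
  have p0 : 0 < 2 ^+ k :> R by rewrite exprn_gt0.
  apply: ler_pM; rewrite ?mulr_ge0 ?invr_ge0 ?(ltW p0)//.
    by rewrite ler_pdivrMr// mul1r.
  by rewrite lef_pV2 ?posrE ?ltr0n.
- exact: cvg_cst.
- exact: cvg_inv_nat.
Unshelve. all: by end_near. Qed.

(** [Afun (gl lam)] is the function [f] of the overview and the [F n] are its partial sums. At
    [lam = 0] they tend to 0 by [line_bound_cvg] and to [Afun (gl 0)] by construction, while
    [resolvent0_unique] identifies [gl 0] with [g]. *)
Lemma Afun_resolvent0 (h g : R -> R) : bm01 h -> bm01 g ->
  (forall x, I01 x -> g x = h x + resQ 0 g x) -> Afun g = 0.
Proof.
move=> bh bg gE; have [_ [H hH]] := bh.
have I12 : I01 (2^-1 : R) by rewrite /= in_itv/=; apply/andP; split; lra.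
have H0 : 0 <= H by apply: le_trans (hH _ I12).
have /boolp.choice[gl glP] := fun lam => resolvent lam bh hH.
(* With [2 * n ^ 4] terms the degree is below the order [2 * N] of the difference, [N = n ^ 4], and
   [(2 * n ^ 4) ^ 2 = 4 * n ^ 8] eventually exceeds what [|lam| <= 2 * n ^ 7] demands. *)
have /boolp.choice[F FP] := fun n : nat => Afun_resS_poly (2 * n ^ 4) bh.
have [k [C [C0 posC]]] := Afun_resolvent_pos bh hH.
pose A1 := \int[mu]_(x in I01) `|a x|.
have A10 : 0 <= A1 by apply: Rintegral_ge0 => // x _.
have tail n lam : (1 <= n)%N -> 2 * expR 1 * (`|lam| + P) <= (2 * n ^ 4)%:R ^+ 2 ->
    `|(F n).[lam] - Afun (gl lam)| <= 2 * H * A1 * 2^-1 ^+ (2 * n ^ 4).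
  move=> n1 nlam; have [_ FE] := FP n; have [bgl _ _ gt] := glP lam.
  have bS := resS_bm01 lam (2 * n ^ 4) bh.
  have -> : (F n).[lam] - Afun (gl lam) =
      - Afun (fun x => -1 * resS lam h (2 * n ^ 4) x + gl lam x).
    by rewrite Afun_lin// FE; ring.
  rewrite normrN mulrAC; apply: Afun_le => [|x Ix]; first exact: bm01_lin.
  by rewrite mulN1r addrC gt// muln_gt0 expn_gt0 n1.
have negle (lam : R) : lam <= - 1 -> 2 * P <= Num.sqrt (- lam) ->
    `|Afun (gl lam)| <= 2 * H / Num.sqrt (- lam) * A1.
  move=> lam1 lamP; have [bgl glE _ _] := glP lam.
  have l0 : 0 < Num.sqrt (- lam) by rewrite sqrtr_gt0; lra.
  apply: Afun_le_Istar2 => //; apply: (resolvent_neg l0 lamP bh bgl hH).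
  by rewrite sqr_sqrtr ?opprK//; lra.
have neginf (B lam : R) : 0 <= B -> lam <= - B ^+ 2 -> B <= Num.sqrt (- lam).
  move=> B0 lB; rewrite -[leLHS](ger0_norm B0) -sqrtr_sqr ler_wsqrtr//; lra.
suff cv0 : (F n).[0] @[n --> \oo] --> (0 : R).
  have cvg0 : (F n).[0] @[n --> \oo] --> Afun (gl 0).
    apply/cvgrPdist_le => e e0.
    have c0 : 2 * H * A1 * (2^-1 ^+ (2 * n ^ 4)) @[n --> \oo] --> (0 : R).
      rewrite [X in _ --> X](_ : 0 = 2 * H * A1 * 0); last by rewrite mulr0.
      apply: cvgM; first exact: cvg_cst.
      apply: (@squeeze_cvgr _ _ _ _ (cst 0) (fun n => n%:R ^+ 4 * 2^-1 ^+ (2 * n ^ 4))).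
      - near=> n; have n1 : 1 <= n%:R :> R by rewrite ler1n; near: n; exact: nbhs_infty_gt.
        by rewrite exprn_ge0//= ler_peMl ?exprn_ge0// exprn_ege1.
      - exact: cvg_cst.
      - exact: cvg_pow4_geometric.
    have /cvgrPdist_le/(_ e e0) c0e := c0.
    near=> n; have n0 : (1 <= n)%N by near: n; exact: nbhs_infty_ge.
    have ne : `|0 - 2 * H * A1 * (2^-1 ^+ (2 * n ^ 4))| <= e by near: n.
    rewrite distrC; apply: le_trans (tail n 0 n0 _) _; last first.
      by move: ne; rewrite sub0r normrN; exact: le_trans (ler_norm _).
    have n1 : 1 <= n%:R :> R by rewrite ler1n.
    have nP : 2 * expR 1 * P <= n%:R by near: n; exact: nbhs_infty_ger.
    rewrite normr0 add0r (le_trans nP)// natrM natrX exprMn -exprM.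
    apply: (@le_trans _ _ (n%:R ^+ (4 * 2))); last by rewrite ler_peMl ?exprn_ge0//; lra.
    by rewrite -[leLHS]expr1 ler_weXn2l.
  have [bg0 g0E _ _] := glP 0.
  rewrite (eq_Afun (k := gl 0)); first exact: (cvg_unique _ cvg0 cv0).
  apply: (resolvent0_unique bg bg0) => x Ix.
  rewrite {1}(gE x Ix) {1}(g0E x Ix); exact: etrans (addrK _ _) (esym (addrK _ _)).
(* The exponent is [k.+1] because [line_bound m] allows the growth [|x| ^ m / |x|]. *)
apply: (@line_bound_cvg _ k.+1 F (fun lam => Afun (gl lam)) 1).
- by move=> n; have [] := FP n.
- pose A := Num.max 1 ((2 * P) ^+ 2).
  have A1' : 1 <= A by rewrite le_max lexx.
  (* Beyond [n1] one has [2 * e * (|x| + P) <= 4 * n ^ 8] on the whole range, the condition under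
     which the tail is geometric. *)
  have [n1 n1P] : exists n1 : nat, expR 1 * (2 + P) <= n1%:R.
    exists (Num.truncn (expR 1 * (2 + P))).+1; exact/ltW/truncnS_gt.
  exists A, (C + 2 * H * A1), n1.+1, (fun n => 2 * H * A1 * 2^-1 ^+ (2 * n ^ 4)).
  have HA0 : 0 <= 2 * H * A1 by rewrite !mulr_ge0.
  split => //.
  + exact: addr_ge0.
  + by move=> n; rewrite mulr_ge0 ?exprn_ge0.
  + rewrite [X in _ --> X](_ : 0 = 2 * H * A1 * 0); last by rewrite mulr0.
    under eq_fun do rewrite mulrCA.
    by apply: cvgM; [exact: cvg_cst|exact: cvg_pow4_geometric].
  + move=> n x nn Ax xn.
    have n1' : 1 <= n%:R :> R by rewrite ler1n (leq_trans _ nn).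
    have x1 : 1 <= `|x| by apply: le_trans Ax.
    rewrite -[(F n).[x]](subrK (Afun (gl x))) (le_trans (ler_normD _ _))// addrC.
    apply: lerD; last first.
      apply: tail; first exact: leq_trans nn.
      apply: (@le_trans _ _ (2 * expR 1 * ((2 + P) * n%:R ^+ 7))).
        rewrite ler_wpM2l ?mulr_ge0 ?expR_ge0// mulrDl lerD//.
        by rewrite ler_peMr// exprn_ege1.
      rewrite natrM natrX exprMn -exprM (_ : (4 * 2 = 7.+1)%N)// exprS.
      have n7 : 0 <= n%:R ^+ 7 :> R by rewrite exprn_ge0.
      have nn1 : n1%:R <= n%:R :> R by rewrite ler_nat ltnW.
      have -> : 2 * expR 1 * ((2 + P) * n%:R ^+ 7) = 2 * (expR 1 * (2 + P)) * n%:R ^+ 7.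
        by move: (_ ^+ 7) => z; ring.
      rewrite [leRHS]mulrA ler_wpM2r//; lra.
    have xk : `|x| ^+ k.+1 / `|x| = `|x| ^+ k.
      by rewrite exprSr mulfK// gt_eqF//; lra.
    rewrite -mulrA xk mulrDl.
    have [x0'|x0'] := leP 0 x.
      rewrite ger0_norm// in x1 *; have [bgl glE gb _] := glP x.
      apply: le_trans (posC _ _ x1 bgl glE gb) _.
      by rewrite lerDl mulr_ge0// exprn_ge0.
    rewrite ltr0_norm// in x1 Ax *.
    have xP : 2 * P <= Num.sqrt (- x).
      by apply: neginf; rewrite ?mulr_ge0//; move: Ax; rewrite ge_max => /andP[_]; lra.
    apply: (@le_trans _ _ (2 * H / Num.sqrt (- x) * A1)).
      by apply: negle => //; lra.
    have xk1 : 1 <= (- x) ^+ k by rewrite exprn_ege1.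
    have s1 : 1 <= Num.sqrt (- x) by rewrite -[leLHS]sqrtr1 ler_wsqrtr.
    apply: (@le_trans _ _ (2 * H * A1)).
      rewrite mulrAC ler_pdivrMr ?ler_peMr//; lra.
    rewrite -[leLHS]add0r lerD ?mulr_ge0 ?exprn_ge0 ?ler_peMr//; lra.
- move=> x xA; apply/cvgrPdist_le => e e0.
  have c0 : 2 * H * A1 * (2^-1 ^+ (2 * n ^ 4)) @[n --> \oo] --> (0 : R).
    rewrite [X in _ --> X](_ : 0 = 2 * H * A1 * 0); last by rewrite mulr0.
    apply: cvgM; first exact: cvg_cst.
    apply: (@squeeze_cvgr _ _ _ _ (cst 0) (fun n => n%:R ^+ 4 * 2^-1 ^+ (2 * n ^ 4))).
    + near=> n; have n1 : 1 <= n%:R :> R by rewrite ler1n; near: n; exact: nbhs_infty_gt.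
      by rewrite exprn_ge0//= ler_peMl ?exprn_ge0// exprn_ege1.
    + exact: cvg_cst.
    + exact: cvg_pow4_geometric.
  have /cvgrPdist_le/(_ e e0) c0e := c0.
  near=> n; have n0 : (1 <= n)%N by near: n; exact: nbhs_infty_ge.
  have ne : `|0 - 2 * H * A1 * (2^-1 ^+ (2 * n ^ 4))| <= e by near: n.
  rewrite distrC; apply: le_trans (tail n x n0 _) _; last first.
    by move: ne; rewrite sub0r normrN; exact: le_trans (ler_norm _).
  have n1 : 1 <= n%:R :> R by rewrite ler1n.
  have nP : 2 * expR 1 * (`|x| + P) <= n%:R by near: n; exact: nbhs_infty_ger.
  rewrite (le_trans nP)// natrM natrX exprMn -exprM.
  apply: (@le_trans _ _ (n%:R ^+ (4 * 2))); last by rewrite ler_peMl ?exprn_ge0//; lra.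
  by rewrite -[leLHS]expr1 ler_weXn2l.
(* The three summands provide, in turn, [1 <= k], [2 * P <= k] and [2 * H * A1 / k <= d] for
   [k = Num.sqrt (- x)]. *)
- move=> d d0; pose B := 1 + 2 * P + 2 * H * A1 / d.
  have HA0 : 0 <= 2 * H * A1 by rewrite !mulr_ge0.
  have HAd : 0 <= 2 * H * A1 / d by rewrite divr_ge0// ltW.
  have B1 : 1 <= B by move: P0; rewrite /B; lra.
  exists (B ^+ 2) => x xB.
  have Bx : B <= Num.sqrt (- x) by apply: neginf => //; lra.
  have B2 : 1 <= B ^+ 2 by rewrite exprn_ege1.
  apply: le_trans (negle x _ _) _; [lra|by rewrite /B in Bx; lra|].
  rewrite mulrAC ler_pdivrMr; last by lra.
  rewrite -ler_pdivrMl// [leLHS]mulrC; rewrite /B in Bx; move: P0; lra.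
Unshelve. all: by end_near. Qed.

(** Every [g] solves the resolvent equation at [lam = 0], with [h := g - resQ 0 g]. *)
Lemma Afun_eq0 (g : R -> R) : bm01 g -> Afun g = 0.
Proof.
move=> bg; pose h x := -1 * resQ 0 g x + g x.
apply: (@Afun_resolvent0 h) => //; first by apply: bm01_lin => //; exact: resQ_bm01.
by move=> x _; rewrite /h mulN1r addrC addrA subrr add0r.
Qed.

(** Once [Afun] vanishes, [X s h] is bounded by the truncation error alone. One factor
    [expR (d * s)] pays for the growth of the resolvent, a second one for the factor
    [lam <= expR (d * s) / d]. *)
Lemma X_decay (h : R -> R) (d : R) : bm01 h -> 0 < d ->
  exists C, forall s, 1 <= s -> `|X s h| <= C * expR (- (s * (T - 2 * d))).
Proof.
move=> bh d0; have [_ [H hH]] := bh.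
have I12 : I01 (2^-1 : R) by rewrite /= in_itv/=; apply/andP; split; lra.
have H0 : 0 <= H by apply: le_trans (hH _ I12).
exists (mb * H * (1 + expR (d * P) * expR d^-1 / d)) => s s1.
have /andP[l1 ls] := powR_le_self s1; have s0 : 0 < s by lra.
have [g [bg gE gG _]] := resolvent (s `^ alpha) bh hH.
have := @resolvent_laplace s H _ h g s1 bh bg hH (gG d d0) gE.
rewrite Afun_eq0// mulr0 mul0r add0r => /le_trans; apply.
set lam := s `^ alpha in l1 ls *; rewrite ger0_norm; last by lra.
set G2 := expR (d * P); set G3 := expR d^-1;
have -> : expR (d * (lam + P)) = expR (d * lam) * G2 by rewrite -expRD -mulrDr.
have -> : expR (- (s * (T - 2 * d))) = expR (- (s * T)) * (expR (d * s) * expR (d * s)).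
  by rewrite -!expRD; congr expR; ring.
set e := expR (- (s * T)); set E := expR (d * s).
have G20 : 0 < G2 := expR_gt0 _; have G30 : 0 < G3 := expR_gt0 _; have e0 : 0 < e := expR_gt0 _.
have E1 : 1 <= E by rewrite -[leLHS]expR0 ler_expR mulr_ge0// ltW.
have lE : expR (d * lam) <= E by rewrite ler_expR ler_pM2l.
have lE2 : lam <= E / d.
  rewrite ler_pdivlMr// mulrC (le_trans _ (expR_ge1Dx _))//.
  have := ler_wpM2l (ltW d0) ls; lra.
have EE : 1 <= E * E by rewrite -[leLHS]mulr1 ler_pM.
have -> : mb * e * (H + lam * (H * (expR (d * lam) * G2 * G3))) =
  mb * H * e * (1 + lam * expR (d * lam) * (G2 * G3)) by ring.
have -> : mb * H * (1 + G2 * G3 / d) * (e * (E * E)) =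
  mb * H * e * (E * E + (E / d * E) * (G2 * G3)) by rewrite -mulrA; field; rewrite gt_eqF.
rewrite ler_wpM2l ?mulr_ge0 ?(ltW e0)// lerD//.
rewrite ler_wpM2r ?mulr_ge0 ?(ltW G20) ?(ltW G30)//.
by apply: ler_pM => //; lra.
Qed.

End LaplaceFunctional.
End Resolvent.

(** * Dominated convergence and uniqueness for Laplace transforms *)

Section DominatedConvergence.
Context (R : realType).
Local Notation mu := (@lebesgue_measure R).
Local Notation I01 := (`]0, 1[%classic : set R).

Lemma rint_dominated (D : set R) (f : nat -> R -> R) (g h : R -> R) : measurable D ->
  (forall n, measurable_fun D (f n)) -> measurable_fun D g -> rintegrable D h ->
  (forall n x, D x -> `|f n x| <= h x) ->
  {ae mu, forall x, D x -> f ^~ x @ \oo --> g x} ->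
  rintegrable D g /\
  \int[mu]_(x in D) f n x @[n --> \oo] --> \int[mu]_(x in D) g x.
Proof.
move=> mD mf mg ih fh fg.
have [|||||ig _ c] := @dominated_convergence _ (measurableTypeR R) R mu D mD
  (fun n => EFin \o f n) (EFin \o g) (EFin \o h).
- by move=> n; apply/measurable_EFinP; exact: mf.
- exact/measurable_EFinP.
- apply: (ae_imp fg) => x fx Dx; apply: cvg_EFin; first exact: nearW.
  exact: fx.
- exact: ih.
- by apply: aeW => x n Dx; rewrite /= lee_fin fh.
- split => //; apply: fine_cvg; rewrite fineK; first exact: c.
  exact: (@integrable_fin_num _ _ _ mu).
Qed.

(** Lebesgue differentiation: the primitive of the extension by zero vanishes near every point of
    []0, b[], and almost everywhere its derivative is [g]. *)
Lemma ae_eq0_primitive (b : R) (g : R -> R) : rintegrable `]0, b[ g ->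
  (forall x, 0 < x < b -> \int[mu]_(y in `]0, x[) g y = 0) ->
  {ae mu, forall x, x \in `]0, b[ -> g x = 0}.
Proof.
move=> ig g0; pose f := g \_ `]0, b[.
have mb : measurable (`]0, b[%classic : set R) by exact: measurable_itv.
have fi : rintegrable setT f.
  move/(@integrable_mkcond _ _ _ mu _ _ mb): ig.
  by rewrite /rintegrable restrict_EFin.
have loc : locally_integrable [set: R] f by apply: integrable_locally.
have fy (y : R) : mu.-integrable `]-oo, y] (EFin \o f).
  by apply: (@integrableS _ _ _ mu setT) => //; exact: measurable_itv.
apply: (ae_imp (FTC1Ny fy loc)) => x [dF Fx] xb.
move: (xb); rewrite in_itv/= => /andP[x0' xb'].
suff : (fun x => \int[mu]_(t in `]-oo, x]) f t)^`()%classic x = 0.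
  by rewrite Fx /f patchE mem_set//= in_itv/= x0'.
rewrite derive1E -(@near_eq_derive _ _ _ (cst 0)); first exact: derive_cst.
have : \forall y \near x, y \in `]0, b[ by apply: near_in_itvoo.
apply: filterS => y; rewrite in_itv/= => /andP[y0 yb]; rewrite /cst/=.
rewrite -(g0 y) ?y0// Rintegral_mkcond [RHS]Rintegral_mkcond.
apply: ae_eq_Rintegral; apply: (ae_imp (ae_neq y)) => z zy _.
rewrite !patchE mem_setE [in RHS]mem_setE /= !in_itv/=.
have [z0|] := boolP (0 < z < y).
  have /andP[z1 z2] := z0.
  by rewrite (ltW z2) /f patchE mem_set//= in_itv/= z1 (lt_trans z2 yb).
move=> z0; case: ifPn => // zley; rewrite /f patchE memNset//= in_itv/= => /andP[zz _].
by move/negP: z0; apply; rewrite zz lt_neqAle zley andbT; exact/eqP.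
Qed.

Lemma cvg_norm_le (w : nat -> R) (l C : R) :
  w @ \oo --> l -> (forall n, `|w n| <= C) -> `|l| <= C.
Proof.
move=> wl wC; have c : `|w n| @[n --> \oo] --> `|l| by exact: cvg_norm.
rewrite -(cvg_lim _ c)//; apply: limr_le; first by apply/cvg_ex; eexists; exact: c.
exact: nearW.
Qed.

Lemma cvg_seq_expR (w : nat -> R) (l : R) :
  w @ \oo --> l -> expR (w n) @[n --> \oo] --> expR l.
Proof. by move=> wl; apply: (cvg_comp _ _ wl); exact: continuous_expR. Qed.

Lemma exp_series_cvg (x : R) :
  \sum_(m < M) x ^+ m / m`!%:R @[M --> \oo] --> expR x.
Proof.
have -> : (fun M => \sum_(m < M) x ^+ m / m`!%:R) = series (exp_coeff x).
  apply/funext => M; rewrite /series/= big_mkord; apply: eq_bigr => m _.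
  by rewrite exp_coeffE mulrC.
exact: is_cvg_series_exp_coeff.
Qed.

Lemma rint_sum (D : set R) (M : nat) (f : 'I_M -> R -> R) : measurable D ->
  (forall i, rintegrable D (f i)) ->
  rintegrable D (fun x => \sum_(i < M) f i x) /\
  \int[mu]_(x in D) (\sum_(i < M) f i x) = \sum_(i < M) \int[mu]_(x in D) f i x.
Proof.
move=> mD; elim: M f => [|M IH] f fi.
  have z : rintegrable D (fun=> 0 : R).
    by rewrite /rintegrable (_ : EFin \o _ = cst 0%E)//; exact: integrable0.
  split; first by apply: eq_rintegrable z => // x _; rewrite big_ord0.
  rewrite big_ord0 -[RHS](mul0r (\int[mu]_(x in D) 0)) -rintZl//.
  by apply: eq_rint => x _; rewrite big_ord0 mul0r.
have [i1 E] := IH (fun i => f (widen_ord (leqnSn M) i)) (fun i => fi _).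
split.
  apply: (eq_rintegrable mD _ (rintegrableD mD i1 (fi ord_max))) => x _.
  by rewrite big_ord_recr.
rewrite big_ord_recr/= -E -rintD//.
by apply: eq_rint => x _; rewrite big_ord_recr.
Qed.

(* Expanding [1 - exp (- e^(n (x - t)))] in powers of [e^(- n t)] turns the Laplace
   transforms at the integers [k n] into an approximation of the integral of [U]
   over []0, x[], since the function tends to the indicator of [t < x]. *)
Lemma laplace_decay_ae0 (b T C : R) (U : R -> R) : 0 < b <= T ->
  rintegrable `]0, T[ U ->
  (forall n, (1 <= n)%N ->
    `|\int[mu]_(t in `]0, T[) (expR (- (n%:R * t)) * U t)| <= C * expR (- (n%:R * b))) ->
  {ae mu, forall t, t \in `]0, b[ -> U t = 0}.
Proof.
move=> /andP[b0 bT] iU UC.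
have mT : measurable (`]0, T[%classic : set R) by exact: measurable_itv.
have mb : measurable (`]0, b[%classic : set R) by exact: measurable_itv.
have C0 : 0 <= C.
  have := le_trans (normr_ge0 _) (UC 1%N isT).
  by rewrite pmulr_lge0// expR_gt0.
have iUb : rintegrable `]0, b[ U.
  apply: (@integrableS _ _ _ mu `]0, T[) => //.
  by apply: subset_itvl; rewrite bnd_simp.
apply: ae_eq0_primitive => // x /andP[x0 xb].
pose y (n : nat) (t : R) := expR (n%:R * (x - t)).
have my n (D : set R) : measurable_fun D (y n).
  apply: measurable_funTS; apply: continuous_measurable_fun => t.
  apply: (@continuous_comp _ _ _ (fun t : R => n%:R * (x - t)) expR); last exact: continuous_expR.
  by apply: cvgM; [exact: cvg_cst|apply: cvgB; [exact: cvg_cst|exact: cvg_id]].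
have mV n (D : set R) : measurable_fun D (fun t => 1 - expR (- y n t)).
  apply: measurable_funB => //; apply: measurableT_comp; first exact: measurable_expR.
  by apply: measurableT_comp; first exact: oppr_measurable.
have mU := rintegrable_measurable iU.
have iUn := rintegrable_norm mT iU.
(* The [m]-th power contributes at most [C * expR (- (m * n * b))] times [expR (m * n * x) / m!].
   The sum is the exponential series at [expR (n * (x - b))] without its first term, which tends to
   0 as [x < b]. *)
have bnd n : (1 <= n)%N -> `|\int[mu]_(t in `]0, T[) ((1 - expR (- y n t)) * U t)|
    <= C * (expR (expR (n%:R * (x - b))) - 1).
  move=> n1.
  pose S M t : R := 1 - \sum_(m < M.+1) (- y n t) ^+ m / m`!%:R.
  have SE M t : S M t = \sum_(m < M) - ((- y n t) ^+ m.+1 / m.+1`!%:R).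
    by rewrite /S big_ord_recl expr0 fact0 divr1 opprD addrA subrr add0r sumrN.
  have termi M (m : 'I_M) : rintegrable `]0, T[
      (fun t => - ((- y n t) ^+ m.+1 / m.+1`!%:R) * U t).
    apply: (@rintegrable_bddM _ _ (expR (n%:R * x) ^+ m.+1)) => //.
      apply: measurableT_comp; first exact: oppr_measurable.
      apply: measurable_funM => //; apply: measurable_funX.
      by apply: measurableT_comp; first exact: oppr_measurable.
    move=> t; rewrite /= in_itv/= => /andP[t0 _].
    rewrite normrN normrM normrX normrN (ger0_norm (expR_ge0 _)).
    rewrite ger0_norm ?invr_ge0// ler_pdivrMr ?ltr0n ?fact_gt0//.
    apply: (@le_trans _ _ (expR (n%:R * x) ^+ m.+1)).
      apply: lerXn2r; rewrite ?nnegrE ?expR_ge0// ler_expR ler_wpM2l//; lra.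
    by rewrite ler_peMr ?exprn_ge0 ?expR_ge0// ler1n fact_gt0.
  have cS : \int[mu]_(t in `]0, T[) (S M t * U t) @[M --> \oo] -->
      \int[mu]_(t in `]0, T[) ((1 - expR (- y n t)) * U t).
    have [|||||_ c] := @rint_dominated `]0, T[ (fun M t => S M t * U t)
      (fun t => (1 - expR (- y n t)) * U t) (fun t => expR (expR (n%:R * x)) * `|U t|) mT.
    - move=> M; have [iS _] := rint_sum mT (@termi M).
      apply: (eq_measurable_fun (fun t => \sum_(m < M) - ((- y n t) ^+ m.+1 / m.+1`!%:R) * U t)).
        by move=> t _; rewrite SE mulr_suml.
      exact: rintegrable_measurable.
    - by apply: measurable_funM.
    - exact: rintegrableZl.
    - move=> M t; rewrite /= in_itv/= => /andP[t0 _].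
      rewrite normrM ler_wpM2r// SE (le_trans (ler_norm_sum _ _ _))//.
      apply: le_trans (exp_partial_le M.+1 (expR_ge0 _)).
      rewrite big_ord_recl -[leLHS]add0r lerD ?divr_ge0 ?exprn_ge0//.
      apply: ler_sum => m _; rewrite normrN normrM normrX normrN.
      rewrite (ger0_norm (expR_ge0 _)) [X in _ * X <= _]ger0_norm ?invr_ge0//.
      rewrite ler_wpM2r ?invr_ge0//.
      apply: lerXn2r; rewrite ?nnegrE ?expR_ge0// ler_expR ler_wpM2l//; lra.
    - apply: aeW => t _; apply: cvgM; last exact: cvg_cst.
      apply: cvgB; first exact: cvg_cst.
      by have := @exp_series_cvg (- y n t); rewrite -[X in X -> _](cvg_shiftS (fun M => \sum_(m < M) (- y n t) ^+ m / m`!%:R)).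
    exact: c.
  apply: (cvg_norm_le cS) => M.
  have [_ E] := rint_sum mT (@termi M).
  rewrite (_ : \int[mu]_(t in `]0, T[) (S M t * U t) = \sum_(m < M)
    \int[mu]_(t in `]0, T[) (- ((- y n t) ^+ m.+1 / m.+1`!%:R) * U t)); last first.
    by rewrite -E; apply: eq_rint => t _; rewrite SE mulr_suml.
  apply: le_trans (ler_norm_sum _ _ _) _.
  apply: (@le_trans _ _ (\sum_(m < M) C * (expR (n%:R * (x - b)) ^+ m.+1 / m.+1`!%:R))).
    apply: ler_sum => m _.
    pose c : R := - ((- expR (n%:R * x)) ^+ m.+1 / m.+1`!%:R).
    have kn : (1 <= m.+1 * n)%N by rewrite muln_gt0.
    have ie : rintegrable `]0, T[ (fun t => expR (- ((m.+1 * n)%:R * t)) * U t).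
      apply: (@rintegrable_bddM _ _ 1) => //; first exact: measurable_expR_lin.
      move=> t; rewrite /= in_itv/= => /andP[t0 _].
      by rewrite ger0_norm ?expR_ge0// -[leRHS]expR0 ler_expR oppr_le0 mulr_ge0// ltW.
    have -> : \int[mu]_(t in `]0, T[) (- ((- y n t) ^+ m.+1 / m.+1`!%:R) * U t) =
        c * \int[mu]_(t in `]0, T[) (expR (- ((m.+1 * n)%:R * t)) * U t).
      rewrite -rintZl//; apply: eq_rint => t _; rewrite mulrA /c; congr (_ * _).
      rewrite mulNr; congr (- _); rewrite mulrAC; congr (_ / _).
      rewrite [in LHS]exprNn [in RHS]exprNn -mulrA; congr (_ * _).
      rewrite -!expRM_natl -expRD; congr expR.
      by rewrite natrM; ring.
    rewrite normrM; apply: le_trans (ler_wpM2l (normr_ge0 _) (UC _ kn)) _.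
    rewrite /c normrN normrM normrX normrN (ger0_norm (expR_ge0 _)) (ger0_norm (x := _^-1)) ?invr_ge0//.
    rewrite mulrCA ler_wpM2l// mulrAC ler_wpM2r ?invr_ge0//.
    by rewrite -!expRM_natl -expRD ler_expR natrM le_eqVlt; apply/orP; left; apply/eqP; ring.
  rewrite -mulr_sumr ler_wpM2l//.
  have := exp_partial_le M.+1 (expR_ge0 (n%:R * (x - b))).
  by rewrite big_ord_recl expr0 fact0 divr1 lerBrDl.
have [|||||iI cI] := @rint_dominated `]0, T[ (fun n t => (1 - expR (- y n t)) * U t)
   (fun t => \1_(`]0, x[%classic) t * U t) (fun t => 2 * `|U t|) mT.
- by move=> n; apply: measurable_funM.
- by apply: measurable_funM => //; exact: measurable_indic.
- exact: rintegrableZl.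
- move=> n t _; rewrite normrM ler_wpM2r// (le_trans (ler_normB _ _))// normr1.
  rewrite ger0_norm ?expR_ge0// (_ : 2 = 1 + 1)// lerD2l -[leRHS]expR0 ler_expR.
  by rewrite oppr_le0 expR_ge0.
(* The point [t = x] is excluded: there the function keeps the value [1 - expR (-1)]. *)
- apply: (ae_imp (ae_neq x)) => t tx; rewrite /= in_itv/= => /andP[t0 tT].
  apply: cvgM; last exact: cvg_cst.
  rewrite indicE mem_setE/= in_itv/= t0/=.
  have cn (c : R) : 0 < c -> expR (- (n%:R * c)) @[n --> \oo] --> (0 : R).
    move=> c0; apply: (@squeeze_cvgr _ _ _ _ (cst 0) (fun n => c^-1 * n%:R^-1)).
    + near=> n; rewrite expR_ge0/= expRN -invfM lef_pV2 ?posrE ?expR_gt0//.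
        by rewrite mulrC (le_trans _ (expR_ge1Dx _))// lerDr.
      rewrite mulr_gt0// ltr0n; near: n; exact: nbhs_infty_gt.
    + exact: cvg_cst.
    + rewrite [X in _ --> X](_ : 0 = c^-1 * 0); last by rewrite mulr0.
      by apply: cvgM; [exact: cvg_cst|exact: cvg_inv_nat].
  have [tltx|xltt|/tx//] := ltgtP t x.
    rewrite [X in _ --> X](_ : 1%:R = 1 - 0 :> R); last by rewrite subr0.
    apply: cvgB; first exact: cvg_cst.
    apply: (@squeeze_cvgr _ _ _ _ (cst 0) (fun n => expR (- (n%:R * (x - t))))).
    + near=> n; rewrite expR_ge0/= ler_expR lerN2 /y.
      by apply: le_trans (expR_ge1Dx _); rewrite lerDr.
    + exact: cvg_cst.
    + by apply: cn; rewrite subr_gt0.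
  rewrite [X in _ --> X](_ : 0%:R = 1 - expR (- 0) :> R); last by rewrite oppr0 expR0 subrr.
  apply: cvgB; first exact: cvg_cst.
  apply: cvg_seq_expR.
  apply: cvgN; rewrite /y.
  rewrite (_ : (fun n : nat => expR (n%:R * (x - t))) = (fun n => expR (- (n%:R * (t - x))))).
    by apply: cn; rewrite subr_gt0.
  by apply/funext => n; congr expR; ring.
have c3 : C * (expR (expR (n%:R * (x - b))) - 1) @[n --> \oo] --> (0 : R).
  rewrite [X in _ --> X](_ : 0 = C * (expR 0 - 1)); last by rewrite expR0 subrr mulr0.
  apply: cvgM; first exact: cvg_cst.
  apply: cvgB; last exact: cvg_cst.
  apply: cvg_seq_expR.
  apply: (@squeeze_cvgr _ _ _ _ (cst 0) (fun n => (b - x)^-1 * n%:R^-1)).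
  + near=> n; rewrite expR_ge0/= -(opprB b x) mulrN expRN -invfM lef_pV2 ?posrE ?expR_gt0//.
      by rewrite mulrC (le_trans _ (expR_ge1Dx _))// lerDr.
    rewrite mulr_gt0// ?subr_gt0// ltr0n; near: n; exact: nbhs_infty_gt.
  + exact: cvg_cst.
  + rewrite [X in _ --> X](_ : 0 = (b - x)^-1 * 0); last by rewrite mulr0.
    by apply: cvgM; [exact: cvg_cst|exact: cvg_inv_nat].
have z : \int[mu]_(t in `]0, T[) (\1_(`]0, x[%classic) t * U t) = 0.
  apply: (cvg_unique _ cI) => //; apply/norm_cvg0P.
  apply: (@squeeze_cvgr _ _ _ _ (cst 0) (fun n => C * (expR (expR (n%:R * (x - b))) - 1))).
  - near=> n; rewrite normr_ge0/=; apply: bnd; near: n; exact: nbhs_infty_ge.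
  - exact: cvg_cst.
  - exact: c3.
rewrite -[RHS]z Rintegral_mkcond [RHS]Rintegral_mkcond; apply: eq_Rintegral => t _.
rewrite !patchE mem_setE [in RHS]mem_setE /= !in_itv/= indicE mem_setE/= in_itv/=.
have [/andP[t0 tx]|tx] := boolP (0 < t < x).
  by rewrite t0 (lt_le_trans (lt_trans tx xb) bT)/= mul1r.
by rewrite mul0r; case: ifPn.
Unshelve. all: by end_near. Qed.

End DominatedConvergence.

(** * Test functions and the fundamental lemmas of the calculus of variations *)

Section TestFunctions.
Context (R : realType).
Local Notation mu := (@lebesgue_measure R).
Local Notation I01 := (`]0, 1[%classic : set R).

Let mI : measurable I01. Proof. exact: measurable_itv. Qed.

Lemma rint_eq0 (D : set R) (f : R -> R) :
  (forall x, D x -> f x = 0) -> \int[mu]_(x in D) f x = 0.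
Proof. by move=> f0; rewrite /Rintegral integral0_eq// => x /f0 ->. Qed.

(** Reduces smoothness to finding a class of functions closed under differentiation. It serves for
    bumps, multiples and primitives. *)
Lemma smooth_class (S : (R -> R) -> Prop) :
  (forall f, S f -> exists2 f', S f' & forall x : R, is_derive x (1 : R) f (f' x)) ->
  forall f, S f -> forall n (x : R), derivable (derive1n n f) x 1.
Proof.
move=> SD; have SN f n : S f -> S (derive1n n f).
  move=> Sf; elim: n => // n IH; rewrite derive1nS.
  have [f' Sf' D] := SD _ IH.
  rewrite (_ : (derive1n n f)^`()%classic = f')//; apply/funext => x.
  by rewrite derive1E; have Dx := D x; exact: derive_val.
move=> f Sf n x; have [f' _ D] := SD _ (SN f n Sf).
by have Dx := D x; exact: ex_derive.
Qed.

Lemma poly_exp_bound (e : R) (P : {poly R}) : 0 < e ->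
  exists C, 0 <= C /\ forall y, 0 < y -> `|P.[y]| * expR (- (e * y)) <= C.
Proof.
move=> e0; exists (\sum_(i < size P) `|P`_i| * (i`!%:R / e ^+ i)); split.
  by apply: sumr_ge0 => i _; rewrite mulr_ge0// divr_ge0// exprn_ge0// ltW.
move=> y y0; rewrite horner_coef.
apply: (@le_trans _ _ (\sum_(i < size P) `|P`_i| * (y ^+ i * expR (- (e * y))))).
  rewrite -[leLHS](ger0_norm) ?mulr_ge0 ?expR_ge0// normrM normr_id -normrM mulr_suml.
  apply: le_trans (ler_norm_sum _ _ _) _; apply: ler_sum => i _.
  by rewrite -mulrA normrM [X in _ * X <= _]ger0_norm// mulr_ge0 ?expR_ge0// exprn_ge0// ltW.
apply: ler_sum => i _; rewrite ler_wpM2l//.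
have := exp_term_le i (ltW (mulr_gt0 e0 y0)).
have ei : 0 < e ^+ i by rewrite exprn_gt0.
rewrite ler_pdivrMr ?ltr0n ?fact_gt0// => H.
rewrite expRN ler_pdivrMr ?expR_gt0// mulrAC ler_pdivlMr//.
by rewrite -exprMn (mulrC y) [leRHS]mulrC.
Qed.

(** Polynomials in [1 / x] times the flat function [exp (- e / x)], extended by 0: a class closed
    under differentiation. *)
Definition expinv (e : R) (P : {poly R}) (x : R) : R :=
  if 0 < x then P.[x^-1] * expR (- (e * x^-1)) else 0.

(** The polynomial of the derivative, from [(1 / x)' = - 1 / x ^ 2]. *)
Definition expinvD (e : R) (P : {poly R}) : {poly R} := 'X^2 * (e *: P - P^`()).

Lemma is_derive_expinv (e : R) (P : {poly R}) (x : R) : 0 < e ->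
  is_derive x (1 : R) (expinv e P) (expinv e (expinvD e P) x).
Proof.
move=> e0; have [x0|x0|->] := ltgtP x 0.
- rewrite {2}/expinv ltNge (ltW x0)/=.
  have d0 : is_derive x (1 : R) (cst 0 : R -> R) 0 by exact: is_derive_cst.
  apply: (near_eq_is_derive _ d0).
  near=> y; rewrite /expinv ltNge (_ : y <= 0)//; apply: ltW; near: y; exact: lt_nbhsl.
- have xn : x != 0 by rewrite gt_eqF.
  rewrite {2}/expinv x0.
  have dV : is_derive x (1 : R) (fun y : R => y^-1) (- x ^- 2).
    by apply: is_derive_eq (is_deriveV xn (is_derive_id x (1 : R))) _; rewrite /GRing.scale/= mulr1.
  have dP := @is_derive1_comp R (horner P) (fun y => y^-1) x _ _ (is_derive_poly P _) dV.
  have dL : is_derive x (1 : R) (fun y : R => - (e * y^-1)) (e * x ^- 2).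
    have := is_deriveZ (- e) dV.
    rewrite (_ : _ \*: _ = (fun y : R => - (e * y^-1))); last first.
      by apply/funext => z; rewrite /= /GRing.scale/= mulNr.
    by move=> D; apply: is_derive_eq D _; rewrite /GRing.scale/= mulrNN.
  have dE := @is_derive1_comp R expR (fun y => - (e * y^-1)) x _ _ (is_derive_expR _) dL.
  have dM : is_derive x (1 : R) (fun y : R => P.[y^-1] * expR (- (e * y^-1)))
      ((expinvD e P).[x^-1] * expR (- (e * x^-1))).
    apply: is_derive_eq (is_deriveM dP dE) _.
    rewrite /expinvD !hornerE /GRing.scale/= exprVn; ring.
  apply: (near_eq_is_derive _ dM).
  near=> y; rewrite /expinv (_ : 0 < y)//; near: y; exact: lt_nbhsr.
- rewrite {2}/expinv ltxx; apply/is_derive1_caratheodory.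
  exists (fun z => if z == 0 then 0 else expinv e P z / z); split; last by rewrite eqxx.
    move=> z; rewrite /expinv ltxx !subr0; case: eqP => [->|/eqP zn]; first by rewrite ltxx mulr0.
    by rewrite divfK.
  (* Two spare powers of [1 / z] are still bounded by the exponential, so the difference quotient at
     0 is [O(z)]. *)
  have [C [C0 PC]] := poly_exp_bound ('X^2 * P) e0.
  rewrite /prop_for /continuous_at eqxx; apply/cvgrPdist_le => d d0.
  near=> z; rewrite sub0r normrN; case: eqP => [_|/eqP zn]; first by rewrite normr0 ltW.
  rewrite /expinv; case: ifPn => z0; last by rewrite mul0r normr0 ltW.
  apply: (@le_trans _ _ (C * z)).
    have := PC z^-1; rewrite invr_gt0 => /(_ z0).
    rewrite !hornerE => H.
    rewrite normrM (gtr0_norm (x := z^-1)) ?invr_gt0// ler_pdivrMr// -mulrA -expr2.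
    rewrite -ler_pdivrMr ?exprn_gt0//; apply: le_trans H; rewrite !normrM (gtr0_norm (x := expR _)) ?expR_gt0//.
    rewrite (gtr0_norm (x := z^-1)) ?invr_gt0// expr2 invfM le_eqVlt; apply/orP; left.
    by apply/eqP; ring.
  have : `|z| <= d / (C + 1).
    near: z; exists (d / (C + 1)); first by rewrite /= divr_gt0//; lra.
    by move=> t /=; rewrite sub0r normrN => /ltW.
  rewrite gtr0_norm// ler_pdivlMr; last by lra.
  apply: le_trans; rewrite mulrC ler_wpM2l ?(ltW z0)//; lra.
Unshelve. all: by end_near. Qed.

(** The parameter [e] is sent to 0 later: the bumps then approach the indicator of []c, d[] while
    staying below 1. *)
Definition bump (c d e x : R) : R := expinv e 1 (x - c) * expinv e 1 (d - x).

Lemma bump_itv (c d e x : R) : c < x < d ->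
  bump c d e x = expR (- (e * (x - c)^-1)) * expR (- (e * (d - x)^-1)).
Proof. by move=> /andP[cx xd]; rewrite /bump /expinv !subr_gt0 cx xd !hornerC !mul1r. Qed.

Lemma bump0 (c d e x : R) : ~~ (c < x < d) -> bump c d e x = 0.
Proof.
rewrite /bump /expinv !subr_gt0; case: ifPn => //= _; last by rewrite mul0r.
by move=> /negbTE ->; rewrite mulr0.
Qed.

Lemma test_fun_bump (c d e : R) : 0 < c -> d < 1 -> 0 < e -> test_fun (bump c d e).
Proof.
move=> c0 d1 e0; split; last first.
  exists c, d; split => // x; rewrite in_itv/= => xcd; apply: bump0.
  by apply: contra xcd => /andP[/ltW -> /ltW ->].
(* By the product rule, finite sums of such products form a class closed under differentiation. *)
pose F (l : seq ({poly R} * {poly R})) (x : R) : R :=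
  \sum_(z <- l) expinv e z.1 (x - c) * expinv e z.2 (d - x).
have FD l : exists l', forall x : R, is_derive x (1 : R) (F l) (F l' x).
  elim: l => [|[P Q] l [l' IH]].
    exists [::] => x; rewrite /F big_nil (_ : (fun _ => _) = cst 0); first exact: is_derive_cst.
    by apply/funext => z; rewrite big_nil.
  exists [:: (expinvD e P, Q), (P, - expinvD e Q) & l'] => x.
  have dc : is_derive x (1 : R) (fun y : R => y - c) 1.
    by apply: is_derive_eq (is_deriveB (is_derive_id x (1 : R)) (is_derive_cst c x (1 : R))) _; rewrite subr0.
  have dd : is_derive x (1 : R) (fun y : R => d - y) (-1).
    by apply: is_derive_eq (is_deriveB (is_derive_cst d x (1 : R)) (is_derive_id x (1 : R))) _; rewrite sub0r.
  have D1 := @is_derive1_comp R _ _ x _ _ (is_derive_expinv P (x - c) e0) dc.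
  have D2 := @is_derive1_comp R _ _ x _ _ (is_derive_expinv Q (d - x) e0) dd.
  have := is_deriveD (is_deriveM D1 D2) (IH x).
  rewrite (_ : _ + _ = F ((P, Q) :: l)); last by apply/funext => y; rewrite /F big_cons.
  move=> D; apply: is_derive_eq D _; rewrite /F !big_cons /GRing.scale/=.
  have -> : expinv e (- expinvD e Q) (d - x) = - expinv e (expinvD e Q) (d - x).
    by rewrite /expinv; case: ifPn => _; rewrite ?oppr0// hornerN mulNr.
  by rewrite mulr1 mulrN1 addrA; congr (_ + _); ring.
apply: (@smooth_class (fun f => exists l, f = F l)).
  by move=> _ [l ->]; have [l' D] := FD l; exists (F l') => //; exists l'.
by exists [:: (1, 1)]; apply/funext => x; rewrite /F big_seq1.
Qed.

Lemma test_fun_is_derive (phi : R -> R) (n : nat) (x : R) : test_fun phi ->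
  is_derive x (1 : R) (derive1n n phi) (derive1n n.+1 phi x).
Proof.
move=> [dphi _]; rewrite derive1nS derive1E; apply: derivableP; exact: dphi.
Qed.

Lemma test_fun_derive1n (phi : R -> R) (n : nat) : test_fun phi -> test_fun (derive1n n phi).
Proof.
move=> [dphi [a [b [a0 b1 ab0]]]]; split.
  by move=> m x; rewrite /derive1n -iterD; exact: dphi.
exists a, b; split => //; elim: n => // n IH x xab.
rewrite derive1nS derive1E -(@near_eq_derive _ _ _ (cst 0)); first exact: derive_cst.
have : \forall y \near x, ~ (`[a, b]%classic y).
  apply: open_nbhs_nbhs; split; first by apply: closed_openC; exact: itv_closed.
  by rewrite /=; exact/negP.
by apply: filterS => y yab; rewrite IH//; exact/negP.
Qed.

Lemma test_fun_continuous (phi : R -> R) : test_fun phi -> continuous phi.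
Proof.
move=> tphi x; apply: differentiable_continuous; apply/derivable1_diffP.
by have [dphi _] := tphi; exact: (dphi 0).
Qed.

Lemma continuous_bm01 (f : R -> R) : continuous f -> bm01 f.
Proof.
move=> cf; split; first by apply: measurable_funTS; exact: continuous_measurable_fun.
have [|c _ cm] := @EVT_max R (fun x => `|f x|) 0 1 ler01 _.
  apply: continuous_subspaceT => x; apply: continuous_comp; first exact: cf.
  exact: norm_continuous.
exists `|f c| => x; rewrite /= in_itv/= => /andP[x0 x1]; apply: cm.
by rewrite in_itv/= (ltW x0) ltW.
Qed.

Lemma test_fun_bm01 (phi : R -> R) : test_fun phi -> bm01 phi.
Proof. by move=> /test_fun_continuous; exact: continuous_bm01. Qed.

Lemma test_fun_ends (phi : R -> R) : test_fun phi ->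
  forall x, ~ I01 x -> phi x = 0.
Proof.
move=> [_ [a [b [a0 b1 ab0]]]] x xI; apply: ab0; apply: contra_notN xI.
by rewrite /= !in_itv/= => /andP[ax xb]; rewrite (lt_le_trans a0 ax) (le_lt_trans xb b1).
Qed.

Lemma rintegrableM_bm01 (g h : R -> R) : rintegrable I01 g -> bm01 h ->
  rintegrable I01 (fun x => g x * h x).
Proof.
move=> ig [mh [H hH]].
apply: (@eq_rintegrable _ _ (fun x => h x * g x)) => // [x _|]; first exact: mulrC.
exact: (@rintegrable_bddM _ _ H).
Qed.

Lemma bump_dominated (g : R -> R) (c d : R) : rintegrable I01 g -> 0 < c -> d < 1 ->
  (forall phi, test_fun phi -> \int[mu]_(x in I01) (g x * phi x) = 0) ->
  \int[mu]_(x in `]c, d[) g x = 0.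
Proof.
move=> ig c0 d1 g0.
have tb n : test_fun (bump c d (n.+1%:R^-1)) by apply: test_fun_bump; rewrite ?invr_gt0.
have mg := rintegrable_measurable ig.
have [|||||_ cv] := @rint_dominated R I01 (fun n x => g x * bump c d (n.+1%:R^-1) x)
  (fun x => g x * \1_(`]c, d[%classic) x) (fun x => `|g x|) mI.
- by move=> n; apply: measurable_funM => //; have [] := test_fun_bm01 (tb n).
- by apply: measurable_funM => //; exact: measurable_indic.
- exact: rintegrable_norm.
- move=> n x _; rewrite normrM ler_piMr//.
  have [xcd|/bump0 ->] := boolP (c < x < d); last by rewrite normr0.
  rewrite bump_itv//.
  have [xc xd] : 0 < x - c /\ 0 < d - x by move: xcd => /andP[]; rewrite !subr_gt0.
  rewrite ger0_norm ?mulr_ge0 ?expR_ge0// -expRD -[leRHS]expR0 ler_expR.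
  by rewrite -opprD oppr_le0 addr_ge0// mulr_ge0// invr_ge0// ltW.
- apply: aeW => x _; apply: cvgM; first exact: cvg_cst.
  rewrite indicE mem_setE/= in_itv/=.
  have [xcd|xcd] := boolP (c < x < d); last first.
    by under eq_fun do rewrite bump0//; exact: cvg_cst.
  under eq_fun do rewrite bump_itv//.
  have cn (k : R) : expR (- (n.+1%:R^-1 * k)) @[n --> \oo] --> (1 : R).
    rewrite -[X in _ --> X]expR0; apply: cvg_seq_expR.
    rewrite -[X in _ --> X]oppr0; apply: cvgN; rewrite -[X in _ --> X](mul0r k).
    apply: cvgM; last exact: cvg_cst.
    exact: cvg_harmonic.
  rewrite (_ : true%:R = 1 * 1 :> R); last by rewrite mulr1.
  by apply: cvgM; exact: cn.
have E : \int[mu]_(x in I01) (g x * \1_(`]c, d[%classic) x) = 0.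
  apply: (cvg_unique _ cv) => //.
  rewrite (_ : (fun n => _) = (fun=> 0)); first exact: cvg_cst.
  by apply/funext => n; exact: g0.
rewrite -[RHS]E; apply/esym; apply: rint01_indic => //; rewrite ?(ltW c0) ?(ltW d1)//.
- by move=> x _ xcd; rewrite indicE mem_set ?mulr1//= in_itv.
- by move=> x _ xcd; rewrite indicE memNset ?mulr0//= in_itv/=; exact/negP.
Qed.

(** The fundamental lemma of the calculus of variations. Bumps have support away from 0, so []0, x[]
    is approached by the intervals []x / n.+2, x[]. *)
Lemma test_fun_ae0 (g : R -> R) : rintegrable I01 g ->
  (forall phi, test_fun phi -> \int[mu]_(x in I01) (g x * phi x) = 0) ->
  {ae mu, forall x, x \in `]0, 1[ -> g x = 0}.
Proof.
move=> ig g0; apply: ae_eq0_primitive => // x /andP[x0 x1].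
have mg := rintegrable_measurable ig.
pose A n : set R := `]x / n.+2%:R, x[%classic.
have [|||||_ cv] := @rint_dominated R I01 (fun n y => g y * \1_(A n) y)
  (fun y => g y * \1_(`]0, x[%classic) y) (fun x => `|g x|) mI.
- by move=> n; apply: measurable_funM => //; apply: measurable_indic; exact: measurable_itv.
- by apply: measurable_funM => //; exact: measurable_indic.
- exact: rintegrable_norm.
- by move=> n y _; rewrite normrM ler_piMr// indicE ger0_norm// lern1 leq_b1.
- apply: aeW => y; rewrite /= in_itv/= => /andP[y0 y1].
  apply: cvgM; first exact: cvg_cst.
  apply: cvg_near_cst; near=> n; rewrite !indicE !mem_setE /= !in_itv/= y0/=.
  suff -> : x / n.+2%:R < y by [].
  rewrite ltr_pdivrMr// -ltr_pdivrMl//.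
  near: n; exists (Num.truncn (y^-1 * x)) => // n /= nn.
  apply: lt_le_trans (truncnS_gt _) _; rewrite ler_nat; exact: (leq_trans nn (leqnSn _)).
have E : \int[mu]_(y in I01) (g y * \1_(`]0, x[%classic) y) = 0.
  apply: (cvg_unique _ cv) => //.
  rewrite (_ : (fun n => _) = (fun=> 0)); first exact: cvg_cst.
  apply/funext => n; have xn0 : 0 < x / n.+2%:R by rewrite divr_gt0.
  rewrite -[RHS](bump_dominated ig xn0 x1 g0); apply: rint01_indic; rewrite ?(ltW xn0) ?(ltW x1)//.
  + by move=> y _ yx; rewrite indicE mem_set ?mulr1//= /A /= in_itv.
  + by move=> y _ yx; rewrite indicE memNset ?mulr0//= /A /= in_itv/=; exact/negP.
rewrite -[RHS]E; apply/esym; apply: rint01_indic => //; rewrite ?(ltW x1)//.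
- by move=> y _ yx; rewrite indicE mem_set ?mulr1//= in_itv.
- by move=> y _ yx; rewrite indicE memNset ?mulr0//= in_itv/=; exact/negP.
Unshelve. all: by end_near. Qed.

Lemma ae_absurd (c d : R) : c < d -> ~ {ae mu, forall x, x \notin `]c, d[}.
Proof.
move=> cd [N [mN N0 sN]].
have : mu.-negligible `]c, d[%classic.
  by exists N; split => // x xcd; apply: sN => /=; apply/negP; rewrite negbK.
move=> /negligibleP-/(_ (measurable_itv _)) E.
have : (mu `]c, d[%classic == 0)%E by apply/eqP; exact: E.
by rewrite lebesgue_measure_itv/= lte_fin cd -EFinD eqe subr_eq0 gt_eqF.
Qed.

(** Otherwise [test_fun_ae0] for the constant 1 would give [1 = 0] almost everywhere. *)
Lemma test_fun_nonzero : exists2 psi : R -> R, test_fun psi & \int[mu]_(x in I01) psi x != 0.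
Proof.
apply: contrapT => H; apply: (@ae_absurd 0 1) => //.
have := @test_fun_ae0 (fun=> 1) (rintegrable_cst01 1) => /(_ _)/ae_imp; apply.
  move=> phi tphi; apply: contrapT => /eqP; under eq_rint do rewrite mul1r.
  by move=> n0; apply: H; exists phi.
move=> x x1; apply/negP => /x1/eqP; by rewrite oner_eq0.
Qed.

(** The vanishing mean makes the primitive zero to the right of both supports, hence compactly
    supported. *)
Lemma test_fun_primitive (phi psi : R -> R) (c : R) : test_fun phi -> test_fun psi ->
  \int[mu]_(x in I01) (phi x - c * psi x) = 0 ->
  exists2 K, test_fun K & forall x, derive1 K x = phi x - c * psi x.
Proof.
move=> tphi tpsi k0.
pose kn n (x : R) : R := derive1n n phi x - c * derive1n n psi x.
have dkn n (x : R) : is_derive x (1 : R) (kn n) (kn n.+1 x).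
  have := is_deriveB (test_fun_is_derive n x tphi) (is_deriveZ c (test_fun_is_derive n x tpsi)).
  by [].
have ck : continuous (kn 0).
  move=> x; apply: differentiable_continuous; apply/derivable1_diffP.
  by have Dx := dkn 0%N x; exact: ex_derive.
have kz x : ~ I01 x -> kn 0 x = 0.
  by move=> xI; rewrite /kn/= (test_fun_ends tphi xI) (test_fun_ends tpsi xI) mulr0 subr0.
have ik : rintegrable setT (kn 0).
  have := bm01_rintegrable (continuous_bm01 ck).
  move/(@integrable_mkcond _ _ _ mu _ _ mI); rewrite restrict_EFin.
  rewrite (_ : _ \_ _ = kn 0)//; apply/funext => x; rewrite patchE.
  by case: ifPn => // /negP xI; rewrite kz// => /mem_set.
have iky (y : R) : mu.-integrable `]-oo, y] (EFin \o kn 0).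
  by apply: (@integrableS _ _ _ mu setT) => //; exact: measurable_itv.
pose K (x : R) : R := \int[mu]_(t in `]-oo, x]) kn 0 t.
have dK (x : R) : is_derive x (1 : R) K (kn 0 x).
  have x1 : x < x + 1 by rewrite ltrDl.
  have [|D1 D2] := @continuous_FTC1 R (kn 0) -oo%O x (x + 1) x1 (iky _) _ (ck x); first exact: ltNyr.
  by apply: DeriveDef; [exact: D1|rewrite -derive1E].
exists K; last by move=> x; rewrite derive1E; have Dx := dK x; exact: derive_val.
split.
  apply: (@smooth_class (fun f => f = K \/ exists n, f = kn n)); last by left.
  move=> f [->|[n ->]]; first by exists (kn 0%N) => //; right; exists 0%N.
  by exists (kn n.+1) => //; right; exists n.+1.
have [_ [a1 [b1 [a10 b11 ab1]]]] := tphi; have [_ [a2 [b2 [a20 b21 ab2]]]] := tpsi.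
exists (Num.min a1 a2), (Num.max b1 b2); split; [by rewrite lt_min a10|by rewrite gt_max b11|].
have k0' x : x < Num.min a1 a2 \/ Num.max b1 b2 < x -> kn 0 x = 0.
  move=> H; rewrite /kn/= ab1 ?ab2 ?mulr0 ?subr0//; rewrite in_itv/= negb_and -!ltNge.
    by case: H; rewrite ?lt_min ?gt_max => /andP[_ ->]; rewrite ?orbT.
  by case: H; rewrite ?lt_min ?gt_max => /andP[-> _]; rewrite ?orbT.
move=> x; rewrite in_itv/= negb_and -!ltNge => /orP[xa|xb].
  apply: rint_eq0 => t.
  by rewrite /= in_itv/= => tx; apply: k0'; left; exact: le_lt_trans xa.
rewrite -[RHS]k0 /K Rintegral_mkcond [RHS]Rintegral_mkcond; apply: eq_Rintegral => t _.
rewrite !patchE mem_setE [in RHS]mem_setE /=.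
case: ifPn => tx; case: ifPn => tI //; first by rewrite kz//; exact/negP.
by rewrite -/(kn 0 t) k0'//; right; move: tx; rewrite in_itv/= -ltNge; exact: lt_trans.
Qed.

(** The du Bois-Reymond lemma. Subtracting a multiple of a fixed [psi] of nonzero mean turns any
    [phi] into a derivative, on which [g] vanishes; the constant is the mean of [g] weighted by
    [psi]. *)
Lemma test_fun_ae_cst (g : R -> R) : rintegrable I01 g ->
  (forall phi, test_fun phi -> \int[mu]_(x in I01) (g x * derive1 phi x) = 0) ->
  exists c, {ae mu, forall x, x \in `]0, 1[ -> g x = c}.
Proof.
move=> ig g0; have [psi tpsi psi0] := test_fun_nonzero.
set m := \int[mu]_(x in I01) psi x in psi0.
pose c := (\int[mu]_(x in I01) (g x * psi x)) / m.
exists c; have igc : rintegrable I01 (fun x => g x - c).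
  by apply: rintegrableB => //; exact: rintegrable_cst01.
suff /ae_imp : {ae mu, forall x, x \in `]0, 1[ -> g x - c = 0}.
  by apply => x xg x01; apply/eqP; rewrite -subr_eq0; apply/eqP; exact: xg.
apply: test_fun_ae0 => // phi tphi.
have ip := bm01_rintegrable (test_fun_bm01 tphi).
have ip0 := bm01_rintegrable (test_fun_bm01 tpsi).
have igp := rintegrableM_bm01 ig (test_fun_bm01 tphi).
have igp0 := rintegrableM_bm01 ig (test_fun_bm01 tpsi).
pose s := (\int[mu]_(x in I01) phi x) / m.
have [|K tK KE] := @test_fun_primitive phi psi s tphi tpsi.
  rewrite rintB//; last exact: rintegrableZl.
  by rewrite rintZl// divfK// subrr.
have := g0 K tK.
rewrite (eq_rint (g := fun x => g x * phi x - s * (g x * psi x))); last first.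
  by move=> x _; rewrite KE; ring.
rewrite rintB//; last exact: rintegrableZl.
rewrite rintZl// => E.
rewrite (eq_rint (g := fun x => g x * phi x - c * phi x)); last by move=> x _; ring.
rewrite rintB//; last exact: rintegrableZl.
rewrite rintZl//; move: E; rewrite /c /s.
by move: (\int[mu]_(x in I01) (g x * phi x)) (\int[mu]_(x in I01) (g x * psi x))
  (\int[mu]_(x in I01) phi x) => u v w <-; field.
Qed.

End TestFunctions.

(** * Square-integrable functions on the unit interval *)

Section SquareIntegrable.
Context (R : realType).
Local Notation mu := (@lebesgue_measure R).
Local Notation I01 := (`]0, 1[%classic : set R).

Let mI : measurable I01. Proof. exact: measurable_itv. Qed.

Lemma in_L2P (f : R -> R) :
  in_L2 f <-> measurable_fun I01 f /\ rintegrable I01 (fun x => f x ^+ 2).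
Proof.
have E : (\int[mu]_x (`|(EFin \o (f \_ I01)) x| `^ 2) = \int[mu]_(x in I01) `|f x ^+ 2|%:E)%E.
  rewrite [RHS]integral_mkcond; apply: eq_integral => x _; rewrite /= !patchE.
  case: ifPn => _; last by rewrite normr0 powR0.
  by rewrite powR_mulrn// normrX.
have M : measurable_fun [set: R] (f \_ I01) <-> measurable_fun I01 f.
  by symmetry; apply: (measurable_restrictT f).
split.
- rewrite /in_L2 inE => /andP[/set_mem/= mf /set_mem/= ff].
  have {}mf : measurable_fun I01 f by apply/M.
  split => //; apply: rintegrableP; first exact: measurable_funX.
  have ff' : ('N[mu]_2%:E [EFin \o (f \_ I01)] < +oo)%E := ff.
  rewrite -E -powR_Lnorm//; exact: poweR_lty.
- move=> [mf ift]; rewrite /in_L2; apply/andP; split; apply: mem_set => /=.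
    exact/M.
  rewrite /finite_norm; apply: (@lty_poweRy _ _ 2) => //.
  by rewrite powR_Lnorm// E; exact: rintegrable_lty.
Qed.

Lemma in_L2_measurable (f : R -> R) : in_L2 f -> measurable_fun I01 f.
Proof. by move=> /in_L2P[]. Qed.

Lemma in_L2_sqr (f : R -> R) : in_L2 f -> rintegrable I01 (fun x => f x ^+ 2).
Proof. by move=> /in_L2P[]. Qed.

Lemma in_L2M (f g : R -> R) : in_L2 f -> in_L2 g -> rintegrable I01 (fun x => f x * g x).
Proof.
move=> /in_L2P[mf f2] /in_L2P[mg g2].
apply: (rintegrable_le mI _ (rintegrableD mI f2 g2)); first exact: measurable_funM.
move=> x _; rewrite ler_norml; apply/andP; split.
  rewrite -subr_ge0 opprK.
  have -> : f x * g x + (f x ^+ 2 + g x ^+ 2) =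
    ((f x + g x) ^+ 2 + f x ^+ 2 + g x ^+ 2) / 2 by field.
  by rewrite divr_ge0// !addr_ge0// sqr_ge0.
rewrite -subr_ge0.
have -> : f x ^+ 2 + g x ^+ 2 - f x * g x =
  ((f x - g x) ^+ 2 + f x ^+ 2 + g x ^+ 2) / 2 by field.
by rewrite divr_ge0// !addr_ge0// sqr_ge0.
Qed.

Lemma bm01_in_L2 (h : R -> R) : bm01 h -> in_L2 h.
Proof.
move=> bh; apply/in_L2P; split; first by case: bh.
by have := bm01_rintegrable (bm01M bh bh).
Qed.

Lemma in_L2_rintegrable (f : R -> R) : in_L2 f -> rintegrable I01 f.
Proof.
move=> fL; have := in_L2M fL (bm01_in_L2 (bm01_cst 1)).
by apply: eq_rintegrable => // x _; rewrite mulr1.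
Qed.

Lemma in_L2_lin (c : R) (f g : R -> R) : in_L2 f -> in_L2 g ->
  in_L2 (fun x => c * f x + g x).
Proof.
move=> fL gL; have mf := in_L2_measurable fL; have mg := in_L2_measurable gL.
apply/in_L2P; split; first by apply: measurable_funD => //; exact: measurable_funM.
have i1 := rintegrableD mI (rintegrableZl (c ^+ 2) mI (in_L2_sqr fL)) (in_L2_sqr gL).
apply: (eq_rintegrable mI _ (rintegrableD mI i1 (rintegrableZl (2 * c) mI (in_L2M fL gL)))).
by move=> x _; ring.
Qed.

Lemma eq_in_L2 (f g : R -> R) : (forall x, I01 x -> f x = g x) -> in_L2 f -> in_L2 g.
Proof.
move=> fg /in_L2P[mf f2]; apply/in_L2P; split.
  by apply: (eq_measurable_fun f) => // x /set_mem Ix; rewrite fg.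
by apply: eq_rintegrable f2 => // x Ix; rewrite fg.
Qed.

Lemma ae_eq_rint01 (f g : R -> R) : {ae mu, forall x, x \in `]0, 1[ -> f x = g x} ->
  \int[mu]_(x in I01) f x = \int[mu]_(x in I01) g x.
Proof. by move=> fg; apply: ae_eq_Rintegral; apply: (ae_imp fg) => x fx Ix; exact: fx. Qed.

(** Evaluate the quadratic at its minimum [c = - B / C]; when [C = 0] it is affine in [c], so [B]
    must vanish. *)
Lemma discriminant_le (A B C : R) : 0 <= A -> 0 <= C ->
  (forall c, 0 <= A + 2 * c * B + c ^+ 2 * C) -> `|B| <= Num.sqrt A * Num.sqrt C.
Proof.
move=> A0 C0 H; rewrite -sqrtrM// -sqrtr_sqr ler_wsqrtr//.
have [C_0|Cn] := eqVneq C 0.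
  have [->|Bn] := eqVneq B 0; first by rewrite expr0n mulr_ge0.
  have := H (- (A + 1) / (2 * B)).
  have -> : A + 2 * (- (A + 1) / (2 * B)) * B + (- (A + 1) / (2 * B)) ^+ 2 * C = - 1.
    by rewrite C_0; field.
  by rewrite oppr_ge0 ler10.
have Cp : 0 < C by rewrite lt_neqAle eq_sym Cn.
have := H (- B / C).
have -> : A + 2 * (- B / C) * B + (- B / C) ^+ 2 * C = (A * C - B ^+ 2) / C by field.
by rewrite pmulr_lge0 ?invr_gt0// subr_ge0.
Qed.

(** The derivative is a separate argument, so Cauchy-Schwarz and the triangle inequality are
    independent of the choice made by [weak_deriv]; [f' = 0] gives the [L^2] norm. *)
Definition h1nrm (f f' : R -> R) : R :=
  Num.sqrt (\int[mu]_(x in I01) (f x ^+ 2) + \int[mu]_(x in I01) (f' x ^+ 2)).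

Lemma int_sqr_ge0 (f : R -> R) : 0 <= \int[mu]_(x in I01) (f x ^+ 2).
Proof. by apply: Rintegral_ge0 => x _; exact: sqr_ge0. Qed.

Lemma h1nrm_expand (c : R) (f f' g g' : R -> R) :
  in_L2 f -> in_L2 f' -> in_L2 g -> in_L2 g' ->
  \int[mu]_(x in I01) ((c * g x + f x) ^+ 2) + \int[mu]_(x in I01) ((c * g' x + f' x) ^+ 2) =
  \int[mu]_(x in I01) (f x ^+ 2) + \int[mu]_(x in I01) (f' x ^+ 2)
  + 2 * c * (\int[mu]_(x in I01) (f x * g x) + \int[mu]_(x in I01) (f' x * g' x))
  + c ^+ 2 * (\int[mu]_(x in I01) (g x ^+ 2) + \int[mu]_(x in I01) (g' x ^+ 2)).
Proof.
have E (h k : R -> R) : in_L2 h -> in_L2 k ->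
   \int[mu]_(x in I01) ((c * k x + h x) ^+ 2) = \int[mu]_(x in I01) (h x ^+ 2)
   + 2 * c * \int[mu]_(x in I01) (h x * k x) + c ^+ 2 * \int[mu]_(x in I01) (k x ^+ 2).
  move=> hL kL; have i1 := in_L2_sqr hL; have i2 := in_L2M hL kL; have i3 := in_L2_sqr kL.
  rewrite -(rintZl (2 * c) mI i2) -(rintZl (c ^+ 2) mI i3).
  have j2 := rintegrableZl (2 * c) mI i2; have j3 := rintegrableZl (c ^+ 2) mI i3.
  rewrite -(rintD mI i1 j2) -(rintD mI (rintegrableD mI i1 j2) j3).
  by apply: eq_rint => x _; ring.
by move=> fL f'L gL g'L; rewrite (E f g)// (E f' g')//; ring.
Qed.

Lemma h1nrm_CS (f f' g g' : R -> R) : in_L2 f -> in_L2 f' -> in_L2 g -> in_L2 g' ->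
  `|\int[mu]_(x in I01) (f x * g x) + \int[mu]_(x in I01) (f' x * g' x)|
  <= h1nrm f f' * h1nrm g g'.
Proof.
move=> fL f'L gL g'L; apply: discriminant_le; rewrite ?addr_ge0 ?int_sqr_ge0// => c.
by rewrite -h1nrm_expand// addr_ge0// int_sqr_ge0.
Qed.

Lemma h1nrm_triangle (f f' g g' : R -> R) : in_L2 f -> in_L2 f' -> in_L2 g -> in_L2 g' ->
  h1nrm (fun x => g x + f x) (fun x => g' x + f' x) <= h1nrm f f' + h1nrm g g'.
Proof.
move=> fL f'L gL g'L.
have := h1nrm_CS fL f'L gL g'L; have := @h1nrm_expand 1 f f' g g' fL f'L gL g'L.
rewrite (eq_rint (g := fun x => (g x + f x) ^+ 2)); last by move=> x _; rewrite mul1r.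
rewrite (eq_rint (f := fun x => (1 * g' x + f' x) ^+ 2) (g := fun x => (g' x + f' x) ^+ 2)); last first.
  by move=> x _; rewrite mul1r.
rewrite /h1nrm => ->; rewrite mulr1 expr1n mul1r.
have := addr_ge0 (int_sqr_ge0 f) (int_sqr_ge0 f').
have := addr_ge0 (int_sqr_ge0 g) (int_sqr_ge0 g').
move: (_ + \int[mu]_(x in I01) (g' x ^+ 2)) (_ + \int[mu]_(x in I01) (f' x ^+ 2)) => C A.
move: (_ + \int[mu]_(x in I01) (f' x * g' x)) => B C0 A0 /(le_trans (ler_norm _)) BAC.
rewrite -[leRHS]ger0_norm ?addr_ge0 ?sqrtr_ge0// -sqrtr_sqr ler_wsqrtr//.
rewrite sqrrD !sqr_sqrtr//; lra.
Qed.

Lemma h1nrmZ (c : R) (f f' : R -> R) : in_L2 f -> in_L2 f' ->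
  h1nrm (fun x => c * f x) (fun x => c * f' x) = `|c| * h1nrm f f'.
Proof.
move=> fL f'L; rewrite /h1nrm -sqrtr_sqr -sqrtrM ?sqr_ge0//; congr Num.sqrt.
rewrite mulrDr -!rintZl//; last 2 first.
- exact: in_L2_sqr.
- exact: in_L2_sqr.
by congr (_ + _); apply: eq_rint => x _; rewrite exprMn.
Qed.

Lemma h1nrm_ge0 (f f' : R -> R) : 0 <= h1nrm f f'.
Proof. exact: sqrtr_ge0. Qed.

Lemma in_Linfty_bdd (p : R -> R) : in_Linfty p ->
  measurable_fun I01 p /\ exists P, {ae mu, forall x, x \in `]0, 1[ -> `|p x| <= P}.
Proof.
rewrite /in_Linfty inE => /andP[/set_mem/= mp /set_mem/=].
have {}mp : measurable_fun I01 p by apply/(measurable_restrictT p).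
rewrite /finite_norm unlock; case: ifPn => [_ pP|/negP[]]; last first.
  rewrite (@lt_le_trans _ _ (mu I01))//; first by rewrite lebesgue_measure_itv/= lte_fin ltr01 -EFinD lte_fin subr0 ltr01.
  by apply: le_outer_measure.
split => //.
have H := @ess_sup_ge _ _ R mu (abse \o (EFin \o (p \_ I01))).
exists (fine (ess_sup mu (abse \o (EFin \o (p \_ I01))))).
apply: (ae_imp H) => x /= Hx x01.
rewrite -lee_fin fineK; last first.
  rewrite ge0_fin_numE//; by apply: le_trans Hx; rewrite lee_fin.
by apply: le_trans Hx; rewrite patchE mem_set.
Qed.

End SquareIntegrable.

(** * Weak derivatives and the [H^1] norm *)

Section WeakDerivatives.
Context (R : realType).
Local Notation mu := (@lebesgue_measure R).
Local Notation I01 := (`]0, 1[%classic : set R).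

Let mI : measurable I01. Proof. exact: measurable_itv. Qed.

Lemma test_fun_derive1 (phi : R -> R) : test_fun phi -> test_fun (derive1 phi).
Proof. exact: (@test_fun_derive1n R phi 1). Qed.

Lemma test_fun_in_L2 (phi : R -> R) : test_fun phi -> in_L2 phi.
Proof. by move=> tphi; apply: bm01_in_L2; exact: test_fun_bm01. Qed.

Lemma weak_deriv_ae_unique (f g h : R -> R) : rintegrable I01 g -> rintegrable I01 h ->
  is_weak_deriv f g -> is_weak_deriv f h ->
  {ae mu, forall x, x \in `]0, 1[ -> g x = h x}.
Proof.
move=> ig ih fg fh.
have : {ae mu, forall x, x \in `]0, 1[ -> g x - h x = 0}.
  apply: test_fun_ae0 => [|phi tphi]; first exact: rintegrableB.
  have bphi := test_fun_bm01 tphi.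
  rewrite (eq_rint (g := fun x => g x * phi x - h x * phi x)); last first.
    by move=> x _; rewrite mulrBl.
  rewrite rintB//; [|exact: rintegrableM_bm01|exact: rintegrableM_bm01].
  have := fg _ tphi; rewrite fh// => /eqP; rewrite eqr_opp => /eqP ->.
  by rewrite subrr.
by move=> /ae_imp; apply => x H x01; apply/eqP; rewrite -subr_eq0; apply/eqP; exact: H.
Qed.

Lemma is_weak_deriv_lin (c : R) (f f' g g' : R -> R) : in_L2 f -> in_L2 f' ->
  in_L2 g -> in_L2 g' -> is_weak_deriv f f' -> is_weak_deriv g g' ->
  is_weak_deriv (fun x => c * f x + g x) (fun x => c * f' x + g' x).
Proof.
move=> /in_L2_rintegrable fL /in_L2_rintegrable f'L /in_L2_rintegrable gL /in_L2_rintegrable g'L.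
move=> fd gd phi tphi.
have bphi := test_fun_bm01 tphi; have bphi' := test_fun_bm01 (test_fun_derive1 tphi).
have E (h k psi : R -> R) : rintegrable I01 h -> rintegrable I01 k -> bm01 psi ->
   \int[mu]_(x in I01) ((c * h x + k x) * psi x) =
   c * \int[mu]_(x in I01) (h x * psi x) + \int[mu]_(x in I01) (k x * psi x).
  move=> hL kL bpsi; have i1 := rintegrableM_bm01 hL bpsi.
  have i2 := rintegrableM_bm01 kL bpsi.
  rewrite -(rintZl c mI i1) -(rintD mI (rintegrableZl c mI i1) i2).
  by apply: eq_rint => x _; rewrite mulrDl mulrA.
by rewrite !E// fd// gd// mulrN opprD.
Qed.

Lemma test_fun_IBP (phi psi : R -> R) : test_fun phi -> test_fun psi ->
  \int[mu]_(x in I01) (phi x * derive1 psi x) = - \int[mu]_(x in I01) (derive1 phi x * psi x).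
Proof.
move=> tphi tpsi.
have dphi (x : R) := test_fun_is_derive 0 x tphi; have dpsi (x : R) := test_fun_is_derive 0 x tpsi.
have tphi' := test_fun_derive1 tphi; have tpsi' := test_fun_derive1 tpsi.
pose f (x : R) := phi x * derive1 psi x + derive1 phi x * psi x.
have D (x : R) : is_derive x (1 : R) (fun x => phi x * psi x) (f x).
  have := is_deriveM (dphi x) (dpsi x).
  by move=> D; apply: is_derive_eq D _; rewrite /f /GRing.scale/= [X in _ + X]mulrC.
have cf : continuous f.
  move=> x; apply: cvgD; apply: cvgM; exact: test_fun_continuous.
have := continuous_FTC2_Rintegral ler01 D cf.
rewrite (test_fun_ends tphi); last by rewrite /= in_itv/= ltxx andbF.
rewrite (test_fun_ends tphi (x := 0)); last by rewrite /= in_itv/= ltxx.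
rewrite !mul0r subrr rintD//; last 2 first.
- by apply: rintegrableM_bm01; [apply: bm01_rintegrable|]; exact: test_fun_bm01.
- by apply: rintegrableM_bm01; [apply: bm01_rintegrable|]; exact: test_fun_bm01.
by move=> /eqP; rewrite addr_eq0 => /eqP.
Qed.

Lemma in_H1_weak (f g : R -> R) : in_L2 f -> in_L2 g -> is_weak_deriv f g -> in_H1 f.
Proof. by move=> fL gL fg; split => //; exists g. Qed.

Lemma weak_derivP (f : R -> R) : in_H1 f -> in_L2 (weak_deriv f) /\ is_weak_deriv f (weak_deriv f).
Proof.
move=> [fL [g [gL fg]]].
by have := @xgetPex _ (fun=> 0) [set g | in_L2 g /\ is_weak_deriv f g] (ex_intro _ g (conj gL fg)).
Qed.

(** Weak derivatives are unique almost everywhere, so any of them may stand for the one picked by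
    [weak_deriv]. *)
Lemma H1norm_weak (f g : R -> R) : in_L2 f -> in_L2 g -> is_weak_deriv f g ->
  H1norm f = (h1nrm f g)%:E.
Proof.
move=> fL gL fg; have fH := in_H1_weak fL gL fg.
have [dL df] := weak_derivP fH.
rewrite /H1norm asboolT// /h1nrm; congr (Num.sqrt (_ + _))%:E.
apply: ae_eq_rint01; apply: (ae_imp (weak_deriv_ae_unique _ _ df fg)) => [||x E Ix].
- exact: in_L2_rintegrable.
- exact: in_L2_rintegrable.
- by rewrite E.
Qed.

Lemma H1norm_lty (f : R -> R^o) : (H1norm f < +oo)%E <-> in_H1 f.
Proof.
by rewrite /H1norm; case: (asboolP (in_H1 f)) => fH; split => //; rewrite ?ltry ?ltxx.
Qed.

Lemma H1norm_fin (f : R -> R^o) : in_H1 f -> H1norm f = (h1nrm f (weak_deriv f))%:E.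
Proof. by move=> fH; have [dL df] := weak_derivP fH; rewrite (@H1norm_weak f (weak_deriv f))//; case: fH. Qed.

Lemma in_H1_lin (c : R) (f g : R -> R) : in_H1 f -> in_H1 g ->
  in_H1 (fun x => c * f x + g x) /\
  is_weak_deriv (fun x => c * f x + g x) (fun x => c * weak_deriv f x + weak_deriv g x).
Proof.
move=> fH gH; have [fL _] := fH; have [gL _] := gH.
have [dfL df] := weak_derivP fH; have [dgL dg] := weak_derivP gH.
have d := is_weak_deriv_lin c fL dfL gL dgL df dg; split => //.
by apply: in_H1_weak d; exact: in_L2_lin.
Qed.

Lemma is_weak_deriv0 : is_weak_deriv (fun=> 0 : R) (fun=> 0 : R).
Proof.
move=> phi _; rewrite !rint_eq0 ?oppr0// => x _; exact: mul0r.
Qed.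

Lemma in_L2_0 : in_L2 (fun=> 0 : R).
Proof. by apply: bm01_in_L2; exact: bm01_cst. Qed.

Lemma H1norm_ge0 (f : R -> R^o) : (0 <= H1norm f)%E.
Proof. by rewrite /H1norm; case: asboolP => // _; rewrite lee_fin sqrtr_ge0. Qed.

Lemma H1normZ (c : R) (f : R -> R^o) : (H1norm f < +oo)%E ->
  H1norm (c *: f) = (`|c|%:E * H1norm f)%E.
Proof.
move=> /H1norm_lty fH; have [fL _] := fH; have [dL df] := weak_derivP fH.
rewrite (H1norm_fin fH) -EFinM -h1nrmZ//.
have := is_weak_deriv_lin c fL dL in_L2_0 in_L2_0 df is_weak_deriv0.
rewrite (_ : (fun x => c * f x + 0) = c *: f); last first.
  by apply/funext => x; rewrite addr0.
rewrite (_ : (fun x => c * weak_deriv f x + 0) = fun x => c * weak_deriv f x); last first.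
  by apply/funext => x; rewrite addr0.
have Z h : in_L2 h -> in_L2 (fun x => c * h x).
  move=> hL; have := in_L2_lin c hL in_L2_0.
  by apply: eq_in_L2 => x _; rewrite addr0.
by move=> d; exact: (@H1norm_weak (c *: f) _ (Z _ fL) (Z _ dL) d).
Qed.

Lemma H1normD (f g : R -> R^o) : (H1norm (f + g)%R <= H1norm f + H1norm g)%E.
Proof.
have [fH|fH] := pselect (in_H1 f); last first.
  by rewrite {2}/H1norm asboolF// addye ?leey// gt_eqF// (lt_le_trans _ (H1norm_ge0 _)).
have [gH|gH] := pselect (in_H1 g); last first.
  by rewrite {3}/H1norm asboolF// addey ?leey// gt_eqF// (lt_le_trans _ (H1norm_ge0 _)).
have [fL _] := fH; have [dL df] := weak_derivP fH.
have [gL _] := gH; have [d'L d'f] := weak_derivP gH.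
have := is_weak_deriv_lin 1 gL d'L fL dL d'f df.
have E (h k : R -> R) : (fun x => 1 * k x + h x) = (fun x => k x + h x).
  by apply/funext => x; rewrite mul1r.
rewrite !E => d.
have -> : f + g = (fun x => g x + f x) by apply/funext => x; rewrite addrC.
have L1 (h k : R -> R) : in_L2 h -> in_L2 k -> in_L2 (fun x => k x + h x).
  by move=> hL kL; rewrite -E; exact: in_L2_lin.
rewrite (@H1norm_weak _ (fun x => weak_deriv g x + weak_deriv f x))//; [|exact: L1|exact: L1].
by rewrite (H1norm_fin fH) (H1norm_fin gH) -EFinD lee_fin h1nrm_triangle.
Qed.

Lemma test_fun_weak_deriv (phi : R -> R) : test_fun phi -> is_weak_deriv phi (derive1 phi).
Proof. by move=> tphi psi tpsi; exact: test_fun_IBP. Qed.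

Lemma test_fun_in_H1 (phi : R -> R) : test_fun phi -> in_H1 phi.
Proof.
move=> tphi; apply: in_H1_weak (test_fun_weak_deriv tphi).
  exact: test_fun_in_L2.
by apply: test_fun_in_L2; exact: test_fun_derive1.
Qed.

Lemma test_fun_in_H10 (phi : R -> R) : test_fun phi -> in_H10 phi.
Proof.
move=> tphi; split; first exact: test_fun_in_H1.
move=> e e0; exists phi => //; rewrite subrr (@H1norm_weak _ (fun=> 0)).
- rewrite /h1nrm !rint_eq0 ?addr0 ?sqrtr0 ?lte_fin// => x _; exact: expr0n.
- exact: in_L2_0.
- exact: in_L2_0.
- exact: is_weak_deriv0.
Qed.

Lemma test_funZ (c : R) (phi : R -> R) : test_fun phi -> test_fun (fun x => c * phi x).
Proof.
move=> tphi; have [_ [a [b [a0 b1 ab]]]] := tphi; split; last first.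
  by exists a, b; split => // x /ab ->; rewrite mulr0.
apply: (@smooth_class R (fun f => exists n, f = fun x => c * derive1n n phi x)); last by exists 0%N.
move=> _ [n ->]; exists (fun x => c * derive1n n.+1 phi x); first by exists n.+1.
move=> x; have := is_deriveZ c (test_fun_is_derive n x tphi); exact.
Qed.

Lemma derive1Z (c : R) (phi : R -> R) : test_fun phi ->
  derive1 (fun x => c * phi x) = fun x => c * derive1 phi x.
Proof.
move=> tphi; apply/funext => x; rewrite derive1E.
by have D := is_deriveZ c (test_fun_is_derive 0 x tphi); exact: derive_val.
Qed.

End WeakDerivatives.

(** * Traces and the Cauchy problem at [x0] *)

Section Traces.
Context (R : realType) (x0 : R).
Local Notation mu := (@lebesgue_measure R).
Local Notation I01 := (`]0, 1[%classic : set R).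
Hypothesis x001 : 0 < x0 < 1.

Let mI : measurable I01. Proof. exact: measurable_itv. Qed.

(** Continuous representatives with different values at [x0] would differ on a whole neighbourhood,
    although they agree almost everywhere near [x0]. *)
Lemma is_trace_unique (f : R -> R) (y z : R) : is_trace f x0 y -> is_trace f x0 z -> y = z.
Proof.
move=> [e1 [e10 [g1 [c1 E1 <-]]]] [e2 [e20 [g2 [c2 E2 <-]]]].
apply: contrapT => /eqP g12.
have : \forall y \near x0, g1 y != g2 y.
  have c : {for x0, continuous (fun y => g1 y - g2 y)}.
    by apply: cvgB; [apply: c1|apply: c2]; exact: ballxx.
  have d0 : 0 < `|g1 x0 - g2 x0| by rewrite normr_gt0 subr_eq0.
  move/cvgrPdist_lt : c => /(_ _ d0); apply: filterS => t.
  by apply: contraTneq => ->; rewrite subrr subr0 ltxx.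
move=> [e3 e30 E3].
pose e := Num.min e1 (Num.min e2 e3).
have e0 : 0 < e by rewrite !lt_min e10 e20.
apply: (@ae_absurd R x0 (x0 + e)); first by rewrite ltrDl.
apply: (ae_imp2 E1 E2) => t t1 t2; apply/negP; rewrite in_itv/= => /andP[x0t te].
have : `|x0 - t| < e by rewrite ltr0_norm ?subr_lt0// opprB ltrBlDl.
rewrite !lt_min => /and3P[h1 h2 h3].
by have := E3 t h3; rewrite -t1// -t2// eqxx.
Qed.

Lemma traceE (f : R -> R) (y : R) : is_trace f x0 y -> trace f x0 = y.
Proof. by move=> fy; apply: xget_unique => // z fz; exact: is_trace_unique fz fy. Qed.

Lemma is_trace_ae (f g : R -> R) : (forall x, I01 x -> {for x, continuous g}) ->
  {ae mu, forall x, x \in `]0, 1[ -> f x = g x} -> is_trace f x0 (g x0).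
Proof.
move=> cg fg.
have [x00 x01] := andP x001.
exists (Num.min x0 (1 - x0)); split; first by rewrite lt_min x00 subr_gt0.
have sub x : ball x0 (Num.min x0 (1 - x0)) x -> 0 < x < 1.
  rewrite /ball/= lt_min !ltr_norml => /andP[/andP[a1 a2] /andP[b1 b2]].
  apply/andP; split; lra.
exists g; split => //.
  by move=> x /sub x1; apply: cg; rewrite /= in_itv.
by apply: (ae_imp fg) => x fx /sub x1; apply: fx; rewrite in_itv.
Qed.

Lemma sgk_near (x y : R) : y != x -> \forall z \near x, sgk x0 z y = sgk x0 x y.
Proof.
move=> yx; have [y0|y0|->] := ltgtP y x0.
- rewrite sgk_left//; have [xy|xy|xy] := ltgtP x y.
  + near=> z; rewrite sgk_left// (_ : z < y)//; near: z; exact: lt_nbhsl.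
  + near=> z; rewrite sgk_left// ltNge (_ : y <= z)//; apply: ltW; near: z; exact: lt_nbhsr.
  + by rewrite xy eqxx in yx.
- rewrite sgk_right//; have [xy|xy|xy] := ltgtP x y.
  + near=> z; rewrite sgk_right// ltNge (_ : z <= y)//; apply: ltW; near: z; exact: lt_nbhsl.
  + near=> z; rewrite sgk_right// (_ : y < z)//; near: z; exact: lt_nbhsr.
  + by rewrite xy eqxx in yx.
- by near=> z; rewrite !sgk_diag.
Unshelve. all: by end_near. Qed.

(** For [y != x] the kernel [sgk x0 z y] is constant in [z] near [x], so dominated convergence
    applies along sequences. *)
Lemma Iop_continuous (q : R -> R) : rintegrable I01 q -> continuous (Iop x0 q).
Proof.
move=> iq x; apply/(@cvg_nbhsP R R^o) => w wx.
have mq := rintegrable_measurable iq.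
have [|||||_ cv] := @rint_dominated R I01 (fun n y => sgk x0 (w n) y * q y)
  (fun y => sgk x0 x y * q y) (fun y => `|q y|) mI.
- by move=> n; apply: measurable_funM => //; exact: measurable_sgk1.
- by apply: measurable_funM => //; exact: measurable_sgk1.
- exact: rintegrable_norm.
- by move=> n y _; rewrite normrM ler_piMl// sgk_le1.
- apply: (ae_imp (ae_neq x)) => y yx _; apply: cvgM; last exact: cvg_cst.
  by apply: cvg_near_cst; apply: (wx _ (sgk_near (introN eqP yx))).
exact: cv.
Qed.

Lemma Iop_diag (q : R -> R) : Iop x0 q x0 = 0.
Proof.
apply: rint_eq0 => y _; have [y0|y0|->] := ltgtP y x0.
- by rewrite sgk_left// ltNge (ltW y0) oppr0 mul0r.
- by rewrite sgk_right// ltNge (ltW y0) mul0r.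
- by rewrite sgk_diag mul0r.
Qed.

(** Since [phi] vanishes at both endpoints, the integral from [y] to the endpoint on its side leaves
    [- phi y]. At [x0] itself the kernel is zero. *)
Lemma Istar_derive1 (phi : R -> R) (y : R) : test_fun phi -> I01 y -> y != x0 ->
  Istar x0 (derive1 phi) y = - phi y.
Proof.
move=> tphi; rewrite /= in_itv/= => /andP[y0 y1] yx0.
have D (x : R) : is_derive x (1 : R) phi (derive1 phi x) := test_fun_is_derive 0 x tphi.
have C := test_fun_continuous (test_fun_derive1 tphi).
have [yx|yx|yx] := ltgtP y x0; last by rewrite yx eqxx in yx0.
- rewrite /Istar (@rint01_indic R 0 y (fun x => - derive1 phi x)) ?(ltW y1)//.
  + have DN (x : R) : is_derive x (1 : R) (fun x => - phi x) (- derive1 phi x).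
      exact: is_deriveN (D x).
    rewrite (continuous_FTC2_Rintegral (ltW y0) DN).
      rewrite (test_fun_ends tphi (x := 0)) ?oppr0 ?addr0//.
      by rewrite /= in_itv/= ltxx.
    by move=> x; apply: cvgN; exact: C.
  + by move=> x _ /andP[_ xy]; rewrite sgk_left// xy mulN1r.
  + by move=> x; rewrite /= in_itv/= => /andP[-> _]/= /negbTE xy; rewrite sgk_left// xy oppr0 mul0r.
- rewrite /Istar (@rint01_indic R y 1 (derive1 phi)) ?(ltW y0)//.
  + rewrite (continuous_FTC2_Rintegral (ltW y1) D C) (test_fun_ends tphi (x := 1)) ?sub0r//.
    by rewrite /= in_itv/= ltxx andbF.
  + by move=> x _ /andP[yx' _]; rewrite sgk_right// yx' mul1r.
  + by move=> x; rewrite /= in_itv/= => /andP[_ ->]; rewrite andbT => /negbTE xy; rewrite sgk_right// xy mul0r.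
Qed.

Lemma Iop_weak_deriv (q : R -> R) : rintegrable I01 q -> is_weak_deriv (Iop x0 q) q.
Proof.
move=> iq phi tphi.
have ip := bm01_rintegrable (test_fun_bm01 (test_fun_derive1 tphi)).
rewrite (eq_rint (g := fun x => derive1 phi x * Iop x0 q x)); last by move=> x _; exact: mulrC.
rewrite IopE// -mulN1r -rintZl//; last first.
  by apply: rintegrableM_bm01 => //; exact: test_fun_bm01.
apply: ae_eq_Rintegral; apply: (ae_imp (ae_neq x0)) => y yx Iy.
by rewrite Istar_derive1 ?mulN1r ?mulrN//; exact/eqP.
Qed.

(** [f - Iop x0 g] has zero weak derivative, hence is a constant, and this constant is the trace of
    [f]. *)
Lemma weak_deriv_Iop (f g : R -> R) : rintegrable I01 f -> rintegrable I01 g ->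
  is_weak_deriv f g -> trace f x0 = 0 ->
  {ae mu, forall x, x \in `]0, 1[ -> f x = Iop x0 g x}.
Proof.
move=> fi gi fg f0.
have iI := bm01_rintegrable (Iop_bm01 x0 gi).
have [c fc] : exists c, {ae mu, forall x, x \in `]0, 1[ -> f x - Iop x0 g x = c}.
  apply: test_fun_ae_cst => [|phi tphi]; first exact: rintegrableB.
  have bphi := test_fun_bm01 (test_fun_derive1 tphi).
  rewrite (eq_rint (g := fun x => f x * derive1 phi x - Iop x0 g x * derive1 phi x)); last first.
    by move=> x _; rewrite mulrBl.
  rewrite rintB//; [|exact: rintegrableM_bm01|exact: rintegrableM_bm01].
  by rewrite fg// (Iop_weak_deriv gi)// subrr.
have {}fc : {ae mu, forall x, x \in `]0, 1[ -> f x = Iop x0 g x + c}.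
  by apply: (ae_imp fc) => x H x1; rewrite -(H x1) addrC subrK.
(* The continuous primitive exhibits an actual trace, so [trace f x0 = 0] concerns a genuine value
   and not the default of [trace]. *)
have : is_trace f x0 (Iop x0 g x0 + c).
  apply: (@is_trace_ae f (fun x => Iop x0 g x + c)) => // x _.
  by apply: cvgD; [exact: Iop_continuous|exact: cvg_cst].
move=> /traceE; rewrite f0 Iop_diag add0r => c0.
by apply: (ae_imp fc) => x /[apply]; rewrite -c0 addr0.
Qed.

(** The weak form of [v'' = q] says that [v1] has weak derivative [q], so the first-order lemma
    applies to [v1] and then to [v]. *)
Lemma weak_deriv2_Iop (v v1 q : R -> R) : rintegrable I01 v -> rintegrable I01 v1 ->
  rintegrable I01 q -> is_weak_deriv v v1 ->
  (forall phi, test_fun phi ->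
    \int[mu]_(x in I01) (v x * derive1n 2 phi x) = \int[mu]_(x in I01) (q x * phi x)) ->
  trace v x0 = 0 -> trace v1 x0 = 0 ->
  {ae mu, forall x, x \in `]0, 1[ -> v x = Iop x0 (Iop x0 q) x}.
Proof.
move=> vi v1i qi vv1 vq tv tv1.
have v1q : is_weak_deriv v1 q.
  move=> phi tphi; have := vv1 _ (test_fun_derive1 tphi).
  by have := vq _ tphi; rewrite derive1nS derive1n1 => -> ->; rewrite opprK.
have E1 := weak_deriv_Iop v1i qi v1q tv1.
have iI := bm01_rintegrable (Iop_bm01 x0 qi).
apply: (weak_deriv_Iop vi iI _ tv) => phi tphi.
rewrite vv1//; congr (- _); apply: ae_eq_rint01.
by apply: (ae_imp E1) => x H x1; rewrite H.
Qed.

End Traces.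

(** * Bochner integrals with real weights *)

Section SimpleWeights.
Context (R : realType).
Import HBNNSimple.

(** The level sets are listed explicitly, so that the product with a vector-valued simple function
    is again a list of pairs. *)
Lemma nneg_simple_approx (D : set R) (w : R -> R) : measurable D ->
  measurable_fun D w -> (forall t, D t -> 0 <= w t) ->
  exists h : nat -> seq (R * set R),
    [/\ forall n z, z \in h n -> measurable z.2,
        forall n t, D t -> 0 <= \sum_(z <- h n) z.1 * \1_(z.2) t <= w t &
        forall t, D t -> \sum_(z <- h n) z.1 * \1_(z.2) t @[n --> \oo] --> w t].
Proof.
move=> mD mw w0.
have mEw : measurable_fun D (EFin \o w) by exact/measurable_EFinP.
have w0' t : D t -> (0 <= (EFin \o w) t)%E by move=> Dt; rewrite lee_fin w0.
pose f := nnsfun_approx mD mEw.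
pose h n := [seq (r, (f n : R -> R) @^-1` [set r]) | r <- finmap.enum_fset (fset_set (range (f n)))].
have hE n t : \sum_(z <- h n) z.1 * \1_(z.2) t = f n t.
  by rewrite big_map fimfunE fsbig_finite.
have fcv t : D t -> f n t @[n --> \oo] --> w t.
  move=> Dt; have := cvg_nnsfun_approx mD mEw w0' Dt.
  by move=> /fine_cvgP[].
exists h; split.
- by move=> n z /mapP[r _ ->]/=; exact: measurable_sfunP.
- move=> n t Dt; rewrite hE; apply/andP; split; first exact: fun_ge0.
  rewrite -(cvg_lim _ (fcv t Dt))//.
  have nd : nondecreasing_seq (fun n => f n t).
    by move=> i j ij; have /lefP := nd_nnsfun_approx mD mEw ij; exact.
  by apply: (nondecreasing_cvgn_le nd); apply/cvg_ex; exists (w t); exact: fcv.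
- by move=> t Dt; under eq_fun do rewrite hE; exact: fcv.
Qed.

End SimpleWeights.

Lemma EFin_Rintegral_ge0 (R : realType) (D : set R) (f : R -> R) : rintegrable D f ->
  (forall t, 0 <= f t) ->
  (\int[@lebesgue_measure R]_(t in D) f t)%:E = (\int[@lebesgue_measure R]_(t in D) (f t)%:E)%E.
Proof.
move=> ig f0; rewrite /Rintegral fineK// ge0_fin_numE.
  apply: le_lt_trans (rintegrable_lty ig).
  apply: ae_le_integral_nomeas => [t _|t _|]; rewrite ?lee_fin//.
  by apply: aeW => t _; rewrite lee_fin ler_norm.
by apply: integral_ge0 => t _; rewrite lee_fin.
Qed.

Section Bochner.
Context (R : realType) (X : lmodType R) (N : X -> \bar R).
Local Notation mu := (@lebesgue_measure R).

(** Functionals of norm at most one, linear on the elements of finite norm, which form the actual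
    space. *)
Definition bounded_functional (l : X -> R) :=
  (forall c x y, (N x < +oo)%E -> (N y < +oo)%E -> l (c *: x + y) = c * l x + l y) /\
  (forall x, (N x < +oo)%E -> (`|l x|%:E <= N x)%E).

Hypothesis N_ge0 : forall x, (0 <= N x)%E.
Hypothesis N0 : N 0 = 0%E.
Hypothesis NZ : forall c x, (N x < +oo)%E -> N (c *: x) = (`|c|%:E * N x)%E.
Hypothesis ND : forall x y, (N (x + y)%R <= N x + N y)%E.
(** Plays the role of Hahn-Banach; for [H^1] and [H^-1] it is verified with explicit functionals. *)
Hypothesis N_norming : forall y r, (N y < +oo)%E -> 0 <= r ->
  (forall l, bounded_functional l -> `|l y| <= r) -> (N y <= r%:E)%E.
(** Completeness, stated for sequences with increments at most [2^-n]. *)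
Hypothesis N_complete : forall x : nat -> X, (forall n, (N (x n) < +oo)%E) ->
  (forall n, (N (x n.+1 - x n)%R <= (2^-1 ^+ n)%:E)%E) ->
  exists y, (N y < +oo)%E /\ (fun n => N (y - x n)) @ \oo --> 0%E.

Lemma ecvg0P (w : nat -> \bar R) : (forall n, 0 <= w n)%E ->
  w @ \oo --> 0%E <-> forall e : R, 0 < e -> \forall n \near \oo, (w n <= e%:E)%E.
Proof.
move=> w0; split=> [/fine_cvgP[wf /cvgrPdist_le wc] e e0|H].
  apply: filterS2 wf (wc e e0) => n wn; rewrite sub0r normrN => H.
  by rewrite -(fineK wn) lee_fin; apply: le_trans (ler_norm _) H.
apply/fine_cvgP; split.
  by apply: filterS (H 1 ltr01) => n wn; rewrite ge0_fin_numE// (le_lt_trans wn)// ltry.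
apply/cvgrPdist_le => e e0; apply: filterS (H e e0) => n wn.
rewrite sub0r normrN ger0_norm ?fine_ge0// -lee_fin fineK//.
by rewrite ge0_fin_numE// (le_lt_trans wn)// ltry.
Qed.

Lemma NZ_lty (c : R) (x : X) : (N x < +oo)%E -> (N (c *: x)%R < +oo)%E.
Proof. by move=> Nx; rewrite NZ// lte_mul_pinfty// lee_fin. Qed.

Lemma ND_lty (x y : X) : (N x < +oo)%E -> (N y < +oo)%E -> (N (x + y)%R < +oo)%E.
Proof. by move=> Nx Ny; apply: (le_lt_trans (ND _ _)); exact: lte_add_pinfty. Qed.

Lemma NN (x : X) : N (- x) = N x.
Proof.
have H y : (N y < +oo)%E -> N (- y) = N y.
  by move=> Ny; rewrite -scaleN1r NZ// normrN normr1 mul1e.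
have [Nx|] := ltP (N x) +oo%E; first exact: H.
rewrite leye_eq => /eqP Nx; rewrite Nx; apply/eqP; rewrite -leye_eq leNgt.
by apply/negP => /[dup] NNx /H; rewrite opprK Nx => E; rewrite -E ltxx in NNx.
Qed.

Lemma NBC (x y : X) : N (x - y) = N (y - x).
Proof. by rewrite -NN opprB. Qed.

Lemma NB_lty (x y : X) : (N x < +oo)%E -> (N y < +oo)%E -> (N (x - y)%R < +oo)%E.
Proof. by move=> Nx Ny; apply: ND_lty; rewrite ?NN. Qed.

Lemma NB_trans (x y z : X) : (N (x - z)%R <= N (x - y)%R + N (y - z)%R)%E.
Proof. by apply: le_trans (ND _ _); rewrite addrA subrK. Qed.

Lemma simple_eval_cons (e : set R * X) (s : simple_fun X) (t : R) :
  simple_eval (e :: s) t = (\1_(e.1) t : R) *: e.2 + simple_eval s t.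
Proof. by rewrite /simple_eval big_cons. Qed.

Lemma simple_eval_nil (t : R) : simple_eval ([::] : simple_fun X) t = 0.
Proof. by rewrite /simple_eval big_nil. Qed.

Definition simple_opp (s : simple_fun X) : simple_fun X := [seq (e.1, - e.2) | e <- s].

Lemma simple_evalB (s s' : simple_fun X) (t : R) :
  simple_eval (s ++ simple_opp s') t = simple_eval s t - simple_eval s' t.
Proof.
rewrite /simple_eval big_cat/=; congr (_ + _); rewrite big_map -sumrN.
by apply: eq_bigr => e _; rewrite scalerN.
Qed.

Lemma simple_intB (s s' : simple_fun X) :
  simple_int (s ++ simple_opp s') = simple_int s - simple_int s'.
Proof.
rewrite /simple_int big_cat/=; congr (_ + _); rewrite big_map -sumrN.
by apply: eq_bigr => e _; rewrite scalerN.
Qed.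

Lemma is_simpleB (D : set R) (s s' : simple_fun X) : is_simple N D s -> is_simple N D s' ->
  is_simple N D (s ++ simple_opp s').
Proof.
move=> hs hs' e; rewrite mem_cat => /orP[/hs//|/mapP[e' /hs'[? ? ? ?] ->]].
by split => //=; rewrite NN.
Qed.

Lemma is_simple_cons (D : set R) (e : set R * X) (s : simple_fun X) : is_simple N D (e :: s) ->
  [/\ measurable e.1, e.1 `<=` D, (mu e.1 < +oo)%E & (N e.2 < +oo)%E] /\ is_simple N D s.
Proof.
by move=> H; split; [apply: H; rewrite mem_head|move=> e' e's; apply: H; rewrite inE e's orbT].
Qed.

Lemma N_simple_eval_lty (D : set R) (s : simple_fun X) (t : R) : is_simple N D s ->
  (N (simple_eval s t) < +oo)%E.
Proof.
elim: s => [_|e s IH /is_simple_cons[[_ _ _ Ne] hs]].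
  by rewrite simple_eval_nil N0.
by rewrite simple_eval_cons ND_lty ?IH// NZ_lty.
Qed.

Lemma N_simple_int_lty (D : set R) (s : simple_fun X) : is_simple N D s ->
  (N (simple_int s) < +oo)%E.
Proof.
elim: s => [_|e s IH /is_simple_cons[[_ _ _ Ne] hs]].
  by rewrite /simple_int big_nil N0.
by rewrite /simple_int big_cons ND_lty ?NZ_lty//; exact: IH.
Qed.

(** The shift [x] is there for the induction: on the set of the first pair its vector is added to
    [x], elsewhere nothing is. *)
Lemma measurable_N_simple (D E : set R) (s : simple_fun X) (x : X) : measurable E ->
  is_simple N D s -> measurable_fun E (fun t => N (x + simple_eval s t)).
Proof.
move=> mE; elim: s x => [x _|e s IH x /is_simple_cons[[me _ _ Ne] hs]].
  apply: (eq_measurable_fun (fun=> N x)); last exact: measurable_cst.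
  by move=> t _; rewrite simple_eval_nil addr0.
apply: (eq_measurable_fun (fun t => if t \in e.1 then N ((x + e.2) + simple_eval s t)
    else N (x + simple_eval s t))).
  move=> t _; rewrite simple_eval_cons indicE; case: ifPn => _.
    by rewrite scale1r addrA.
  by rewrite scale0r add0r.
apply: measurable_fun_if => //.
- apply: measurable_funTS; apply: (measurable_fun_bool true).
  by rewrite setTI (_ : _ @^-1` _ = e.1)//; apply/seteqP; split => t /= => [/set_mem//|/mem_set].
- by apply: measurable_funS (IH _ hs).
- by apply: measurable_funS (IH _ hs).
Qed.

Lemma cvg_N_fine (x : X) (y : nat -> X) : (forall n, (N (y n) < +oo)%E) ->
  (fun n => N (x - y n)) @ \oo --> 0%E ->
  (N x < +oo)%E /\ fine (N (y n)) @[n --> \oo] --> fine (N x).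
Proof.
move=> Ny /ecvg0P-/(_ (fun n => N_ge0 _)) H.
have Nx : (N x < +oo)%E.
  have [n _ /(_ n (leqnn n)) Hn] := H 1 ltr01.
  rewrite -(subrK (y n) x); apply: ND_lty => //.
  by apply: le_lt_trans Hn _; rewrite ltry.
split => //; apply/cvgrPdist_le => e e0; apply: filterS (H e e0) => n Hn.
have fx : N x \is a fin_num by rewrite ge0_fin_numE.
have fy : N (y n) \is a fin_num by rewrite ge0_fin_numE.
have fd : N (x - y n) \is a fin_num by rewrite ge0_fin_numE// NB_lty.
have h1 := ND (x - y n) (y n); have h2 := ND (y n - x) x.
rewrite subrK in h1; rewrite subrK NBC in h2.
move: h1 h2 Hn; rewrite -(fineK fx) -(fineK fy) -(fineK fd) -!EFinD !lee_fin /=.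
by move=> h1 h2 Hn; rewrite ler_norml; apply/andP; split; lra.
Qed.

(** Limit and approximants are set to 0 on the exceptional set, after which convergence holds
    everywhere. *)
Lemma ae_measurable_lim (D : set R) (f : nat -> R -> R) (F : R -> R) : measurable D ->
  (forall n, measurable_fun D (f n)) ->
  {ae mu, forall t, D t -> f n t @[n --> \oo] --> F t} ->
  exists2 g, measurable_fun D g & {ae mu, forall t, D t -> F t = g t}.
Proof.
move=> mD mf [Z [mZ Z0 sZ]].
have mC : measurable (~` Z) by exact: measurableC.
exists (fun t => F t * \1_(~` Z) t); last first.
  exists Z; split => // t /= H; apply: contrapT => nZ; apply: H => Dt.
  by rewrite indicE mem_set// mulr1.
apply: (@measurable_fun_cvg _ _ _ _ (fun n t => f n t * \1_(~` Z) t)) => [n|t Dt].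
  by apply: measurable_funM => //; exact: measurable_indic.
have [Zt|Zt] := pselect (Z t).
  have -> : \1_(~` Z) t = 0 :> R by rewrite indicE memNset//=; exact.
  by rewrite mulr0; under eq_fun do rewrite mulr0; exact: cvg_cst.
apply: cvgM; last exact: cvg_cst.
by apply: contrapT => H; apply: Zt; apply: sZ => /= H'; apply: H; exact: H'.
Qed.

Lemma strongly_measurable_N (D : set R) (F : R -> X) : measurable D ->
  strongly_measurable N D F ->
  exists phi : R -> R, [/\ measurable_fun D phi, forall t, 0 <= phi t &
    {ae mu, forall t, D t -> N (F t) = (phi t)%:E}].
Proof.
move=> mD [s [hs sF]].
have [||g mg gF] := @ae_measurable_lim D (fun n t => fine (N (simple_eval (s n) t)))
  (fun t => fine (N (F t))) mD.
- move=> n; apply: (measurableT_comp (fine_measurable measurableT)) => //.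
  apply: (eq_measurable_fun (fun t => N (0 + simple_eval (s n) t))).
    by move=> t _; rewrite add0r.
  exact: measurable_N_simple (hs n).
- apply: (ae_imp sF) => t Ft Dt.
  by have [] := cvg_N_fine (fun n => N_simple_eval_lty t (hs n)) (Ft Dt).
- exists (fun t => `|g t|); split => //; first exact: measurableT_comp.
  apply: (ae_imp2 sF gF) => t Ft Fg Dt; rewrite -Fg//.
  have [Nx _] := cvg_N_fine (fun n => N_simple_eval_lty t (hs n)) (Ft Dt).
  by rewrite ger0_norm ?fine_ge0// fineK// ge0_fin_numE.
Qed.

Lemma bounded_functional0 (l : X -> R) : bounded_functional l -> l 0 = 0.
Proof.
move=> [ll _]; have N0' : (N 0 < +oo)%E by rewrite N0.
by have := ll 1 0 0 N0' N0'; rewrite scale1r addr0; lra.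
Qed.

Lemma bounded_functionalB (l : X -> R) (x y : X) : bounded_functional l ->
  (N x < +oo)%E -> (N y < +oo)%E -> l (x - y) = l x - l y.
Proof.
move=> [ll _] Nx Ny; have := ll (-1) y x Ny Nx.
by rewrite scaleN1r addrC => ->; rewrite mulN1r addrC.
Qed.

Lemma simple_int_functional (D : set R) (s : simple_fun X) (l : X -> R) : measurable D ->
  bounded_functional l -> is_simple N D s ->
  rintegrable D (fun t => l (simple_eval s t)) /\
  l (simple_int s) = \int[mu]_(t in D) l (simple_eval s t).
Proof.
move=> mD bl; have [ll lb] := bl; elim: s => [_|e s IH /is_simple_cons[[me eD mue Ne] hs]].
  split.
    apply: (@eq_rintegrable _ _ (fun=> 0)) => // [t _|].
      by rewrite simple_eval_nil bounded_functional0.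
    by rewrite /rintegrable (_ : EFin \o _ = cst 0%E)//; exact: integrable0.
  rewrite /simple_int big_nil bounded_functional0// rint_eq0// => t _.
  by rewrite simple_eval_nil bounded_functional0.
have [is_ E] := IH hs.
have ev t : l (simple_eval (e :: s) t) = l e.2 * \1_(e.1) t + l (simple_eval s t).
  by rewrite simple_eval_cons ll// 1?mulrC//; exact: N_simple_eval_lty hs.
have eDE : e.1 `&` D = e.1 by apply/setIidPl.
have i1 : rintegrable D (\1_(e.1) : R -> R).
  apply: rintegrableP; first exact: measurable_indic.
  under eq_integral do rewrite ger0_norm ?indic_ge0//.
  by rewrite (@integral_indic _ (measurableTypeR R) R mu D mD _ me) eDE.
have i2 := rintegrableZl (l e.2) mD i1.
split; first exact: (eq_rintegrable mD (fun t _ => esym (ev t)) (rintegrableD mD i2 is_)).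
rewrite (eq_rint (fun t _ => ev t)) rintD// -E rintZl//.
rewrite /simple_int big_cons ll//; last exact: N_simple_int_lty hs.
by rewrite mulrC; congr (_ * _ + _); rewrite /Rintegral (@integral_indic _ (measurableTypeR R) R mu D mD _ me) eDE.
Qed.

(** The sets of a simple function may overlap, so a termwise triangle inequality is too weak;
    functionals reduce the claim to scalar integrals. *)
Lemma N_simple_int_le (D : set R) (s : simple_fun X) : measurable D -> is_simple N D s ->
  (N (simple_int s) <= \int[mu]_(t in D) N (simple_eval s t))%E.
Proof.
move=> mD hs.
have I0 : (0 <= \int[mu]_(t in D) N (simple_eval s t))%E by exact: integral_ge0.
have [Ioo|] := ltP (\int[mu]_(t in D) N (simple_eval s t))%E +oo%E; last first.
  by rewrite leye_eq => /eqP ->; exact: leey.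
have fI : (\int[mu]_(t in D) N (simple_eval s t))%E \is a fin_num by rewrite ge0_fin_numE.
rewrite -(fineK fI); apply: N_norming; [exact: N_simple_int_lty hs|exact: fine_ge0|].
move=> l bl; have [il ->] := simple_int_functional mD bl hs.
apply: le_trans (le_norm_rint mD il) _; rewrite -lee_fin [leRHS]fineK//.
rewrite (EFin_Rintegral_ge0 (rintegrable_norm mD il))//.
apply: ae_le_integral_nomeas.
- by move=> t _; rewrite lee_fin.
- by [].
- by apply: aeW => t _; have [_ lb] := bl; apply: lb; exact: N_simple_eval_lty hs.
Qed.

(** Domination by [Phi] makes the integrated errors tend to 0; by [N_simple_int_le] the integrals of
    the approximants are then Cauchy. *)
Lemma bochner_exists (D : set R) (G : R -> X) (s : nat -> simple_fun X) (Phi : R -> R) :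
  measurable D -> (forall n, is_simple N D (s n)) ->
  {ae mu, forall t, D t -> (fun n => N (G t - simple_eval (s n) t)) @ \oo --> 0%E} ->
  rintegrable D Phi ->
  {ae mu, forall t, D t -> forall n, (N (G t - simple_eval (s n) t)%R <= (Phi t)%:E)%E} ->
  exists x, is_bochner_int N D G x.
Proof.
move=> mD hs sG iP GP.
have smG n : strongly_measurable N D (fun t => G t - simple_eval (s n) t).
  exists (fun m => s m ++ simple_opp (s n)); split; first by move=> m; exact: is_simpleB.
  apply: (ae_imp sG) => t Gt Dt.
  under eq_fun do rewrite simple_evalB opprB addrA subrK.
  exact: Gt.
have /boolp.choice[psi psiP] := fun n => strongly_measurable_N mD (smG n).
have mpsi n : measurable_fun D (psi n) by have [] := psiP n.
have psi0 n t : 0 <= psi n t by have [_ ->] := psiP n.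
have psiE : {ae mu, forall t, D t -> forall n, N (G t - simple_eval (s n) t) = (psi n t)%:E}.
  have : {ae mu, forall t, forall n, D t -> N (G t - simple_eval (s n) t) = (psi n t)%:E}.
    by apply/ae_foralln => n; have [_ _] := psiP n.
  by move=> /ae_imp; apply => t H Dt n; exact: H.
(* The minimum is dominated everywhere, whereas [psi n] is so only almost everywhere. *)
pose g n t := Num.min (psi n t) `|Phi t|.
have gE : {ae mu, forall t, D t -> forall n, N (G t - simple_eval (s n) t) = (g n t)%:E}.
  apply: (ae_imp2 psiE GP) => t H1 H2 Dt n; rewrite H1//; congr _%:E.
  rewrite /g minEle ifT//; have := H2 Dt n; rewrite H1// lee_fin => /le_trans; apply.
  exact: ler_norm.
have g0 n t : 0 <= g n t by rewrite le_min psi0 normr_ge0.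
have mg n : measurable_fun D (g n).
  apply: measurable_minr => //; apply: measurableT_comp => //.
  exact: rintegrable_measurable.
have [||||_ Icv] := @rint_dominated R D g (fun=> 0) (fun t => `|Phi t|) mD mg.
- exact: measurable_cst.
- exact: rintegrable_norm.
- by move=> n t _; rewrite ger0_norm// ge_min lexx orbT.
- apply: (ae_imp2 sG gE) => t H1 H2 Dt; have := H1 Dt.
  by under eq_fun do rewrite H2//; move=> /fine_cvgP[].
have ig n : rintegrable D (g n).
  apply: rintegrable_le mD (mg n) (rintegrable_norm mD iP) _ => t _.
  by rewrite ger0_norm// ge_min lexx orbT.
move: Icv; rewrite rint_eq0// => Icv.
have NI n : (\int[mu]_(t in D) N (G t - simple_eval (s n) t)%R = (\int[mu]_(t in D) g n t)%:E)%E.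
  rewrite (EFin_Rintegral_ge0 (ig n))//.
  by apply: ae_eq_integral_nomeas; apply: (ae_imp gE) => t H Dt; exact: H.
(* A subsequence with errors at most [2^-n / 4], so that consecutive integrals differ by at most
   [2^-n], as [N_complete] demands. *)
have /boolp.choice[k kP] n : exists k, (n <= k)%N /\ \int[mu]_(t in D) g k t <= 2^-1 ^+ n / 4.
  have e0 : (0 : R) < 2^-1 ^+ n / 4 by rewrite divr_gt0// exprn_gt0.
  have /cvgrPdist_le/(_ _ e0)[M _ HM] := Icv.
  exists (maxn n M); split; first exact: leq_maxl.
  by have := HM (maxn n M) (leq_maxr _ _); rewrite /= sub0r normrN; exact: le_trans (ler_norm _).
have NS n m : (N (simple_int (s n) - simple_int (s m))%R <=
    (\int[mu]_(t in D) g n t + \int[mu]_(t in D) g m t)%:E)%E.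
  rewrite -simple_intB; apply: le_trans (N_simple_int_le mD (is_simpleB (hs n) (hs m))) _.
  rewrite -rintD// (EFin_Rintegral_ge0 (rintegrableD mD (ig n) (ig m))); last first.
    by move=> t; rewrite addr_ge0.
  apply: ae_le_integral_nomeas => [//|t _|]; first by rewrite lee_fin addr_ge0.
  apply: (ae_imp gE) => t H Dt; rewrite simple_evalB EFinD -!H// NBC.
  by rewrite addeC NBC (le_trans (NB_trans _ (G t) _))// addeC (NBC (simple_eval (s n) t)) addeC.
have [|n|y [Ny yc]] := @N_complete (fun n => simple_int (s (k n))).
- by move=> n; exact: N_simple_int_lty (hs _).
- apply: le_trans (NS _ _) _; rewrite lee_fin.
  have [_ h1] := kP n.+1; have [_ h2] := kP n.
  have e0 : (0 : R) < 2^-1 ^+ n by rewrite exprn_gt0.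
  by rewrite exprS in h1; lra.
have kinf (P : set nat) : (\forall n \near \oo, P n) -> \forall n \near \oo, P (k n).
  move=> [M _ HM]; exists M => // n /= Mn; apply: HM => /=.
  by have [nk _] := kP n; exact: leq_trans Mn nk.
exists y; split => //; exists (fun n => s (k n)); split => //.
- apply: (ae_imp sG) => t Gt Dt P /(Gt Dt) H; exact: (kinf (fun n => P (N (G t - simple_eval (s n) t)))).
- have : (\int[mu]_(t in D) N (G t - simple_eval (s n) t)%R)%E @[n --> \oo] --> 0%E.
    by under eq_fun do rewrite NI; apply: cvg_EFin => //; exact: nearW.
  move=> c P /c H; exact: (kinf (fun n => P (\int[mu]_(t in D) N (G t - simple_eval (s n) t)%R)%E)).
Qed.

Lemma functional_ae_measurable (D : set R) (F : R -> X) (l : X -> R) : measurable D ->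
  bounded_functional l -> strongly_measurable N D F ->
  exists2 g, measurable_fun D g & {ae mu, forall t, D t -> l (F t) = g t}.
Proof.
move=> mD bl [s [hs sF]].
apply: (@ae_measurable_lim D (fun n t => l (simple_eval (s n) t))) => //.
  by move=> n; apply: rintegrable_measurable; have [] := simple_int_functional mD bl (hs n).
apply: (ae_imp sF) => t Ft Dt.
have Ns n := N_simple_eval_lty t (hs n).
have [NF _] := cvg_N_fine Ns (Ft Dt).
apply/cvgrPdist_le => e e0.
have /ecvg0P-/(_ (fun n => N_ge0 _) e e0) := Ft Dt; apply: filterS => n Hn.
rewrite -bounded_functionalB// -lee_fin; apply: le_trans Hn.
by have [_ lb] := bl; apply: lb; exact: NB_lty.
Qed.

(** A functional is controlled by [N], so both limits defining the Bochner integral pass through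
    [l]. The scalar integrand is measurable only up to a null set, hence the representative [g]. *)
Lemma bochner_functional (D : set R) (G : R -> X) (x : X) (l : X -> R) : measurable D ->
  bounded_functional l -> is_bochner_int N D G x ->
  exists2 g, rintegrable D g &
    {ae mu, forall t, D t -> l (G t) = g t} /\ l x = \int[mu]_(t in D) g t.
Proof.
move=> mD bl [Nx [s [hs sG IG sx]]].
have [g mg gE] := functional_ae_measurable mD bl (ex_intro _ s (conj hs sG)).
have is_ n := simple_int_functional mD bl (hs n).
have I0 n : (0 <= \int[mu]_(t in D) N (G t - simple_eval (s n) t)%R)%E.
  by apply: integral_ge0.
have dle n : (\int[mu]_(t in D) `|(g t - l (simple_eval (s n) t))|%:E <=
    \int[mu]_(t in D) N (G t - simple_eval (s n) t)%R)%E.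
  apply: ae_le_integral_nomeas => //.
  apply: (ae_imp2 gE sG) => t gt sGt Dt.
  have Ns m := N_simple_eval_lty t (hs m).
  have [NG _] := cvg_N_fine Ns (sGt Dt).
  rewrite -gt// -bounded_functionalB//.
  by have [_ lb] := bl; apply: lb; exact: NB_lty.
have mls n : measurable_fun D (fun t => l (simple_eval (s n) t)).
  by have [i _] := is_ n; exact: rintegrable_measurable.
have /ecvg0P-/(_ I0) IG0 := IG.
have [n0 _ Hn0] := IG0 1 ltr01.
have id n : (n0 <= n)%N -> rintegrable D (fun t => g t - l (simple_eval (s n) t)).
  move=> n0n; apply: rintegrableP; first exact: measurable_funB.
  by apply: le_lt_trans (dle n) _; apply: le_lt_trans (Hn0 n n0n) _; exact: ltry.
have ig : rintegrable D g.
  have [i _] := is_ n0.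
  apply: (eq_rintegrable mD _ (rintegrableD mD (id n0 (leqnn _)) i)) => t _.
  by rewrite subrK.
exists g => //; split => //; apply/eqP; rewrite -subr_eq0 -normr_le0.
apply/ler_addgt0Pr => e e0; rewrite add0r.
have e20 : 0 < e / 2 by rewrite divr_gt0.
have /ecvg0P-/(_ (fun n => N_ge0 _)) sx0 := sx.
have [n1 _ Hn1] := IG0 _ e20; have [n2 _ Hn2] := sx0 _ e20.
pose n := maxn n0 (maxn n1 n2).
have [n0n n1n n2n] : [/\ (n0 <= n)%N, (n1 <= n)%N & (n2 <= n)%N].
  by rewrite /n !leq_max !leqnn !orbT.
have [i E] := is_ n.
have -> : l x - \int[mu]_(t in D) g t = l (x - simple_int (s n))
    - \int[mu]_(t in D) (g t - l (simple_eval (s n) t)).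
  rewrite bounded_functionalB//; last exact: N_simple_int_lty (hs n).
  by rewrite rintB// E; ring.
rewrite (splitr e) (le_trans (ler_normB _ _))// lerD//.
  rewrite -lee_fin; apply: le_trans (Hn2 n n2n).
  by have [_ lb] := bl; apply: lb; apply: NB_lty => //; exact: N_simple_int_lty (hs n).
apply: le_trans (le_norm_rint mD (id n n0n)) _.
rewrite -lee_fin; apply: le_trans (Hn1 n n1n); apply: le_trans (dle n).
by rewrite (EFin_Rintegral_ge0 (rintegrable_norm mD (id n n0n))).
Qed.

(** Meant for the singular weight [(t - tau) ^ (alpha - 1)]. Approximants of [F] are multiplied by
    simple functions below [w] and cut off where they are too large. *)
Lemma bochner_weighted_exists (D D0 : set R) (w phi : R -> R) (F : R -> X) :
  measurable D -> D `<=` D0 -> measurable D0 ->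
  measurable_fun D w -> (forall t, D t -> 0 <= w t) ->
  strongly_measurable N D0 F -> measurable_fun D0 phi -> (forall t, 0 <= phi t) ->
  {ae mu, forall t, D0 t -> N (F t) = (phi t)%:E} ->
  rintegrable D (fun t => w t * phi t) ->
  exists x, is_bochner_int N D (fun t => w t *: F t) x.
Proof.
move=> mD DD0 mD0 mw w0 [f [hf fF]] mphi phi0 phiE iwp.
have [h [mh hw hcv]] := nneg_simple_approx mD mw w0.
pose hv n t : R := \sum_(z <- h n) z.1 * \1_(z.2) t.
pose Nf n t := fine (N (simple_eval (f n) t)).
have Nf_lty n t := N_simple_eval_lty t (hf n).
have NfE n t : N (simple_eval (f n) t) = (Nf n t)%:E by rewrite fineK// ge0_fin_numE.
have mNf n : measurable_fun D (Nf n).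
  apply: (measurableT_comp (fine_measurable measurableT)) => //.
  apply: (eq_measurable_fun (fun t => N (0 + simple_eval (f n) t))).
    by move=> t _; rewrite add0r.
  exact: measurable_N_simple (hf n).
(* Outside [E n] the approximant exceeds [2 * phi] and is dropped. The error is then at most
   [3 * w * phi], once from [F] and twice from the approximant. *)
pose E n : set R := D `&` (fun t => 2 * phi t - Nf n t) @^-1` `[0, +oo[%classic.
have mE n : measurable (E n).
  have m : measurable_fun D (fun t => 2 * phi t - Nf n t).
    apply: measurable_funB => //; apply: measurable_funM => //.
    exact: measurable_funS mphi.
  by apply: m => //; exact: measurable_itv.
pose s n : simple_fun X := [seq (e.1 `&` (z.2 `&` E n), z.1 *: e.2) | z <- h n, e <- f n].
have hs n : is_simple N D (s n).
  move=> e /allpairsP[[z e'] [/= zh e'f ->]]; have [m1 s1 mu1 N1] := hf n e' e'f.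
  have m2 : measurable (e'.1 `&` (z.2 `&` E n)).
    by apply: measurableI => //; apply: measurableI; [exact: mh zh|exact: mE].
  split => //=.
  - by move=> t [_ [_ []]].
  - by apply: le_lt_trans mu1; apply: le_outer_measure; exact: subIsetl.
  - exact: NZ_lty.
have ev n t : simple_eval (s n) t = (hv n t * \1_(E n) t) *: simple_eval (f n) t.
  rewrite /simple_eval /s big_allpairs_dep /hv mulr_suml scaler_suml.
  apply: eq_bigr => z _; rewrite scaler_sumr; apply: eq_bigr => e _ /=.
  by rewrite !indicI/= !scalerA; congr (_ *: _); ring.
have EP n t : D t -> E n t <-> Nf n t <= 2 * phi t.
  by move=> Dt; rewrite /E /= in_itv/= andbT subr_ge0; split => [[]|].
have phiE' : {ae mu, forall t, D t -> N (F t) = (phi t)%:E}.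
  by apply: (ae_imp phiE) => t H /DD0; exact: H.
have bnd : {ae mu, forall t, D t -> forall n,
    (N (w t *: F t - simple_eval (s n) t)%R <= (3 * (w t * phi t))%:E)%E}.
  apply: (ae_imp phiE') => t H Dt n; have NF := H Dt.
  apply: le_trans (ND _ _) _; rewrite NN NZ ?NF ?ltry// (ger0_norm (w0 t Dt)) ev NZ// NfE.
  have /andP[] := hw n t Dt; rewrite -/(hv n t) => h0 h1.
  rewrite -!EFinM -EFinD lee_fin.
  have [Et|Et] := pselect (E n t); last first.
    rewrite indicE memNset// mulr0 normr0 mul0r addr0 ler_peMl ?mulr_ge0 ?w0//; lra.
  rewrite indicE mem_set// mulr1 ger0_norm//.
  have /EP-/(_ Dt) H2 := Et.
  have N0' : 0 <= Nf n t by exact: fine_ge0.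
  have := ler_pM h0 N0' h1 H2; lra.
apply: (@bochner_exists D _ s (fun t => 3 * (w t * phi t))) => //; last exact: rintegrableZl.
apply: (ae_imp2 phiE' (ae_imp2 bnd fF (fun t a b => conj a b))) => t H [B fFt] Dt.
have NF := H Dt.
apply/ecvg0P => // e e0.
(* If [phi t = 0] the domination alone makes the error 0; otherwise the norms converge to
   [phi t > 0], so [t] lies in [E n] eventually. *)
have [p0|pn] := eqVneq (phi t) 0.
  apply: nearW => n; apply: le_trans (B Dt n) _.
  by rewrite p0 !mulr0 lee_fin ltW.
have pp : 0 < phi t by rewrite lt_neqAle eq_sym pn phi0.
have fc := fFt (DD0 _ Dt).
have [_ Nfc] := cvg_N_fine (fun n => Nf_lty n t) fc.
have e1 : 0 < e / (2 * (phi t + 1)) by rewrite divr_gt0// mulr_gt0//; lra.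
have wt := w0 t Dt.
have e2 : 0 < e / (2 * (w t + 1)) by rewrite divr_gt0// mulr_gt0//; lra.
have /cvgrPdist_le/(_ _ e1) hn := hcv t Dt.
have /ecvg0P-/(_ (fun n => N_ge0 _) _ e2) fn := fc.
have /cvgrPdist_le/(_ _ pp) Nn := Nfc.
near=> n.
have hn' : `|w t - hv n t| <= e / (2 * (phi t + 1)) by near: n.
have fn' : (N (F t - simple_eval (f n) t)%R <= (e / (2 * (w t + 1)))%:E)%E by near: n.
have Nn' : `|fine (N (F t)) - fine (N (simple_eval (f n) t))| <= phi t by near: n.
have Et : E n t.
  by apply/EP => //; move: Nn'; rewrite NF /= -/(Nf n t) ler_norml; lra.
rewrite ev indicE mem_set// mulr1.
have -> : w t *: F t - hv n t *: simple_eval (f n) t =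
   (w t - hv n t) *: F t + hv n t *: (F t - simple_eval (f n) t).
  by rewrite scalerBl scalerBr addrA subrK.
have /andP[] := hw n t Dt; rewrite -/(hv n t) => h0 h1.
have NFf : (N (F t - simple_eval (f n) t)%R < +oo)%E by apply: NB_lty => //; rewrite NF ltry.
apply: le_trans (ND _ _) _; rewrite NZ ?NF ?ltry// NZ// (ger0_norm h0).
apply: (@le_trans _ _ ((e / (2 * (phi t + 1)) * phi t)%:E + (w t * (e / (2 * (w t + 1))))%:E)%E).
  apply: leeD; first by rewrite -EFinM lee_fin ler_wpM2r.
  rewrite EFinM; apply: lee_pmul => //; rewrite ?lee_fin//.
have half (k : R) : 0 <= k -> e / (2 * (k + 1)) * k <= e / 2.
  move=> k0; have k1 : k + 1 != 0 by rewrite gt_eqF//; lra.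
  have -> : e / (2 * (k + 1)) * k = e / 2 * (k / (k + 1)) by field.
  rewrite ler_piMr ?divr_ge0 ?(ltW e0)// ler_pdivrMr ?mul1r; lra.
by rewrite -EFinD lee_fin [leRHS]splitr lerD ?half// mulrC half.
Unshelve. all: by end_near. Qed.

Variable alpha : R.
Hypothesis alpha01 : 0 < alpha < 1.

Lemma L2_valued_norm (T : R) (F : R -> X) : L2_valued N T F ->
  exists phi : R -> R, [/\ rintegrable `]0, T[ phi, forall t, 0 <= phi t &
    {ae mu, forall t, t \in `]0, T[ -> N (F t) = (phi t)%:E}].
Proof.
have mT : measurable (`]0, T[%classic : set R) by exact: measurable_itv.
move=> [sF F2]; have [phi [mphi phi0 phiE]] := strongly_measurable_N mT sF.
exists phi; split => //.
have i2 : rintegrable `]0, T[ (fun t => phi t ^+ 2).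
  apply: rintegrableP; first exact: measurable_funX.
  apply: le_lt_trans F2; apply: ae_le_integral_nomeas.
  - by move=> t _; rewrite lee_fin.
  - by move=> t _; apply: mule_ge0.
  - by apply: (ae_imp phiE) => t H Dt; rewrite H// -EFinM -expr2 ger0_norm// sqr_ge0.
have i1 : rintegrable `]0, T[ (fun=> 1).
  apply: rintegrableP => //; rewrite integral_cst//= lebesgue_measure_itv/=.
  by case: ifPn => _; rewrite ?mule0// normr1 mul1e -EFinD ltry.
apply: (rintegrable_le mT mphi (rintegrableD mT i1 i2)) => t _.
rewrite ger0_norm// -subr_ge0.
have -> : 1 + phi t ^+ 2 - phi t = ((phi t - 1) ^+ 2 + phi t ^+ 2 + 1) / 2 by field.
by rewrite divr_ge0// !addr_ge0// sqr_ge0.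
Qed.

Lemma L2_valued_functional (T : R) (F : R -> X) (l : X -> R) :
  bounded_functional l -> L2_valued N T F ->
  exists2 U, rintegrable `]0, T[ U & {ae mu, forall t, t \in `]0, T[ -> l (F t) = U t}.
Proof.
have mT : measurable (`]0, T[%classic : set R) by exact: measurable_itv.
move=> bl FL; have [phi [iphi phi0 phiE]] := L2_valued_norm FL.
have [sF _] := FL; have [g mg gE] := functional_ae_measurable mT bl sF.
exists g => //; apply: rintegrableP => //.
apply: le_lt_trans (rintegrable_lty iphi); apply: ae_le_integral_nomeas.
- by move=> t _; rewrite lee_fin.
- by move=> t _; rewrite lee_fin.
- apply: (ae_imp2 gE phiE) => t H1 H2 Dt; rewrite -H1// (ger0_norm (phi0 t)) -H2//.
  by have [_ lb] := bl; apply: lb; rewrite H2// ltry.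
Qed.

(** One null set of times serves all functionals: it comes from the times at which the weighted
    integral of [phi] is infinite. Elsewhere the Bochner integral exists and every functional
    commutes with it. *)
Lemma RL_integral_functional (T : R) (F : R -> X) : L2_valued N T F ->
  {ae mu, forall t, t \in `]0, T[ ->
    (N (RL_integral N alpha F t) < +oo)%E /\
    forall l, bounded_functional l ->
      l (RL_integral N alpha F t) = RLreal alpha (fun tau => l (F tau)) t}.
Proof.
move=> FL; have [phi [iphi phi0 phiE]] := L2_valued_norm FL.
have mT : measurable (`]0, T[%classic : set R) by exact: measurable_itv.
have mphi := rintegrable_measurable iphi.
have phioo : (\int[mu]_(t in `]0%R, T[) (phi t)%:E < +oo)%E.
  apply: le_lt_trans (rintegrable_lty iphi).
  apply: ae_le_integral_nomeas => [t _|t _|]; rewrite ?lee_fin//.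
  by apply: aeW => t _; rewrite lee_fin ler_norm.
have mEphi : measurable_fun `]0, T[ (EFin \o phi) by exact/measurable_EFinP.
have Ephi0 t : (0 <= (EFin \o phi) t)%E by rewrite lee_fin.
apply: (ae_imp (ae_RL_lty alpha01 mEphi Ephi0 phioo)) => t Ht tT.
have /andP[t0 tT'] : 0 < t < T by move: tT; rewrite in_itv.
have mt : measurable (`]0, t[%classic : set R) by exact: measurable_itv.
have tsub : (`]0, t[%classic : set R) `<=` `]0, T[%classic.
  by apply: subset_itvl; rewrite bnd_simp ltW.
pose w (tau : R) : R := (t - tau) `^ (alpha - 1).
have mw : measurable_fun `]0, t[ w.
  apply: (measurableT_comp (measurable_powR _)).
  by apply: measurable_funB.
have w0 tau : (`]0, t[%classic : set R) tau -> 0 <= w tau by move=> _; exact: powR_ge0.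
have iw : rintegrable `]0, t[ (fun tau => w tau * phi tau).
  apply: rintegrableP.
    by apply: measurable_funM => //; exact: measurable_funS mphi.
  apply: le_lt_trans (Ht tT); apply: ae_le_integral_nomeas => [tau _|tau _|].
  - by rewrite lee_fin.
  - by rewrite mule_ge0// lee_fin powR_ge0.
  - by apply: aeW => tau _; rewrite -EFinM lee_fin ger0_norm// mulr_ge0// powR_ge0.
have [sF _] := FL.
have [x0 xP0] := bochner_weighted_exists mt tsub mT mw w0 sF mphi phi0 phiE iw.
have xP : is_bochner_int N `]0, t[ (fun tau => w tau *: F tau)
    (bochner_int N `]0, t[ (fun tau => w tau *: F tau)).
  by apply: (@xgetPex _ 0 [set x | is_bochner_int N `]0, t[ (fun tau => w tau *: F tau) x]); exists x0.
set x := bochner_int _ _ _ in xP.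
have Nx : (N x < +oo)%E by case: xP.
split; first by rewrite /RL_integral; exact: NZ_lty.
move=> l bl; have [g ig [gE lx]] := bochner_functional mt bl xP.
rewrite /RL_integral /RLreal -/x.
have [ll _] := bl; have N0' : (N 0 < +oo)%E by rewrite N0.
have lZ c y : (N y < +oo)%E -> l (c *: y) = c * l y.
  by move=> Ny; rewrite -[c *: y]addr0 ll// bounded_functional0// addr0.
rewrite lZ// lx; congr (_ * _); apply: ae_eq_Rintegral.
apply: (ae_imp2 gE phiE) => tau H1 H2 Dt.
by rewrite -H1// lZ// H2 ?ltry//; exact: tsub.
Qed.

End Bochner.

(** * Completeness and norming functionals in [L^2], [H^1] and [H^-1] *)

Section SobolevInstances.
Context (R : realType).
Local Notation mu := (@lebesgue_measure R).
Local Notation I01 := (`]0, 1[%classic : set R).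

Let mI : measurable I01. Proof. exact: measurable_itv. Qed.

Definition l2nrm (f : R -> R) : R := h1nrm f (fun=> 0).

Lemma l2nrmE (f : R -> R) : l2nrm f = Num.sqrt (\int[mu]_(x in I01) (f x ^+ 2)).
Proof.
by rewrite /l2nrm /h1nrm [X in _ + X]rint_eq0 ?addr0// => x _; rewrite expr0n.
Qed.

Lemma l2nrm_ge0 (f : R -> R) : 0 <= l2nrm f.
Proof. exact: h1nrm_ge0. Qed.

Lemma l2nrm_CS (f g : R -> R) : in_L2 f -> in_L2 g ->
  `|\int[mu]_(x in I01) (f x * g x)| <= l2nrm f * l2nrm g.
Proof.
move=> fL gL; have := h1nrm_CS fL (in_L2_0 R) gL (in_L2_0 R).
by rewrite [X in _ + X]rint_eq0 ?addr0// => x _; rewrite mul0r.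
Qed.

Lemma l2nrm_triangle (f g : R -> R) : in_L2 f -> in_L2 g ->
  l2nrm (fun x => g x + f x) <= l2nrm f + l2nrm g.
Proof.
move=> fL gL; have := h1nrm_triangle fL (in_L2_0 R) gL (in_L2_0 R).
by rewrite (_ : (fun x : R => 0 + 0) = fun=> 0)//; apply/funext => x; rewrite addr0.
Qed.

Lemma l2nrm_le_h1nrm (f f' : R -> R) : l2nrm f <= h1nrm f f' /\ l2nrm f' <= h1nrm f f'.
Proof.
rewrite !l2nrmE /h1nrm; split; rewrite ler_wsqrtr//.
  by rewrite lerDl int_sqr_ge0.
by rewrite lerDr int_sqr_ge0.
Qed.

Lemma l2nrm1 : l2nrm (fun=> 1) = 1.
Proof.
rewrite l2nrmE (eq_rint (g := fun=> 1)) ?rint_cst01 ?sqrtr1// => x _.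
by rewrite expr1n.
Qed.

Lemma in_L2B (f g : R -> R) : in_L2 f -> in_L2 g -> in_L2 (fun x => f x - g x).
Proof.
move=> fL gL; have := in_L2_lin (-1) gL fL.
by apply: eq_in_L2 => x _; rewrite mulN1r addrC.
Qed.

Lemma in_L2_norm (f : R -> R) : in_L2 f -> in_L2 (fun x => `|f x|).
Proof.
move=> /in_L2P[mf f2]; apply/in_L2P; split; first exact: measurableT_comp.
by apply: eq_rintegrable f2 => // x _; rewrite real_normK ?num_real.
Qed.

Lemma l2nrm_norm (f : R -> R) : l2nrm (fun x => `|f x|) = l2nrm f.
Proof.
by rewrite !l2nrmE; congr Num.sqrt; apply: eq_rint => x _; rewrite real_normK ?num_real.
Qed.

Lemma geometric_sum_le (n k : nat) : \sum_(n <= i < n + k) (2^-1 : R) ^+ i <= 2 * 2^-1 ^+ n.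
Proof.
suff -> : \sum_(n <= i < n + k) (2^-1 : R) ^+ i = 2 * (2^-1 ^+ n - 2^-1 ^+ (n + k)).
  by rewrite ler_wpM2l// gerBl exprn_ge0.
elim: k => [|k IH]; first by rewrite addn0 big_geq// subrr mulr0.
rewrite addnS big_nat_recr ?leq_addr//= IH exprS; move: (2^-1 ^+ (n + k)) => z.
by field.
Qed.

(** Riesz-Fischer: the increments have summable [L^1] norms, so the series of their moduli is finite
    almost everywhere and [f n] converges there. Fatou's lemma turns this into the rate in [L^2]. *)
Lemma L2_complete (f : nat -> R -> R) : (forall n, in_L2 (f n)) ->
  (forall n, l2nrm (fun x => f n.+1 x - f n x) <= 2^-1 ^+ n) ->
  exists g, in_L2 g /\ forall n, l2nrm (fun x => g x - f n x) <= 2 * 2^-1 ^+ n.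
Proof.
move=> fL fd.
pose d n x := `|f n.+1 x - f n x|.
have dL n : in_L2 (d n) by apply: in_L2_norm; exact: in_L2B.
have mf n := in_L2_measurable (fL n).
have md n := in_L2_measurable (dL n).
have d0 n x : 0 <= d n x by exact: normr_ge0.
have id n : \int[mu]_(x in I01) d n x <= 2^-1 ^+ n.
  rewrite (eq_rint (g := fun x => d n x * 1)); last by move=> x _; rewrite mulr1.
  apply: le_trans (ler_norm _) _.
  apply: le_trans (l2nrm_CS (dL n) (bm01_in_L2 (bm01_cst 1))) _.
  by rewrite l2nrm1 mulr1 l2nrm_norm.
have mEd n : measurable_fun I01 (EFin \o d n) by exact/measurable_EFinP.
pose G x := (\sum_(0 <= n <oo) (d n x)%:E)%E.
have mG : measurable_fun I01 G.
  apply: (@ge0_emeasurable_sum _ (measurableTypeR R) R I01 (fun n x => (d n x)%:E) xpredT).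
    by move=> k x _ _; rewrite lee_fin.
  by move=> k _; exact: mEd.
have G0 x : (0 <= G x)%E by apply: nneseries_ge0 => k _ _; rewrite lee_fin.
have iG : mu.-integrable I01 G.
  apply/integrableP; split => //.
  under eq_integral do rewrite gee0_abs//.
  rewrite (@integral_nneseries _ _ _ mu I01 mI (fun n => EFin \o d n) mEd); last first.
    by move=> k x _; rewrite lee_fin.
  apply: (@le_lt_trans _ _ 2%:E); last exact: ltry.
  apply: lime_le; first by apply: is_cvg_nneseries => k _ _; apply: integral_ge0 => x _; rewrite lee_fin.
  apply: nearW => n.
  under eq_bigr do rewrite -(EFin_Rintegral_ge0 (in_L2_rintegrable (dL _)) (d0 _)).
  rewrite sumEFin lee_fin.
  have := geometric_sum_le 0 n; rewrite add0n expr0 mulr1; apply: le_trans.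
  by apply: ler_sum => k _.
have fcv : {ae mu, forall x, I01 x -> f n x @[n --> \oo] --> limn (fun n => f n x)}.
  have Gae : {ae mu, forall x, I01 x -> G x \is a fin_num} := @integrable_ae _ _ _ mu I01 mI G iG.
  apply: (ae_imp Gae) => x Gx Ix.
  have cv : cvgn (series (fun n => f n.+1 x - f n x)).
    apply: normed_cvg; apply: nondecreasing_is_cvgn.
      apply/nondecreasing_seqP => n; rewrite [X in X <= _]/series [X in _ <= X]/series/=.
      by rewrite big_nat_recr//= lerDl d0.
    exists (fine (G x)) => _ [n _ <-]; rewrite -lee_fin fineK ?Gx// /series/= -sumEFin.
    by apply: nneseries_lim_ge => k _; rewrite lee_fin.
  have E : (fun n => f n x) = (fun n => f 0%N x + series (fun n => f n.+1 x - f n x) n).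
    by apply/funext => n; rewrite /series/= telescope_sumr// addrC subrK.
  have : cvgn (fun n => f n x) by rewrite E; apply: is_cvgD => //; exact: is_cvg_cst.
  exact.
have [g mg gE] := ae_measurable_lim mI mf fcv.
have gcv : {ae mu, forall x, I01 x -> f n x @[n --> \oo] --> g x}.
  by apply: (ae_imp2 fcv gE) => x H1 H2 Ix; rewrite -H2//; exact: H1.
have fdist n m : l2nrm (fun x => f (n + m)%N x - f n x) <= 2 * 2^-1 ^+ n.
  apply: le_trans (geometric_sum_le n m); elim: m => [|m IH].
    rewrite addn0 big_geq// l2nrmE rint_eq0 ?sqrtr0// => x _.
    by rewrite subrr expr0n.
  rewrite addnS big_nat_recr ?leq_addr//=.
  apply: le_trans (lerD IH (fd _)).
  rewrite (_ : (fun x => _) = fun x => (f (n + m).+1 x - f (n + m)%N x) + (f (n + m)%N x - f n x)).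
    by apply: l2nrm_triangle; exact: in_L2B.
  by apply/funext => x; rewrite addrA subrK.
have key n : (\int[mu]_(x in I01) ((g x - f n x) ^+ 2)%:E <= ((2 * 2^-1 ^+ n) ^+ 2)%:E)%E.
  pose h m x := ((f (n + m)%N x - f n x) ^+ 2)%:E.
  have mh m : measurable_fun I01 (h m).
    by apply/measurable_EFinP; apply: measurable_funX; exact: measurable_funB.
  have h0 m x : I01 x -> (0 <= h m x)%E by move=> _; rewrite lee_fin sqr_ge0.
  apply: (@le_trans _ _ (\int[mu]_(x in I01) limn_einf (h ^~ x))%E).
    rewrite le_eqVlt; apply/orP; left; apply/eqP; apply: ae_eq_integral_nomeas.
    apply: (ae_imp gcv) => x gx Ix.
    rewrite (cvg_limn_einf_sup (l := ((g x - f n x) ^+ 2)%:E))//.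
    apply: cvg_EFin; first exact: nearW.
    have c1 : f (m + n)%N x - f n x @[m --> \oo] --> g x - f n x.
      apply: cvgB; last exact: cvg_cst.
      by rewrite (cvg_shiftn n (fun m => f m x)); exact: gx.
    rewrite /= /h /comp/= expr2; under eq_fun do rewrite addnC expr2.
    exact: (cvgM c1 c1).
  apply: le_trans (@fatou _ _ _ mu I01 mI h mh h0) _.
  rewrite limn_einf_lim; apply: lime_le; first exact: is_cvg_einfs.
  apply: nearW => m; apply: (@le_trans _ _ (\int[mu]_(x in I01) h m x)%E).
    by apply: ereal_inf_lbound; exists m => //=.
  have iL := in_L2_sqr (in_L2B (fL (n + m)%N) (fL n)).
  rewrite -(EFin_Rintegral_ge0 iL)//; last by move=> x; rewrite sqr_ge0.
  rewrite lee_fin -[leLHS]sqr_sqrtr ?int_sqr_ge0// -l2nrmE.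
  by apply: lerXn2r; rewrite ?nnegrE ?l2nrm_ge0// mulr_ge0// exprn_ge0.
have gfL n : in_L2 (fun x => g x - f n x).
  apply/in_L2P; split; first exact: measurable_funB.
  apply: rintegrableP; first by apply: measurable_funX; exact: measurable_funB.
  under eq_integral do rewrite ger0_norm ?sqr_ge0//.
  by apply: le_lt_trans (key n) _; exact: ltry.
exists g; split.
  have := in_L2_lin 1 (gfL 0%N) (fL 0%N).
  by apply: eq_in_L2 => x _; rewrite mul1r subrK.
move=> n; rewrite l2nrmE.
have e0 : 0 <= 2 * 2^-1 ^+ n :> R by rewrite mulr_ge0// exprn_ge0.
rewrite -[leRHS](ger0_norm e0) -sqrtr_sqr ler_wsqrtr// -lee_fin.
by rewrite (EFin_Rintegral_ge0 (in_L2_sqr (gfL n)))// => x; exact: sqr_ge0.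
Qed.

Lemma H1norm0 : H1norm (0 : R -> R^o) = 0%E.
Proof.
rewrite (@H1norm_weak _ _ (fun=> 0) (in_L2_0 R) (in_L2_0 R) (@is_weak_deriv0 R)).
by rewrite /h1nrm !rint_eq0 ?addr0 ?sqrtr0// => x _; exact: expr0n.
Qed.

(** The norm is attained by the [H^1] inner product with [y], divided by the norm of [y]. *)
Lemma H1norm_norming (y : R -> R^o) (r : R) : (H1norm y < +oo)%E -> 0 <= r ->
  (forall l, bounded_functional (@H1norm R) l -> `|l y| <= r) -> (H1norm y <= r%:E)%E.
Proof.
move=> /H1norm_lty yH r0 lr; have [yL _] := yH; have [dL dy] := weak_derivP yH.
rewrite (H1norm_fin yH) lee_fin; set n := h1nrm _ _.
have [->//|nn] := eqVneq n 0.
have n0 : 0 < n by rewrite lt_neqAle eq_sym nn h1nrm_ge0.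
pose ip (z : R -> R) := \int[mu]_(x in I01) (z x * y x)
  + \int[mu]_(x in I01) (weak_deriv z x * weak_deriv y x).
have ipn : ip y = n ^+ 2.
  by rewrite /n /h1nrm sqr_sqrtr// addr_ge0// int_sqr_ge0.
have := lr (fun z => ip z / n); rewrite ipn expr2 mulfK// (gtr0_norm n0); apply.
split.
- move=> c z w /H1norm_lty zH /H1norm_lty wH; rewrite mulrA -mulrDl; congr (_ / _).
  have [zL _] := zH; have [wL _] := wH.
  have [dzL dz] := weak_derivP zH; have [dwL dw] := weak_derivP wH.
  have [cH dc] := in_H1_lin c zH wH; have [dcL dc'] := weak_derivP cH.
  have E (h k q : R -> R) : in_L2 h -> in_L2 k -> in_L2 q ->
     \int[mu]_(x in I01) ((c * h x + k x) * q x) =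
     c * \int[mu]_(x in I01) (h x * q x) + \int[mu]_(x in I01) (k x * q x).
    move=> hL kL qL; have i1 := in_L2M hL qL; have i2 := in_L2M kL qL.
    rewrite -(rintZl c mI i1) -(rintD mI (rintegrableZl c mI i1) i2).
    by apply: eq_rint => x _; rewrite mulrDl mulrA.
  rewrite /ip (E z w y zL wL yL).
  have -> : \int[mu]_(x in I01) (weak_deriv (c *: z + w)%R x * weak_deriv y x) =
     \int[mu]_(x in I01) ((c * weak_deriv z x + weak_deriv w x) * weak_deriv y x).
    apply: ae_eq_rint01.
    apply: (ae_imp (weak_deriv_ae_unique _ _ dc' dc)) => [||x H Ix].
    + exact: in_L2_rintegrable.
    + by apply: in_L2_rintegrable; exact: in_L2_lin.
    + by rewrite -H.
  by rewrite (E _ _ _ dzL dwL dL) mulrDr addrACA.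
- move=> z /H1norm_lty zH; have [zL _] := zH; have [dzL dz] := weak_derivP zH.
  rewrite (H1norm_fin zH) lee_fin normrM normfV (gtr0_norm n0) ler_pdivrMr//.
  exact: h1nrm_CS.
Qed.

(** Functions and weak derivatives converge separately in [L^2], and the identity defining a weak
    derivative is continuous in both. *)
Lemma H1norm_complete (x : nat -> R -> R^o) : (forall n, (H1norm (x n) < +oo)%E) ->
  (forall n, (H1norm (x n.+1 - x n)%R <= (2^-1 ^+ n)%:E)%E) ->
  exists y, (H1norm y < +oo)%E /\ (fun n => H1norm (y - x n)) @ \oo --> 0%E.
Proof.
move=> xH xd.
have {}xH n : in_H1 (x n) by apply/H1norm_lty.
have xL n : in_L2 (x n) by case: (xH n).
pose x' n := weak_deriv (x n).
have x'L n : in_L2 (x' n) by have [] := weak_derivP (xH n).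
have xx' n : is_weak_deriv (x n) (x' n) by have [] := weak_derivP (xH n).
have dB (f f' g g' : R -> R) : in_L2 f -> in_L2 f' -> in_L2 g -> in_L2 g' ->
    is_weak_deriv f f' -> is_weak_deriv g g' ->
    is_weak_deriv (fun t => f t - g t) (fun t => f' t - g' t).
  move=> fL f'L gL g'L df dg.
  have := is_weak_deriv_lin (-1) gL g'L fL f'L dg df.
  rewrite (_ : (fun t => -1 * g t + f t) = fun t => f t - g t); last first.
    by apply/funext => t; rewrite mulN1r addrC.
  rewrite (_ : (fun t => -1 * g' t + f' t) = fun t => f' t - g' t)//.
  by apply/funext => t; rewrite mulN1r addrC.
have dn n : h1nrm (fun t => x n.+1 t - x n t) (fun t => x' n.+1 t - x' n t) <= 2^-1 ^+ n.
  have := xd n; rewrite (@H1norm_weak _ _ (fun t => x' n.+1 t - x' n t))//.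
  - exact: (in_L2B (xL n.+1) (xL n)).
  - exact: in_L2B.
  - exact: (@dB (x n.+1) _ (x n)).
have [g [gL gx]] := L2_complete xL (fun n => le_trans (l2nrm_le_h1nrm _ _).1 (dn n)).
have [g' [g'L gx']] := L2_complete x'L (fun n => le_trans (l2nrm_le_h1nrm _ _).2 (dn n)).
have c0 (K : R) : K * (2 * 2^-1 ^+ n) @[n --> \oo] --> (0 : R).
  rewrite -[X in _ --> X](mulr0 K); apply: cvgM; first exact: cvg_cst.
  rewrite -[X in _ --> X](mulr0 2); apply: cvgM; first exact: cvg_cst.
  by apply: cvg_expr; rewrite ger0_norm; lra.
have gg' : is_weak_deriv g g'.
  move=> phi tphi; have pL := test_fun_in_L2 tphi.
  have p'L := test_fun_in_L2 (test_fun_derive1 tphi).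
  apply/eqP; rewrite -subr_eq0 opprK -normr_le0; apply/ler_addgt0Pr => e e0; rewrite add0r.
  have /cvgrPdist_le/(_ _ e0)[n _ Hn] := c0 (l2nrm (derive1 phi) + l2nrm phi).
  have := Hn n (leqnn n); rewrite /= sub0r normrN ger0_norm; last first.
    by rewrite !mulr_ge0 ?addr_ge0 ?l2nrm_ge0// exprn_ge0.
  apply: le_trans.
  have E : \int[mu]_(t in I01) (g t * derive1 phi t) + \int[mu]_(t in I01) (g' t * phi t) =
     \int[mu]_(t in I01) ((g t - x n t) * derive1 phi t) +
     \int[mu]_(t in I01) ((g' t - x' n t) * phi t).
    have B (h k q : R -> R) : in_L2 h -> in_L2 k -> in_L2 q ->
       \int[mu]_(t in I01) ((h t - k t) * q t) =
       \int[mu]_(t in I01) (h t * q t) - \int[mu]_(t in I01) (k t * q t).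
      move=> hL kL qL; rewrite -(rintB mI (in_L2M hL qL) (in_L2M kL qL)).
      by apply: eq_rint => t _; rewrite mulrBl.
    by rewrite (B g (x n))// (B g' (x' n))// xx'//; ring.
  rewrite E mulrDl (le_trans (ler_normD _ _))// lerD//.
    apply: le_trans (l2nrm_CS (in_L2B gL (xL n)) p'L) _.
    by rewrite mulrC ler_wpM2l ?l2nrm_ge0.
  apply: le_trans (l2nrm_CS (in_L2B g'L (x'L n)) pL) _.
  by rewrite mulrC ler_wpM2l ?l2nrm_ge0.
exists g; split; first by apply/H1norm_lty; exact: in_H1_weak gg'.
apply/ecvg0P => [n|e e0]; first exact: H1norm_ge0.
have /cvgrPdist_le/(_ _ e0) := c0 2; apply: filterS => n Hn.
rewrite (@H1norm_weak _ _ (fun t => g' t - x' n t)); last 3 first.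
- exact: (in_L2B gL (xL n)).
- exact: in_L2B.
- exact: (@dB g _ (x n)).
rewrite lee_fin; move: Hn; rewrite sub0r normrN ger0_norm; last first.
  by rewrite !mulr_ge0// exprn_ge0.
apply: le_trans.
have e1 : 0 <= 2 * 2^-1 ^+ n :> R by rewrite mulr_ge0// exprn_ge0.
rewrite /h1nrm -[leRHS]ger0_norm ?mulr_ge0// -sqrtr_sqr ler_wsqrtr//.
have H f : l2nrm f <= 2 * 2^-1 ^+ n -> \int[mu]_(x in I01) (f x ^+ 2) <= (2 * 2^-1 ^+ n) ^+ 2.
  move=> fn; rewrite -[leLHS]sqr_sqrtr ?int_sqr_ge0// -l2nrmE.
  by apply: lerXn2r; rewrite ?nnegrE ?l2nrm_ge0.
have := H _ (gx n); have := H _ (gx' n).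
move: (2 * 2^-1 ^+ n) e1 => z z0 h1 h2.
have := sqr_ge0 z; rewrite exprMn; lra.
Qed.

Lemma H1norm_functional (h : R -> R) : bm01 h ->
  exists2 K : R, 0 < K &
    bounded_functional (@H1norm R) (fun z : R -> R^o => (\int[mu]_(x in I01) (z x * h x)) / K).
Proof.
move=> bh; have hL := bm01_in_L2 bh.
have K0 : 0 < l2nrm h + 1 by rewrite ltr_wpDl// l2nrm_ge0.
exists (l2nrm h + 1) => //; split.
- move=> c z w /H1norm_lty[zL _] /H1norm_lty[wL _]; rewrite mulrA -mulrDl; congr (_ / _).
  have i1 := in_L2M zL hL; have i2 := in_L2M wL hL.
  rewrite -(rintZl c mI i1) -(rintD mI (rintegrableZl c mI i1) i2).
  by apply: eq_rint => x _; rewrite mulrDl mulrA.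
- move=> z /H1norm_lty zH; have [zL _] := zH.
  rewrite (H1norm_fin zH) lee_fin normrM normfV (gtr0_norm K0) ler_pdivrMr//.
  apply: le_trans (l2nrm_CS zL hL) _; apply: ler_pM; rewrite ?l2nrm_ge0 ?lerDl//.
  by have [] := l2nrm_le_h1nrm z (weak_deriv z).
Qed.

Lemma in_H10_0 : in_H10 (0 : R -> R^o).
Proof.
have c0 : (0 : R) < 4^-1 by rewrite invr_gt0.
have c1 : (2^-1 : R) < 1 by rewrite invf_lt1// ltr1n.
have := test_fun_in_H10 (test_funZ 0 (test_fun_bump c0 c1 ltr01)).
by rewrite (_ : (fun x => _) = 0)//; apply/funext => x; rewrite mul0r.
Qed.

Lemma Hm1norm_le (l : functional R) (C : R) : linear_on_H10 l ->
  (forall v, in_H10 v -> (H1norm v <= 1)%E -> `|l v| <= C) -> (Hm1norm l <= C%:E)%E.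
Proof.
move=> ll lC; rewrite /Hm1norm asboolT//; apply: ge_ereal_sup => _ [v [vH v1] <-].
by rewrite lee_fin lC.
Qed.

Lemma Hm1norm_ubound (l : functional R) : (Hm1norm l < +oo)%E ->
  linear_on_H10 l /\
  forall v, in_H10 v -> (H1norm v <= 1)%E -> (`|l v|%:E <= Hm1norm l)%E.
Proof.
rewrite /Hm1norm; case: asboolP => // ll _; split => // v vH v1.
by apply: ereal_sup_ubound; exists v.
Qed.

Lemma Hm1norm_ge0 (l : functional R) : (0 <= Hm1norm l)%E.
Proof.
rewrite /Hm1norm; case: asboolP => // _.
apply: (@le_trans _ _ `|l 0|%:E); first by rewrite lee_fin.
apply: ereal_sup_ubound; exists 0 => //; split; first exact: in_H10_0.
by rewrite H1norm0.
Qed.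

Lemma Hm1norm_fin (l : functional R) : (Hm1norm l < +oo)%E ->
  Hm1norm l \is a fin_num.
Proof. by rewrite ge0_fin_numE// Hm1norm_ge0. Qed.

Lemma Hm1norm0 : Hm1norm (0 : functional R) = 0%E.
Proof.
apply/eqP; rewrite eq_le Hm1norm_ge0 andbT; apply: Hm1norm_le.
  by move=> c v w _ _; rewrite mulr0 addr0.
by move=> v _ _; rewrite normr0.
Qed.

Lemma linear_on_H10Z (c : R) (l : functional R) : linear_on_H10 l -> linear_on_H10 (c *: l).
Proof.
move=> ll d v w vH wH; have E u : (c *: l) u = c * l u by [].
by rewrite !E ll//; ring.
Qed.

Lemma Hm1normZ (c : R) (l : functional R) : (Hm1norm l < +oo)%E ->
  Hm1norm (c *: l) = (`|c|%:E * Hm1norm l)%E.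
Proof.
have half (d : R) (m : functional R) : (Hm1norm m < +oo)%E -> (Hm1norm (d *: m) <= `|d|%:E * Hm1norm m)%E.
  move=> mf; have [ml mb] := Hm1norm_ubound mf.
  rewrite -(fineK (Hm1norm_fin mf)) -EFinM; apply: Hm1norm_le; first exact: linear_on_H10Z.
  move=> v vH v1; have -> : (d *: m) v = d * m v by [].
  by rewrite normrM ler_wpM2l// -lee_fin fineK ?Hm1norm_fin// mb.
move=> lf; apply/eqP; rewrite eq_le half//=.
have [->|c0] := eqVneq c 0; first by rewrite normr0 mul0e Hm1norm_ge0.
have clf : (Hm1norm (c *: l) < +oo)%E.
  by apply: le_lt_trans (half c l lf) _; rewrite lte_mul_pinfty// lee_fin.
have := half c^-1 _ clf; rewrite scalerA mulVf// scale1r normfV => H.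
rewrite muleC -lee_pdivlMr ?normr_gt0// muleC; exact: H.
Qed.

Lemma Hm1normD (l m : functional R) : (Hm1norm (l + m)%R <= Hm1norm l + Hm1norm m)%E.
Proof.
have [lf|] := ltP (Hm1norm l) +oo%E; last first.
  by rewrite leye_eq => /eqP ->; rewrite addye ?leey// gt_eqF// (lt_le_trans _ (Hm1norm_ge0 _)).
have [mf|] := ltP (Hm1norm m) +oo%E; last first.
  by rewrite leye_eq => /eqP ->; rewrite addey ?leey// gt_eqF// (lt_le_trans _ (Hm1norm_ge0 _)).
have [ll lb] := Hm1norm_ubound lf; have [ml mb] := Hm1norm_ubound mf.
rewrite -(fineK (Hm1norm_fin lf)) -(fineK (Hm1norm_fin mf)) -EFinD.
have E u : (l + m) u = l u + m u by [].
apply: Hm1norm_le.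
  by move=> c v w vH wH; rewrite !E ll// ml//; ring.
move=> v vH v1; rewrite E (le_trans (ler_normD _ _))// lerD//.
  by rewrite -lee_fin fineK ?Hm1norm_fin// lb.
by rewrite -lee_fin fineK ?Hm1norm_fin// mb.
Qed.

Lemma Hm1norm_eval (v : R -> R^o) : in_H10 v -> (H1norm v <= 1)%E ->
  bounded_functional (@Hm1norm R) (fun l => l v).
Proof.
move=> vH v1; split => [c l m _ _|l lf] //.
by have [_ ->] := Hm1norm_ubound lf.
Qed.

(** The dual norm is a supremum of evaluations, which are functionals of norm at most one by
    [Hm1norm_eval]. *)
Lemma Hm1norm_norming (l : functional R) (r : R) : (Hm1norm l < +oo)%E -> 0 <= r ->
  (forall e, bounded_functional (@Hm1norm R) e -> `|e l| <= r) -> (Hm1norm l <= r%:E)%E.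
Proof.
move=> lf r0 er; have [ll _] := Hm1norm_ubound lf; apply: Hm1norm_le => // v vH v1.
by apply: (er (fun m => m v)); exact: Hm1norm_eval.
Qed.

Lemma in_H10Z (c : R) (v : R -> R^o) : in_H10 v -> in_H10 (c *: v).
Proof.
move=> [vH va]; split; first by apply/H1norm_lty; rewrite H1normZ ?lte_mul_pinfty ?lee_fin//; apply/H1norm_lty.
move=> e e0; have c1 : 0 < `|c| + 1 by rewrite ltr_wpDl.
have [phi tphi Hphi] := va _ (divr_gt0 e0 c1).
exists (fun x => c * phi x); first exact: test_funZ.
have -> : c *: v - (fun x => c * phi x) = c *: (v - phi).
  by rewrite scalerBr.
have fin : (H1norm (v - phi)%R < +oo)%E by apply: lt_trans Hphi _; exact: ltry.
have ff : H1norm (v - phi) \is a fin_num by rewrite ge0_fin_numE// H1norm_ge0.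
have n0 : 0 <= fine (H1norm (v - phi)) by rewrite fine_ge0// H1norm_ge0.
have E := esym (fineK ff); rewrite H1normZ// E -EFinM lte_fin.
move: Hphi; rewrite E lte_fin ltr_pdivlMr//; apply: le_lt_trans.
by rewrite mulrC ler_wpM2l// lerDl.
Qed.

(** Adding 1 to the norm of [v] gives a positive scaling factor even when the norm is 0. *)
Lemma Hm1norm_bound (l : functional R) (v : R -> R^o) : (Hm1norm l < +oo)%E -> in_H10 v ->
  `|l v| <= fine (Hm1norm l) * (fine (H1norm v) + 1).
Proof.
move=> lf vH; have [ll lb] := Hm1norm_ubound lf.
have vf : H1norm v \is a fin_num.
  by rewrite ge0_fin_numE ?H1norm_ge0//; apply/H1norm_lty; case: vH.
set c := _ + 1; have c0 : 0 < c by rewrite ltr_wpDl// fine_ge0 ?H1norm_ge0.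
have l0 : l 0 = 0.
  by have := ll 1 0 0 in_H10_0 in_H10_0; rewrite scale1r addr0; lra.
have wH := in_H10Z c^-1 vH.
have -> : l v = c * l (c^-1 *: v).
  have := ll c _ _ wH in_H10_0; rewrite l0 !addr0 => <-.
  by rewrite scalerA mulfV ?gt_eqF// scale1r.
rewrite normrM (gtr0_norm c0) mulrC ler_wpM2r ?(ltW c0)//.
rewrite -lee_fin fineK ?Hm1norm_fin//; apply: lb => //.
rewrite H1normZ; last by rewrite -ge0_fin_numE// H1norm_ge0.
rewrite -(fineK vf) -EFinM lee_fin gtr0_norm ?invr_gt0// mulrC ler_pdivrMr// mul1r.
by rewrite /c lerDl.
Qed.

(** The limit is taken at each [v]; on the unit ball [K v <= 2], so the rates are uniform there and
    give convergence in the dual norm. *)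
Lemma Hm1norm_complete (x : nat -> functional R) : (forall n, (Hm1norm (x n) < +oo)%E) ->
  (forall n, (Hm1norm (x n.+1 - x n)%R <= (2^-1 ^+ n)%:E)%E) ->
  exists y, (Hm1norm y < +oo)%E /\ (fun n => Hm1norm (y - x n)) @ \oo --> 0%E.
Proof.
move=> xf xd.
have xl n : linear_on_H10 (x n) by have [] := Hm1norm_ubound (xf n).
pose K (v : R -> R^o) := fine (H1norm v) + 1.
have K0 v : 0 <= K v by rewrite addr_ge0// fine_ge0// H1norm_ge0.
have step n v : in_H10 v -> `|x n.+1 v - x n v| <= K v * 2^-1 ^+ n.
  move=> vH; have df : (Hm1norm (x n.+1 - x n)%R < +oo)%E.
    by apply: le_lt_trans (xd _) _; exact: ltry.
  have := Hm1norm_bound df vH; move=> /le_trans; apply.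
  rewrite mulrC; apply: ler_wpM2l; first exact: K0.
  by rewrite -lee_fin fineK ?Hm1norm_fin//; exact: xd.
have xE n v : x n v = x 0%N v + \sum_(m < n) (x m.+1 v - x m v).
  by rewrite -(big_mkord xpredT (fun m => x m.+1 v - x m v)) telescope_sumr// addrC subrK.
pose y v := limn (fun n => x n v).
have yP v : in_H10 v -> (fun n => x n v) @ \oo --> y v /\
    forall n, `|y v - x n v| <= 2 * K v * 2^-1 ^+ n.
  move=> vH; have [l [lcv lM]] := @geometric_tail_cvg R (fun m => x m.+1 v - x m v)
    (K v) 0 (K0 v) (fun m _ => step m v vH).
  have cv : (fun n => x n v) @ \oo --> x 0%N v + l.
    by under eq_fun do rewrite xE; apply: cvgD => //; exact: cvg_cst.
  have yE : y v = x 0%N v + l by rewrite /y; apply: cvg_lim.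
  rewrite yE; split => // n; have := lM n (leq0n n).
  by rewrite [x n v]xE opprD addrACA subrr add0r.
have yl : linear_on_H10 (y : functional R).
  move=> c v w vH wH; have [cv _] := yP v vH; have [cw _] := yP w wH.
  rewrite {1}/y; apply: cvg_lim => //.
  under eq_fun do rewrite xl//.
  by apply: cvgD => //; apply: cvgM => //; exact: cvg_cst.
have yx n : (Hm1norm ((y : functional R) - x n)%R <= (4 * 2^-1 ^+ n)%:E)%E.
  apply: Hm1norm_le => [c v w vH wH|v vH v1].
    have E u : ((y : functional R) - x n) u = y u - x n u by [].
    by rewrite !E yl// xl//; ring.
  have [_ H] := yP v vH; apply: le_trans (H n) _.
  rewrite ler_wpM2r ?exprn_ge0//.
  have : fine (H1norm v) <= 1.
    rewrite -lee_fin fineK// ge0_fin_numE ?H1norm_ge0//; exact: le_lt_trans v1 (ltry _).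
  rewrite /K; lra.
exists y; split.
  have -> : y = ((y : functional R) - x 0%N) + x 0%N by rewrite subrK.
  apply: le_lt_trans (Hm1normD _ _) _; apply: lte_add_pinfty => //.
  by apply: le_lt_trans (yx _) _; exact: ltry.
apply/ecvg0P => [n|e e0]; first exact: Hm1norm_ge0.
have c0 : 4 * 2^-1 ^+ n @[n --> \oo] --> (0 : R).
  rewrite -[X in _ --> X](mulr0 4); apply: cvgM; first exact: cvg_cst.
  by apply: cvg_expr; rewrite ger0_norm; lra.
have /cvgrPdist_le/(_ _ e0) := c0; apply: filterS => n Hn.
apply: le_trans (yx n) _; rewrite lee_fin; move: Hn.
by rewrite sub0r normrN; exact: le_trans (ler_norm _).
Qed.

(** The functional that maps [v] to minus the integral of [f' * v'] shows that the choice in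
    [distr_dxx] is not from an empty set. *)
Lemma distr_dxxP (f : R -> R^o) : in_H1 f ->
  forall phi, test_fun phi -> distr_dxx f phi = \int[mu]_(x in I01) (f x * derive1n 2 phi x).
Proof.
move=> fH; have [dL df] := weak_derivP fH.
pose l : functional R := fun v => - \int[mu]_(x in I01) (weak_deriv f x * weak_deriv v x).
pose S := [set l : functional R | (Hm1norm l < +oo)%E /\
    forall phi, test_fun phi -> l phi = \int[mu]_(x in I01) (f x * derive1n 2 phi x)].
suff H : S l by have [] : S (distr_dxx f) by apply: xgetPex; exists l.
split.
  apply: (@le_lt_trans _ _ (l2nrm (weak_deriv f))%:E); last exact: ltry.
  apply: Hm1norm_le => [c v w [vH _] [wH _]|v [vH _] v1].
    have [dvL dv] := weak_derivP vH; have [dwL dw] := weak_derivP wH.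
    have [cH dc] := in_H1_lin c vH wH; have [dcL dc'] := weak_derivP cH.
    have -> : l (c *: v + w) = - \int[mu]_(x in I01) (weak_deriv f x * (c * weak_deriv v x + weak_deriv w x)).
      congr (- _); apply: ae_eq_rint01.
      apply: (ae_imp (weak_deriv_ae_unique _ _ dc' dc)) => [||x H Ix].
      - exact: in_L2_rintegrable.
      - by apply: in_L2_rintegrable; exact: in_L2_lin.
      - by rewrite -H.
    have i1 := in_L2M dL dvL; have i2 := in_L2M dL dwL.
    rewrite (eq_rint (g := fun x => c * (weak_deriv f x * weak_deriv v x) + weak_deriv f x * weak_deriv w x)); last first.
      by move=> x _; ring.
    rewrite (rintD mI (rintegrableZl c mI i1) i2) (rintZl c mI i1) /l mulrN; exact: opprD.
  have [dvL dv] := weak_derivP vH.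
  rewrite /l normrN; apply: le_trans (l2nrm_CS dL dvL) _.
  rewrite ler_piMr ?l2nrm_ge0//; apply: le_trans (l2nrm_le_h1nrm v _).2 _.
  by rewrite -lee_fin -H1norm_fin.
move=> phi tphi; rewrite /l.
have [dpL dp] := weak_derivP (test_fun_in_H1 tphi).
have tphi' := test_fun_derive1 tphi.
have -> : \int[mu]_(x in I01) (weak_deriv f x * weak_deriv phi x) =
    \int[mu]_(x in I01) (weak_deriv f x * derive1 phi x).
  apply: ae_eq_rint01.
  apply: (ae_imp (weak_deriv_ae_unique _ _ dp (test_fun_weak_deriv tphi))) => [||x H Ix].
  - exact: in_L2_rintegrable.
  - by apply: in_L2_rintegrable; exact: test_fun_in_L2.
  - by rewrite H.
by rewrite -df// derive1nS derive1n1.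
Qed.

End SobolevInstances.

(** * The moments of the solution and the conclusion *)

Section Uniqueness.
Context (R : realType) (alpha T x0 P : R) (p p0 a : R -> R) (u : R -> R -> R^o).
Local Notation mu := (@lebesgue_measure R).
Local Notation I01 := (`]0, 1[%classic : set R).
Hypothesis alpha01 : 0 < alpha < 1.
Hypothesis T0 : 0 < T.
Hypothesis x001 : 0 < x0 < 1.
Hypothesis bp0 : bm01 p0.
Hypothesis pP : forall x, I01 x -> `|p0 x| <= P.
Hypothesis pp0 : {ae mu, forall x, x \in `]0, 1[ -> p x = p0 x}.
Hypothesis aL : in_L2 a.
Hypothesis hu : L2_valued (@H1norm R) T u.
Hypothesis hua : H_alpha (@Hm1norm R) alpha T (fun t => embed (fun x => u t x - a x)).
Hypothesis heq : {ae mu, forall t, t \in `]0, T[ ->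
  Hm1norm (dt_alpha (@Hm1norm R) alpha T
             (fun s => embed (fun x => u s x - a x)) t
           - distr_dxx (u t) + embed (fun x => p x * u t x)) = 0%E}.
Hypothesis htr0 : {ae mu, forall t, t \in `]0, T[ ->
  trace (RL_integral (@H1norm R) alpha u t) x0 = 0}.
Hypothesis htr1 : {ae mu, forall t, t \in `]0, T[ ->
  trace (weak_deriv (RL_integral (@H1norm R) alpha u t)) x0 = 0}.

Let mI : measurable I01. Proof. exact: measurable_itv. Qed.
Let mT : measurable (`]0, T[%classic : set R). Proof. exact: measurable_itv. Qed.

Let moment (h : R -> R) (t : R) : R := \int[mu]_(x in I01) (u t x * h x).

Lemma RLreal_ae (t : R) (U V : R -> R) : 0 < t < T ->
  {ae mu, forall s, s \in `]0, T[ -> U s = V s} ->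
  RLreal alpha U t = RLreal alpha V t.
Proof.
move=> /andP[t0 tT] UV; congr (_ * _); apply: ae_eq_Rintegral.
apply: (ae_imp UV) => s H; rewrite /= in_itv/= => /andP[s0 st]; rewrite H//.
by rewrite in_itv/= s0 (lt_trans st).
Qed.

Lemma RLrealZ (t c : R) (U : R -> R) : 0 < t < T -> c != 0 -> measurable_fun `]0, T[ U ->
  RLreal alpha (fun s => c * U s) t = c * RLreal alpha U t.
Proof.
move=> /andP[t0 tT] c0 mU; rewrite /RLreal [RHS]mulrCA; congr (_ * _).
rewrite -RintegralZl_meas//.
- by apply: eq_rint => s _; rewrite mulrCA.
- apply: measurable_funM.
    by apply: (measurableT_comp (measurable_powR _)); apply: measurable_funB.
  by apply: measurable_funS mU => //; apply: subset_itvl; rewrite bnd_simp ltW.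
Qed.

Lemma H1_moment (h : R -> R) : bm01 h ->
  exists K l, [/\ 0 < K, bounded_functional (@H1norm R) l &
    forall z : R -> R^o, \int[mu]_(x in I01) (z x * h x) = K * l z].
Proof.
move=> bh; have [K K0 bl] := H1norm_functional bh; exists K.
exists (fun z : R -> R^o => (\int[mu]_(x in I01) (z x * h x)) / K); split => // z.
by rewrite mulrC divfK// gt_eqF.
Qed.

Lemma moment_rep (h : R -> R) : bm01 h ->
  exists2 U, rintegrable `]0, T[ U & {ae mu, forall t, t \in `]0, T[ -> moment h t = U t}.
Proof.
move=> bh; have [K [l [K0 bl lE]]] := H1_moment bh.
have [U iU UE] := L2_valued_functional (@H1norm_ge0 R) (@H1norm0 R) (@H1normZ R)
  (@H1normD R) bl hu.
exists (fun t => K * U t); first exact: rintegrableZl.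
by apply: (ae_imp UE) => t H tT; rewrite /moment lE H.
Qed.

(** A moment is a multiple of a functional of norm at most one, so [J^alpha] commutes with it,
    outside a null set that does not depend on [h]. *)
Lemma RL_integral_moment : {ae mu, forall t, t \in `]0, T[ ->
  in_H1 (RL_integral (@H1norm R) alpha u t) /\
  forall h, bm01 h -> \int[mu]_(x in I01) (RL_integral (@H1norm R) alpha u t x * h x) =
    RLreal alpha (moment h) t}.
Proof.
have := RL_integral_functional (@H1norm_ge0 R) (@H1norm0 R) (@H1normZ R)
  (@H1normD R) (@H1norm_norming R) (@H1norm_complete R) alpha01 hu.
move=> /ae_imp; apply => t H tT; have [/H1norm_lty vH vl] := H tT.
have tT' : 0 < t < T by move: tT; rewrite in_itv.
split => // h bh; have [K [l [K0 bl lE]]] := H1_moment bh.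
rewrite lE vl//.
have [U iU UE] := L2_valued_functional (@H1norm_ge0 R) (@H1norm0 R) (@H1normZ R)
  (@H1normD R) bl hu.
rewrite (RLreal_ae tT' UE) -RLrealZ ?gt_eqF//; last exact: rintegrable_measurable.
by apply: RLreal_ae => //; apply: (ae_imp UE) => s Hs sT; rewrite /moment lE Hs.
Qed.

Lemma u_H1 : {ae mu, forall t, t \in `]0, T[ -> in_H1 (u t)}.
Proof.
have [phi [_ _ phiE]] := L2_valued_norm (@H1norm_ge0 R) (@H1norm0 R) (@H1normZ R)
  (@H1normD R) hu.
by apply: (ae_imp phiE) => t H tT; apply/H1norm_lty; rewrite H// ltry.
Qed.

(** [J^alpha] applied to the equation. The null set of times must be common to all test functions:
    at a given time [RL_integral_functional] covers every functional, and null sets depending on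
    [phi] occur only under the time integral of [RLreal]. *)
Lemma RL_equation : {ae mu, forall t, t \in `]0, T[ -> forall phi, test_fun phi ->
  \int[mu]_(x in I01) (RL_integral (@H1norm R) alpha u t x *
     (derive1n 2 phi x - p0 x * phi x)) =
  \int[mu]_(x in I01) ((u t x - a x) * phi x)}.
Proof.
pose w t : functional R := embed (fun x => u t x - a x).
pose F := dt_alpha (@Hm1norm R) alpha T w.
(* [dt_alpha] is a choice; [hua] guarantees an actual preimage under [J^alpha] and not the
   default. *)
have [FL FE] : is_RL_preimage (@Hm1norm R) alpha T w F.
  have [F0 HF0] := hua.
  by apply: (@xgetPex _ (fun=> 0) [set F | is_RL_preimage (@Hm1norm R) alpha T w F]); exists F0.
have FR := RL_integral_functional (@Hm1norm_ge0 R) (@Hm1norm0 R) (@Hm1normZ R)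
  (@Hm1normD R) (@Hm1norm_norming R) (@Hm1norm_complete R) alpha01 FL.
have bq phi : test_fun phi -> bm01 (fun x => derive1n 2 phi x - p0 x * phi x).
  move=> tphi; have := bm01_lin (-1) (bm01M bp0 (test_fun_bm01 tphi))
    (test_fun_bm01 (test_fun_derive1n 2 tphi)).
  by congr (@bm01 R _); apply/funext => x; rewrite mulN1r addrC.
have zero (l : functional R) phi : test_fun phi -> (H1norm phi <= 1)%E -> Hm1norm l = 0%E ->
    l phi = 0.
  move=> tphi phi1 l0.
  have lf : (Hm1norm l < +oo)%E by rewrite l0.
  have [_ /(_ phi (test_fun_in_H10 tphi) phi1)] := Hm1norm_ubound lf.
  by rewrite l0 lee_fin normr_le0 => /eqP.
have FM phi : test_fun phi -> (H1norm phi <= 1)%E ->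
    {ae mu, forall t, t \in `]0, T[ ->
      F t phi = moment (fun x => derive1n 2 phi x - p0 x * phi x) t}.
  move=> tphi phi1; apply: (ae_imp2 heq u_H1) => t Ht uH tT.
  have := zero _ phi tphi phi1 (Ht tT).
  have uH1 := uH tT; have [uL _] := uH1.
  have -> : (dt_alpha (Hm1norm (R:=R)) alpha T
     (fun s : R => embed (fun x : R => u s x - a x)) t - distr_dxx (u t) +
     embed (fun x : R => p x * u t x)) phi =
    F t phi - distr_dxx (u t) phi + \int[mu]_(x in I01) (p x * u t x * phi x) by [].
  rewrite distr_dxxP// => E.
  have -> : F t phi = \int[mu]_(x in I01) (u t x * derive1n 2 phi x)
     - \int[mu]_(x in I01) (p x * u t x * phi x) by lra.
  have iu := in_L2_rintegrable uL.
  have -> : \int[mu]_(x in I01) (p x * u t x * phi x) = \int[mu]_(x in I01) (u t x * (p0 x * phi x)).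
    apply: ae_eq_rint01; apply: (ae_imp pp0) => x px Ix.
    by rewrite px// mulrA (mulrC (p0 x)).
  rewrite -rintB//; last 2 first.
  - by apply: rintegrableM_bm01 => //; apply: test_fun_bm01; exact: test_fun_derive1n.
  - by apply: rintegrableM_bm01 => //; apply: bm01M => //; exact: test_fun_bm01.
  by apply: eq_rint => x _; rewrite mulrBr.
apply: (ae_imp2 (ae_imp2 FE FR (fun t a b => conj a b))
  (ae_imp2 u_H1 RL_integral_moment (fun t a b => conj a b))) => t [FEt FRt] [uH Ht] tT.
have tT' : 0 < t < T by move: tT; rewrite in_itv.
have [vH vm] := Ht tT; have [RF_lty RFl] := FRt tT.
have unit phi : test_fun phi -> (H1norm phi <= 1)%E ->
  \int[mu]_(x in I01) (RL_integral (@H1norm R) alpha u t x *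
     (derive1n 2 phi x - p0 x * phi x)) =
  \int[mu]_(x in I01) ((u t x - a x) * phi x).
  move=> tphi phi1; rewrite vm; last exact: bq.
  have := zero _ phi tphi phi1 (FEt tT).
  have -> : (w t - RL_integral (@Hm1norm R) alpha F t) phi =
    w t phi - RL_integral (@Hm1norm R) alpha F t phi by [].
  rewrite (RFl (fun l => l phi)); last exact: (Hm1norm_eval (test_fun_in_H10 tphi) phi1).
  move=> /eqP; rewrite subr_eq0 => /eqP; rewrite /w /embed => ->.
  by apply: RLreal_ae => //; apply: (ae_imp (FM phi tphi phi1)) => s H sT; rewrite H.
move=> phi tphi.
have pf : H1norm phi \is a fin_num.
  by rewrite ge0_fin_numE ?H1norm_ge0//; apply/H1norm_lty; exact: test_fun_in_H1.
(* Evaluations have norm at most one only on the unit ball; scaling by the norm plus 1, a positive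
   number, reaches every test function. *)
pose c := fine (H1norm phi) + 1.
have c0 : 0 < c by rewrite ltr_wpDl// fine_ge0// H1norm_ge0.
pose psi x := c^-1 * phi x.
have tpsi : test_fun psi by exact: test_funZ.
have psi1 : (H1norm psi <= 1)%E.
  have -> : psi = c^-1 *: (phi : R -> R^o) by [].
  rewrite H1normZ; last by rewrite -ge0_fin_numE// H1norm_ge0.
  rewrite -(fineK pf) -EFinM lee_fin gtr0_norm ?invr_gt0// mulrC ler_pdivrMr// mul1r.
  by rewrite /c lerDl.
have d2 : derive1n 2 psi = fun x => c^-1 * derive1n 2 phi x.
  rewrite !derive1nS !derive1n0 derive1Z// derive1Z//; exact: test_fun_derive1.
have := unit psi tpsi psi1.
have vL : in_L2 (RL_integral (@H1norm R) alpha u t) by case: vH.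
set v := RL_integral _ _ _ _ in vL *.
rewrite (eq_rint (g := fun x => c^-1 * (v x * (derive1n 2 phi x - p0 x * phi x)))); last first.
  by move=> x _; rewrite d2 /psi; ring.
rewrite [in X in _ = X -> _](eq_rint (g := fun x => c^-1 * ((u t x - a x) * phi x))); last first.
  by move=> x _; rewrite /psi; ring.
have i1 : rintegrable I01 (fun x => v x * (derive1n 2 phi x - p0 x * phi x)).
  by apply: rintegrableM_bm01; [exact: in_L2_rintegrable|exact: bq].
have [uL _] := uH tT.
have i2 : rintegrable I01 (fun x => (u t x - a x) * phi x).
  apply: rintegrableM_bm01; last exact: test_fun_bm01.
  by apply: in_L2_rintegrable; exact: in_L2B.
by rewrite (rintZl c^-1 mI i1) (rintZl c^-1 mI i2) => /(mulfI (invr_neq0 (lt0r_neq0 c0))).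
Qed.

Lemma bm01_resolved (g : R -> R) : bm01 g -> bm01 (fun x => g x - p0 x * Istar2 x0 g x).
Proof.
move=> bg; have := bm01_lin (-1) (bm01M bp0 (Istar2_bm01 x0 bg)) bg.
by congr (@bm01 R _); apply/funext => x; rewrite mulN1r addrC.
Qed.

Lemma moment_equation (g : R -> R) : bm01 g -> {ae mu, forall t, t \in `]0, T[ ->
  moment (Istar2 x0 g) t - Afun x0 a g =
  RLreal alpha (moment (fun x => g x - p0 x * Istar2 x0 g x)) t}.
Proof.
move=> bg; have bB := Istar2_bm01 x0 bg.
apply: (ae_imp2 (ae_imp2 htr0 htr1 (fun t a b => conj a b))
  (ae_imp2 (ae_imp2 u_H1 RL_integral_moment (fun t a b => conj a b)) RL_equation
   (fun t a b => conj a b))) => t [t0 t1] [[uH Ht] Et] tT.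
have [uL _] := uH tT; have [vH vm] := Ht tT.
have {}Et := Et tT; have {}t0 := t0 tT; have {}t1 := t1 tT.
rewrite -vm; last exact: bm01_resolved.
set v := RL_integral _ _ _ _ in vH Et t0 t1 *.
have [vL _] := vH; have [dvL dv] := weak_derivP vH.
have iv := in_L2_rintegrable vL; have iu := in_L2_rintegrable uL.
have ia := in_L2_rintegrable aL.
(* The weak second derivative of [v], read off from [RL_equation]. *)
pose q x := v x * p0 x + (u t x - a x).
have iuh h : bm01 h -> rintegrable I01 (fun x => u t x * h x).
  by move=> bh; exact: rintegrableM_bm01.
have iva : rintegrable I01 (fun x => v x * p0 x) by exact: rintegrableM_bm01.
have iua : rintegrable I01 (fun x => u t x - a x) by exact: rintegrableB.
have iq : rintegrable I01 q by exact: rintegrableD.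
have vq phi : test_fun phi ->
    \int[mu]_(x in I01) (v x * derive1n 2 phi x) = \int[mu]_(x in I01) (q x * phi x).
  move=> tphi; have b := test_fun_bm01 tphi.
  have b2 := test_fun_bm01 (test_fun_derive1n 2 tphi).
  have j1 := rintegrableM_bm01 iv b2.
  have j2 := rintegrableM_bm01 iva b.
  have j3 := rintegrableM_bm01 iua b.
  have := Et _ tphi.
  rewrite (eq_rint (g := fun x => v x * derive1n 2 phi x - v x * p0 x * phi x)); last first.
    by move=> x _; rewrite mulrBr mulrA.
  rewrite (rintB mI j1 j2) => E.
  rewrite (eq_rint (f := fun x => q x * phi x)
     (g := fun x => v x * p0 x * phi x + (u t x - a x) * phi x)); last first.
    by move=> x _; rewrite /q mulrDl.
  by rewrite (rintD mI j2 j3) -E addrC subrK.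
have vE := weak_deriv2_Iop x001 iv (in_L2_rintegrable dvL) iq dv vq t0 t1.
have ig := bm01_rintegrable bg; have iIg := bm01_rintegrable (Istar_bm01 x0 ig).
have iIq := bm01_rintegrable (Iop_bm01 x0 iq).
(* The duality of [Iop] and [Istar], used twice, moves both integrations from [q] onto [g]. *)
have E1 : \int[mu]_(x in I01) (v x * g x) = \int[mu]_(x in I01) (q x * Istar2 x0 g x).
  rewrite /Istar2 -IopE//.
  transitivity (\int[mu]_(x in I01) (g x * Iop x0 (Iop x0 q) x)).
    by apply: ae_eq_rint01; apply: (ae_imp vE) => x H Ix; rewrite H// mulrC.
  by rewrite (IopE x0 iIq ig); apply: eq_rint => x _; exact: mulrC.
have k1 := rintegrableM_bm01 iva bB.
have k2 := rintegrableM_bm01 iu bB.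
have k3 := rintegrableM_bm01 ia bB.
have k4 := rintegrableM_bm01 iv bg.
rewrite (eq_rint (f := fun x => v x * (g x - p0 x * Istar2 x0 g x))
   (g := fun x => v x * g x - v x * p0 x * Istar2 x0 g x)); last first.
  by move=> x _; rewrite mulrBr mulrA.
rewrite (rintB mI k4 k1) E1.
rewrite (eq_rint (f := fun x => q x * Istar2 x0 g x)
   (g := fun x => v x * p0 x * Istar2 x0 g x + (u t x * Istar2 x0 g x - a x * Istar2 x0 g x))); last first.
  by move=> x _; rewrite /q; ring.
rewrite (rintD mI k1 (rintegrableB mI k2 k3)) (rintB mI k2 k3).
by rewrite [RHS]addrAC subrr add0r.
Qed.

Let X (s : R) (h : R -> R) : R := \int[mu]_(t in `]0, T[) (expR (- (s * t)) * moment h t).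

Lemma rintegrable_exp_mul (s : R) (U : R -> R) : 0 < s -> rintegrable `]0, T[ U ->
  rintegrable `]0, T[ (fun t => expR (- (s * t)) * U t).
Proof.
move=> s0 iU; apply: (@rintegrable_bddM _ _ 1) => //; first exact: measurable_expR_lin.
move=> t; rewrite /= in_itv/= => /andP[t0 _].
by rewrite ger0_norm ?expR_ge0// -[leRHS]expR0 ler_expR oppr_le0 mulr_ge0// ltW.
Qed.

Lemma laplace_moment_ae (s : R) (h U : R -> R) : {ae mu, forall t, t \in `]0, T[ -> moment h t = U t} ->
  X s h = \int[mu]_(t in `]0, T[) (expR (- (s * t)) * U t).
Proof.
by move=> hU; apply: ae_eq_Rintegral; apply: (ae_imp hU) => t H tT; rewrite H.
Qed.

Lemma laplace_moment_lin (s c : R) (h k : R -> R) : 0 < s -> bm01 h -> bm01 k ->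
  X s (fun x => c * h x + k x) = c * X s h + X s k.
Proof.
move=> s0 bh bk; have [U iU UE] := moment_rep bh; have [V iV VE] := moment_rep bk.
rewrite (laplace_moment_ae s UE) (laplace_moment_ae s VE).
have i1 := rintegrable_exp_mul s0 iU; have i2 := rintegrable_exp_mul s0 iV.
rewrite -(rintZl c mT i1) -(rintD mT (rintegrableZl c mT i1) i2).
apply: ae_eq_Rintegral; apply: (ae_imp2 u_H1 (ae_imp2 UE VE (fun t a b => conj a b))) => t uH [Ut Vt] tT.
have [uL _] := uH tT; have iu := in_L2_rintegrable uL.
rewrite -Ut// -Vt//.
have -> : moment (fun x => c * h x + k x) t = c * moment h t + moment k t.
  have j1 := rintegrableM_bm01 iu bh; have j2 := rintegrableM_bm01 iu bk.
  rewrite /moment -(rintZl c mI j1) -(rintD mI (rintegrableZl c mI j1) j2).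
  by apply: eq_rint => x _; ring.
ring.
Qed.

(** On the unit interval the [L^1] norm of [u t] is at most its [L^2] norm, hence at most its [H^1]
    norm, which [phi] represents. *)
Lemma moment_le : exists2 phi, rintegrable `]0, T[ phi & (forall t, 0 <= phi t) /\
  {ae mu, forall t, t \in `]0, T[ -> forall h H, bm01 h -> (forall x, I01 x -> `|h x| <= H) ->
    `|moment h t| <= H * phi t}.
Proof.
have [phi [iphi phi0 phiE]] := L2_valued_norm (@H1norm_ge0 R) (@H1norm0 R) (@H1normZ R)
  (@H1normD R) hu.
exists phi => //; split => //.
apply: (ae_imp phiE) => t Ht tT h H bh hH.
have uH : in_H1 (u t) by apply/H1norm_lty; rewrite Ht// ltry.
have [uL _] := uH; have iu := in_L2_rintegrable uL.
have I12 : I01 (2^-1 : R) by rewrite /= in_itv/=; apply/andP; split; lra.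
have H0 : 0 <= H by apply: le_trans (hH _ I12).
have L1 : \int[mu]_(x in I01) `|u t x| <= phi t.
  rewrite (eq_rint (g := fun x => `|u t x| * 1)); last by move=> x _; rewrite mulr1.
  apply: le_trans (ler_norm _) _.
  apply: le_trans (l2nrm_CS (in_L2_norm uL) (bm01_in_L2 (bm01_cst 1))) _.
  rewrite l2nrm1 mulr1 l2nrm_norm; apply: le_trans (l2nrm_le_h1nrm _ (weak_deriv (u t))).1 _.
  by rewrite -lee_fin -H1norm_fin// Ht.
apply: le_trans (ler_wpM2l H0 L1); rewrite -rintZl//; last exact: rintegrable_norm.
apply: le_norm_rint_le => //.
- by apply: measurable_funM; [exact: rintegrable_measurable|case: bh].
- by apply: rintegrableZl => //; exact: rintegrable_norm.
- by move=> x Ix; rewrite normrM mulrC ler_wpM2r// hH.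
Qed.

Lemma laplace_cst (s : R) : 0 < s ->
  \int[mu]_(t in `]0, T[) expR (- (s * t)) = (1 - expR (- (s * T))) / s.
Proof.
move=> s0; have sn : s != 0 by rewrite gt_eqF.
have D (t : R) : is_derive t (1 : R) (fun t => - (expR (- (s * t)) / s)) (expR (- (s * t))).
  have d1 : is_derive t (1 : R) (fun t : R => - (s * t)) (- s).
    have := @is_derive_pow R (- s) 0 1 0 t; rewrite expr0 !mulr1.
    by rewrite (_ : (fun x : R => _) = (fun t => - (s * t)))//; apply/funext => z; rewrite expr1 add0r mul1r mulNr.
  have := is_deriveZ (- s^-1) (@is_derive1_comp R expR _ t _ _ (is_derive_expR _) d1).
  rewrite (_ : _ \*: _ = (fun t : R => - (expR (- (s * t)) / s))); last first.
    by apply/funext => z; rewrite /= /GRing.scale/= mulNr mulrC.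
  by move=> D; apply: is_derive_eq D _; rewrite /GRing.scale/=; field.
have C : continuous (fun t : R => expR (- (s * t))).
  move=> t; apply: (@continuous_comp _ _ _ (fun t : R => - (s * t)) expR); last exact: continuous_expR.
  by apply: cvgN; apply: cvgM; [exact: cvg_cst|exact: cvg_id].
rewrite (continuous_FTC2_Rintegral (ltW T0) D C) mulr0 oppr0 expR0.
by rewrite opprK mulrBl addrC.
Qed.

(** Supplies the bounds assumed of the abstract functional: [mb] is the time integral of the [H^1]
    norm of [u t], and the last bound is the truncation error of [laplace_RLreal]. *)
Lemma laplace_moment_bounds : exists mb : R, [/\ 0 <= mb,
  forall s h H, 0 < s -> bm01 h -> (forall x, I01 x -> `|h x| <= H) -> `|X s h| <= mb * H &
  forall s g H, 0 < s -> bm01 g ->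
  (forall x, I01 x -> `|g x - p0 x * Istar2 x0 g x| <= H) ->
  `|X s (Istar2 x0 g) - Afun x0 a g * ((1 - expR (- (s * T))) / s)
    - s `^ (- alpha) * X s (fun x => g x - p0 x * Istar2 x0 g x)|
  <= s `^ (- alpha) * expR (- (s * T)) * (mb * H)].
Proof.
have [phi iphi [phi0 phiE]] := moment_le.
exists (\int[mu]_(t in `]0, T[) phi t); split.
- by apply: Rintegral_ge0 => t _.
- move=> s h H s0 bh hH; have [U iU UE] := moment_rep bh.
  rewrite (laplace_moment_ae s UE) mulrC -rintZl//.
  apply: le_trans (le_norm_rint mT (rintegrable_exp_mul s0 iU)) _.
  have iHp := rintegrableZl H mT iphi.
  have ie := rintegrable_norm mT (rintegrable_exp_mul s0 iU).
  have I12 : I01 (2^-1 : R) by rewrite /= in_itv/=; apply/andP; split; lra.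
  have H0 : 0 <= H by apply: le_trans (hH _ I12).
  rewrite -lee_fin (EFin_Rintegral_ge0 ie)// (EFin_Rintegral_ge0 iHp); last first.
    by move=> t; rewrite mulr_ge0.
  apply: ae_le_integral_nomeas => [t _|t _|]; rewrite ?lee_fin ?mulr_ge0//.
  apply: (ae_imp2 UE phiE) => t Ut Pt tT; rewrite lee_fin normrM -Ut//.
  apply: le_trans (Pt tT h H bh hH); rewrite ler_piMl// ger0_norm ?expR_ge0//.
  have /andP[t0 _] : 0 < t < T by move: tT; rewrite /= in_itv.
  by rewrite -[leRHS]expR0 ler_expR oppr_le0 mulr_ge0// ltW.
- move=> s g H s0 bg gH.
  have bB := Istar2_bm01 x0 bg; have bk := bm01_resolved bg.
  have [U iU UE] := moment_rep bk; have [V iV VE] := moment_rep bB.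
  have [iRL L] := laplace_RLreal alpha01 T0 s0 iU.
  have E : X s (Istar2 x0 g) - Afun x0 a g * ((1 - expR (- (s * T))) / s) =
     \int[mu]_(t in `]0, T[) (expR (- (s * t)) * RLreal alpha U t).
    rewrite (laplace_moment_ae s VE) -laplace_cst//.
    have ic : rintegrable `]0, T[ (fun t => expR (- (s * t)) * Afun x0 a g).
      apply: rintegrable_exp_mul => //; apply: rintegrableP => //.
      rewrite integral_cst//= lebesgue_measure_itv/= lte_fin T0.
      by rewrite -EFinD -EFinM ltry.
    have ie : rintegrable `]0, T[ (fun t => expR (- (s * t))).
      have : rintegrable `]0, T[ (fun t => expR (- (s * t)) * 1).
        apply: rintegrable_exp_mul => //; apply: rintegrableP => //.
        rewrite integral_cst//= lebesgue_measure_itv/= lte_fin T0.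
        by rewrite -EFinD -EFinM ltry.
      by apply: eq_rintegrable => // t _; rewrite mulr1.
    rewrite -rintZl//.
    rewrite [X in _ - X](eq_rint (g := fun t => expR (- (s * t)) * Afun x0 a g)); last first.
      by move=> t _; rewrite mulrC.
    rewrite -rintB//; last exact: rintegrable_exp_mul.
    apply: ae_eq_Rintegral; apply: (ae_imp2 VE (moment_equation bg)) => t Vt Et tT.
    rewrite -mulrBr -Vt// Et//; congr (_ * _); apply: RLreal_ae => //.
  rewrite E (laplace_moment_ae s UE); apply: le_trans L _.
  rewrite ler_wpM2l ?mulr_ge0 ?powR_ge0 ?expR_ge0//.
  have I12 : I01 (2^-1 : R) by rewrite /= in_itv/=; apply/andP; split; lra.
  have H0 : 0 <= H by apply: le_trans (gH _ I12).
  rewrite mulrC -rintZl//.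
  have iHp := rintegrableZl H mT iphi.
  have ie := rintegrable_norm mT iU.
  rewrite -lee_fin (EFin_Rintegral_ge0 ie)// (EFin_Rintegral_ge0 iHp); last first.
    by move=> t; rewrite mulr_ge0.
  apply: ae_le_integral_nomeas => [t _|t _|]; rewrite ?lee_fin ?mulr_ge0//.
  by apply: (ae_imp2 UE phiE) => t Ut Pt tT; rewrite lee_fin -Ut// Pt.
Qed.

(** [q] is the weak derivative of [Iop x0 q]. *)
Lemma Iop_ae0 (q : R -> R) : rintegrable I01 q ->
  {ae mu, forall x, x \in `]0, 1[ -> Iop x0 q x = 0} ->
  {ae mu, forall x, x \in `]0, 1[ -> q x = 0}.
Proof.
move=> iq q0; apply: test_fun_ae0 => // phi tphi.
have := Iop_weak_deriv x0 iq tphi.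
rewrite (_ : \int[mu]_(x in I01) (Iop x0 q x * _ x) = 0).
  by move=> /eqP; rewrite eq_sym oppr_eq0 => /eqP.
rewrite -[RHS](rint_cst01 0); apply: ae_eq_rint01.
by apply: (ae_imp q0) => x H Ix; rewrite H// mul0r.
Qed.

(** By duality [Afun x0 a phi] pairs the twice integrated [a] with [phi]. So that function vanishes,
    and integration from [x0] is injective. *)
Lemma initial_value_eq0 : {ae mu, forall x, x \in `]0, 1[ -> a x = 0}.
Proof.
have ia := in_L2_rintegrable aL.
have [mb [mb0 X_le X_eq]] := laplace_moment_bounds.
have A0 := Afun_eq0 x001 bp0 pP ia alpha01 T0 mb0 laplace_moment_lin X_le X_eq.
have iI := bm01_rintegrable (Iop_bm01 x0 ia).
apply: Iop_ae0 => //; apply: Iop_ae0 => //.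
apply: test_fun_ae0 => [|phi tphi]; first by apply: bm01_rintegrable; exact: Iop_bm01.
have bphi := test_fun_bm01 tphi; have ip := bm01_rintegrable bphi.
rewrite -[RHS](A0 phi bphi) /Afun /Istar2 -IopE//; last first.
  by apply: bm01_rintegrable; exact: Istar_bm01.
rewrite (eq_rint (g := fun x => phi x * Iop x0 (Iop x0 a) x)); last by move=> x _; rewrite mulrC.
by rewrite (IopE x0 iI ip); apply: eq_rint => x _; exact: mulrC.
Qed.

Lemma moment_eq0 (h : R -> R) : bm01 h -> {ae mu, forall t, t \in `]0, T[ -> moment h t = 0}.
Proof.
move=> bh; have ia := in_L2_rintegrable aL.
have [mb [mb0 X_le X_eq]] := laplace_moment_bounds.
have D := X_decay x001 bp0 pP ia alpha01 T0 mb0 laplace_moment_lin X_le X_eq bh.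
have [U iU UE] := moment_rep bh.
(* [X_decay] with [d = T / n.+2 / 2] gives decay at rate [b n]. These intervals exhaust []0, T[],
   and [n.+2] keeps [b n] positive. *)
pose b n : R := T - T / n.+2%:R.
have Z n : {ae mu, forall t, t \in `]0, b n[ -> U t = 0}.
  have d0 : 0 < T / n.+2%:R / 2 by rewrite !divr_gt0.
  have [C CP] := D _ d0.
  apply: (@laplace_decay_ae0 R (b n) T C) => // [|m m1].
    apply/andP; split; last by rewrite /b gerBl divr_ge0// ltW.
    by rewrite /b subr_gt0 gtr_pMr// invf_lt1 ?ltr1n// ltr0n.
  have := CP m%:R; rewrite ler1n => /(_ m1); rewrite (laplace_moment_ae _ UE).
  by rewrite (_ : T - 2 * (T / n.+2%:R / 2) = b n)// /b; field; rewrite -natr1 gt_eqF// ltr_wpDl.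
have {}Z : {ae mu, forall t, forall n, t \in `]0, b n[ -> U t = 0} by apply/ae_foralln.
apply: (ae_imp2 UE Z) => t Ut Zt tT; rewrite Ut//.
have /andP[t0 tT'] : 0 < t < T by move: tT; rewrite in_itv.
have dT : 0 < T - t by rewrite subr_gt0.
pose n := Num.truncn (T / (T - t)); apply: (Zt n); rewrite in_itv/= t0/= /b.
rewrite ltrBrDr -ltrBrDl ltr_pdivrMr// mulrC -ltr_pdivrMr//.
by apply: lt_trans (truncnS_gt _) _; rewrite ltr_nat.
Qed.

Lemma solution_eq0 : {ae mu, forall t, t \in `]0, T[ ->
  {ae mu, forall x, x \in `]0, 1[ -> u t x = 0}}.
Proof.
(* Rational endpoints are countable, so one null set of times serves all of them; dominated
   convergence then reaches every [x]. *)
pose r (z : nat * nat) : R := z.2%:R / z.1.+1%:R.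
pose h (z : nat * nat) : R -> R := \1_(`]0, r z[%classic).
have bh z : bm01 (h z).
  split; first by apply: measurable_indic; exact: measurable_itv.
  by exists 1 => x _; rewrite /h indicE ger0_norm// lern1 leq_b1.
have H : {ae mu, forall t, forall n k, t \in `]0, T[ -> moment (h (n, k)) t = 0}.
  by apply/ae_foralln => n; apply/ae_foralln => k; exact: moment_eq0.
apply: (ae_imp2 u_H1 H) => t uH Ht tT.
have [uL _] := uH tT; have iu := in_L2_rintegrable uL; have mu_ := rintegrable_measurable iu.
apply: ae_eq0_primitive => // x /andP[x0' x1].
pose k n := Num.truncn (x * n.+1%:R).
have rx n : x - n.+1%:R^-1 < r (n, k n) <= x.
  have n0 : 0 < n.+1%:R :> R by rewrite ltr0n.
  have xn : 0 <= x * n.+1%:R by rewrite mulr_ge0// ltW.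
  rewrite /r /=; apply/andP; split.
    by rewrite ltr_pdivlMr// mulrBl mulVf ?gt_eqF// ltrBlDr natr1 truncnS_gt.
  by rewrite ler_pdivrMr// truncn_le.
have [|||||_ cv] := @rint_dominated R I01 (fun n y => u t y * h (n, k n) y)
  (fun y => u t y * \1_(`]0, x[%classic) y) (fun y => `|u t y|) mI.
- by move=> n; apply: measurable_funM => //; case: (bh (n, k n)).
- by apply: measurable_funM => //; exact: measurable_indic.
- exact: rintegrable_norm.
- by move=> n y _; rewrite normrM ler_piMr// /h indicE ger0_norm// lern1 leq_b1.
- apply: aeW => y; rewrite /= in_itv/= => /andP[y0 y1].
  apply: cvgM; first exact: cvg_cst.
  apply: cvg_near_cst; rewrite /h !indicE !mem_setE.
  have [yx|xy] := ltP y x; last first.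
    apply: nearW => n; rewrite !indicE !mem_setE /= !in_itv/= y0/=.
    have /andP[_ rx'] := rx n.
    by rewrite !ltNge xy (le_trans rx' xy).
  have xy0 : 0 < x - y by rewrite subr_gt0.
  exists (Num.truncn (x - y)^-1) => // n /= nn; rewrite !indicE !mem_setE /= !in_itv/= y0/= yx.
  have /andP[rx' _] := rx n; rewrite (lt_trans _ rx')//.
  rewrite ltrBrDr -ltrBrDl invf_plt ?posrE ?ltr0n//.
  by apply: lt_le_trans (truncnS_gt _) _; rewrite ler_nat.
have E : \int[mu]_(y in I01) (u t y * \1_(`]0, x[%classic) y) = 0.
  apply: (cvg_unique _ cv) => //.
  rewrite (_ : (fun n => _) = (fun=> 0)); first exact: cvg_cst.
  by apply/funext => n; exact: Ht.
rewrite -[RHS]E; apply/esym; apply: rint01_indic => //; rewrite ?(ltW x1)//.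
- by move=> y _ yx; rewrite indicE mem_set ?mulr1//= in_itv.
- by move=> y _ yx; rewrite indicE memNset ?mulr0//= in_itv/=; exact/negP.
Qed.

End Uniqueness.

(** Clipping [p] at an almost everywhere bound gives a representative bounded at every point, as the
    resolvent estimates require. *)
Lemma in_Linfty_rep (R : realType) (p : R -> R) : in_Linfty p ->
  exists P p0, [/\ bm01 p0, forall x, (`]0, 1[%classic : set R) x -> `|p0 x| <= P &
    {ae @lebesgue_measure R, forall x, x \in `]0, 1[ -> p x = p0 x}].
Proof.
move=> /in_Linfty_bdd[mp [P pP]].
exists (Num.max P 0), (fun x => Num.max (- Num.max P 0) (Num.min (p x) (Num.max P 0))).
have M0 : 0 <= Num.max P 0 by rewrite le_max lexx orbT.
set M := Num.max P 0 in M0 *.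
have bd x : `|Num.max (- M) (Num.min (p x) M)| <= M.
  by rewrite ler_norml le_max lexx/= ge_max ge_min lexx orbT andbT; lra.
split => //.
  split; last by exists M => x _; exact: bd.
  by apply: measurable_maxr => //; apply: measurable_minr.
apply: (ae_imp pP) => x H x01; have := H x01.
move=> /le_trans-/(_ M); rewrite le_max lexx => /(_ isT).
rewrite ler_norml => /andP[h1 h2].
by rewrite minEle h2 maxEle h1.
Qed.

Theorem theorem1p2 (R : realType) (alpha T x0 : R) (p a : R -> R)
    (u : R -> R -> R^o)
    (halpha : 0 < alpha < 1) (hT : 0 < T) (hx0 : 0 < x0 < 1)
    (hp : in_Linfty p) (ha : in_L2 a)
    (hu : L2_valued (@H1norm R) T u)
    (hua : H_alpha (@Hm1norm R) alpha T (fun t => embed (fun x => u t x - a x)))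
    (heq : {ae (@lebesgue_measure R), forall t, t \in `]0, T[ ->
      Hm1norm (dt_alpha (@Hm1norm R) alpha T
                 (fun s => embed (fun x => u s x - a x)) t
               - distr_dxx (u t) + embed (fun x => p x * u t x)) = 0%E})
    (htr0 : {ae (@lebesgue_measure R), forall t, t \in `]0, T[ ->
      trace (RL_integral (@H1norm R) alpha u t) x0 = 0})
    (htr1 : {ae (@lebesgue_measure R), forall t, t \in `]0, T[ ->
      trace (weak_deriv (RL_integral (@H1norm R) alpha u t)) x0 = 0}) :
  {ae (@lebesgue_measure R), forall t, t \in `]0, T[ ->
    {ae (@lebesgue_measure R), forall x, x \in `]0, 1[ -> u t x = 0}} /\
  {ae (@lebesgue_measure R), forall x, x \in `]0, 1[ -> a x = 0}.
Proof.
have [P [p0 [bp0 pP pp0]]] := in_Linfty_rep hp.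
split.
  exact: (solution_eq0 halpha hT hx0 bp0 pP pp0 ha hu hua heq htr0 htr1).
exact: (initial_value_eq0 halpha hT hx0 bp0 pP pp0 ha hu hua heq htr0 htr1).
Qed.
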